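(* Let $m\ge2$, let $i\in\{1,\dots,m-1\}$ with $(i,2m)=1$, and let $\lambda=e^{\pi\sqrt{-1}/m}$. Let $H=\mathcal{B}_{4m}$ act (inner-faithfully) by $\pi_i(u,v)$ on $A=A^-=\Bbbk\langle u,v\rangle/(u^2-\lambda^iv^2)$. Then $$A^H=\Bbbk[u^2,\,(uv)^m-(vu)^m],$$ a commutative polynomial ring on the two displayed (algebraically independent) generators, and hence $\mathcal{B}_{4m}$ is a reflection Hopf algebra for $A^-$.
   Context: Ground field $\Bbbk=\mathbb{C}$. A connected graded algebra $A$ is AS regular of dimension $d$ if it has finite global dimension $d$, finite Gelfand–Kirillov dimension, and $\mathrm{Ext}^k_A(\Bbbk,A)=\delta_{k,d}\cdot\Bbbk(l)$ for some $l\in\mathbb{Z}$. An action of $H$ on an $H$-module algebra $A$ is inner-faithful if the only Hopf ideal $I$ of $H$ with $I\cdot A=0$ is $0$. $A^H=\{a\in A: h\cdot a=\epsilon(h)a\ \forall h\in H\}$. A semisimple Hopf algebra $H$ acting inner-faithfully and preserving the grading on an AS regular $H$-module algebra $A$ is a reflection Hopf algebra for $A$ if $A^H$ is AS regular. ''$H$ acts by $V$ on $A$'' means that $A$ is generated in degree 1, $A_1=V$ as an $H$-module, and the action is extended to $A$ by $h\cdot(ab)=\sum(h_{(1)}\cdot a)(h_{(2)}\cdot b)$. $\mathcal{B}_{4m}$ (Masuoka), $m\ge2$: generated by $a,s_+,s_-$ with $a$ central and grouplike, $a^2=1$, $s_\pm^2=1$, $(s_+s_-)^m=a$. With $e_0=(1+a)/2$,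 $e_1=(1-a)/2$: $\Delta(s_\pm)=s_\pm\otimes e_0s_\pm+s_\mp\otimes e_1s_\pm$, $\epsilon(s_\pm)=1$, $S(s_\pm)=e_0s_\pm+e_1s_\mp$. $\pi_i(u,v)$ is the two-dimensional module with ordered basis $u,v$ and $s_+u=v$, $s_+v=u$, $s_-u=\lambda^iv$, $s_-v=\lambda^{-i}u$, $a$ acting by $(-1)^i$. *)

(* Defs.v *)
From HB Require Import structures.
From mathcomp Require Import all_boot all_order all_algebra.
From mathcomp Require Import complex finmap.
From mathcomp Require Import all_classical all_reals.
From mathcomp Require Import ereal sequences exp trigo.
(* The notations of multinomials are incompatible with those of analysis. *)
From mathcomp Require Import -(notations) mpoly monalg.

Set Implicit Arguments.
Unset Strict Implicit.
Unset Printing Implicit Defensive.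

Import Order.TTheory GRing.Theory Num.Theory.

Local Open Scope classical_set_scope.
Local Open Scope ring_scope.

Notation "{ 'malg' G [ K ] }" := (@malg K G)
  (at level 0, G, K at level 2, format "{ 'malg'  G [ K ] }") : type_scope.
Notation "{ 'mpoly' T [ n ] }" := (mpoly n T)
  (at level 0, T, n at level 2, format "{ 'mpoly'  T [ n ] }") : type_scope.

Section MalgAlgebra.
Variables (K : comNzRingType) (M : monomType).
Implicit Types (k : K) (x y : {malg K[M]}).

Lemma malg_scalerAr k x y : k *: (x * y) = x * (k *: y).
Proof.
rewrite (malgMEw (fsubset_refl _) (msuppZ_le _ _)) malgME scaler_sumr.
apply: eq_bigr => k1 _; rewrite scaler_sumr; apply: eq_bigr => k2 _.
by apply/malgP => m; rewrite !mcoeffZ !mcoeffU mulrnAr mulrCA.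
Qed.

End MalgAlgebra.

(* The algebra K<X> of noncommutative polynomials: a copy of the algebra of the
   free monoid {fmonom X}, whose product is locked so that failing unifications
   do not unfold it. *)
Record free_alg (K : comNzRingType) (X : choiceType) :=
  Free { free_val : {malg K[fmonom X]} }.

HB.instance Definition _ K X := [isNew for @free_val K X].
HB.instance Definition _ K X := [Choice of free_alg K X by <:].

HB.lock Definition free_mul (K : comNzRingType) (X : choiceType)
  (p q : free_alg K X) : free_alg K X := Free (free_val p * free_val q).

Section FreeAlgebra.
Variables (K : comNzRingType) (X : choiceType).
Local Notation F := (free_alg K X).
Implicit Types p q r : F.

Lemma free_val_inj : injective (@free_val K X). Proof. exact: val_inj. Qed.

Definition free_add p q : F := Free (free_val p + free_val q).
Definition free_opp p : F := Free (- free_val p).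
Definition free_scale (k : K) p : F := Free (k *: free_val p).

Fact free_addA : associative free_add.
Proof. by move=> p q r; apply: free_val_inj; apply: addrA. Qed.
Fact free_addC : commutative free_add.
Proof. by move=> p q; apply: free_val_inj; apply: addrC. Qed.
Fact free_add0 : left_id (Free 0) free_add.
Proof. by move=> p; apply: free_val_inj; apply: add0r. Qed.
Fact free_addN : left_inverse (Free 0) free_opp free_add.
Proof. by move=> p; apply: free_val_inj; apply: addNr. Qed.

HB.instance Definition _ := GRing.isZmodule.Build F
  free_addA free_addC free_add0 free_addN.

Fact free_mulA : associative (@free_mul K X).
Proof. by move=> p q r; apply: free_val_inj; rewrite free_mul.unlock /= mulrA. Qed.
Fact free_mul1 : left_id (Free 1) (@free_mul K X).
Proof. by move=> p; apply: free_val_inj; rewrite free_mul.unlock /= mul1r. Qed.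
Fact free_mulr1 : right_id (Free 1) (@free_mul K X).
Proof. by move=> p; apply: free_val_inj; rewrite free_mul.unlock /= mulr1. Qed.
Fact free_mulDl : left_distributive (@free_mul K X) +%R.
Proof. by move=> p q r; apply: free_val_inj; rewrite free_mul.unlock /= mulrDl. Qed.
Fact free_mulDr : right_distributive (@free_mul K X) +%R.
Proof. by move=> p q r; apply: free_val_inj; rewrite free_mul.unlock /= mulrDr. Qed.
Fact free_one_neq0 : Free 1 != 0 :> F.
Proof. by apply/eqP => /(congr1 (@free_val K X)) /eqP; rewrite oner_eq0. Qed.

HB.instance Definition _ := GRing.Zmodule_isNzRing.Build F
  free_mulA free_mul1 free_mulr1 free_mulDl free_mulDr free_one_neq0.

Fact free_scaleA a b p : free_scale a (free_scale b p) = free_scale (a * b) p.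
Proof. by apply: free_val_inj; apply: scalerA. Qed.
Fact free_scale1 : left_id 1 free_scale.
Proof. by move=> p; apply: free_val_inj; apply: scale1r. Qed.
Fact free_scaleDr : right_distributive free_scale +%R.
Proof. by move=> k p q; apply: free_val_inj; apply: scalerDr. Qed.
Fact free_scaleDl p : {morph free_scale^~ p : a b / a + b}.
Proof. by move=> a b; apply: free_val_inj; apply: scalerDl. Qed.

HB.instance Definition _ := GRing.Zmodule_isLmodule.Build K F
  free_scaleA free_scale1 free_scaleDr free_scaleDl.

Lemma free_valD p q : free_val (p + q) = free_val p + free_val q.
Proof. by []. Qed.
Lemma free_valN p : free_val (- p) = - free_val p.
Proof. by []. Qed.
Lemma free_valZ k p : free_val (k *: p) = k *: free_val p.
Proof. by []. Qed.
Lemma free_val1 : free_val (1 : F) = 1.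
Proof. by []. Qed.
Lemma free_valM p q : free_val (p * q) = free_val p * free_val q.
Proof. by rewrite {1}/GRing.mul /= free_mul.unlock. Qed.

Fact free_scalerAl k p q : k *: (p * q) = (k *: p) * q.
Proof. by apply: free_val_inj; rewrite free_valZ !free_valM free_valZ scalerAl. Qed.
HB.instance Definition _ := GRing.Lmodule_isLalgebra.Build K F free_scalerAl.

Fact free_scalerAr k p q : k *: (p * q) = p * (k *: q).
Proof.
by apply: free_val_inj; rewrite free_valZ !free_valM free_valZ malg_scalerAr.
Qed.
HB.instance Definition _ := GRing.Lalgebra_isAlgebra.Build K F free_scalerAr.

End FreeAlgebra.

HB.lock Definition var (K : comNzRingType) (X : choiceType) (x : X) :
  free_alg K X := Free (mkmalgU (fmu x) 1).

Section FreeAlgebraTheory.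
Variables (K : comNzRingType) (X : choiceType).
Local Notation free_alg := (free_alg K X).

Definition homogeneous (n : nat) (p : free_alg) : Prop :=
  forall w : fmonom X, mcoeff w (free_val p) != 0 -> fdeg w = n.

Variable f : X -> K.

Definition word_val (w : fmonom X) : K := \prod_(x <- (w : seq X)) f x.

Fact word_val_mmorphism : mmorphism word_val.
Proof.
split=> [w1 w2|]; rewrite /word_val; first by rewrite fmM big_cat.
by rewrite fm1 big_nil.
Qed.

HB.instance Definition _ :=
  isMultiplicative.Build (fmonom X) K word_val word_val_mmorphism.

Definition character (p : free_alg) : K := mmap idfun word_val (free_val p).

Fact character_zmod_morphism : zmod_morphism character.
Proof. by move=> p q; rewrite /character -raddfB. Qed.

HB.instance Definition _ :=
  GRing.isZmodMorphism.Build free_alg K character character_zmod_morphism.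

Fact character_monoid_morphism : monoid_morphism character.
Proof.
rewrite /character; split=> [|p q]; first by rewrite free_val1 rmorph1.
by rewrite free_valM rmorphM.
Qed.

HB.instance Definition _ :=
  GRing.isMonoidMorphism.Build free_alg K character character_monoid_morphism.

Lemma character_var x : character (var K x) = f x.
Proof.
by rewrite /character var.unlock /= mmapU /= mul1r /word_val fmU big_seq1.
Qed.

Lemma characterZ c p : character (c *: p) = c * character p.
Proof. exact: mmapZ. Qed.

Lemma ex_character : exists2 chi : {rmorphism free_alg -> K},
  forall x, chi (var K x) = f x & forall c p, chi (c *: p) = c * chi p.
Proof. by exists character; [exact: character_var|exact: characterZ]. Qed.

End FreeAlgebraTheory.

Section Quotient.
Variables (K : fieldType) (F : algType K).

Record ideal := Ideal {
  ideal_set :> F -> Prop;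
  ideal0 : ideal_set 0;
  idealD : forall x y, ideal_set x -> ideal_set y -> ideal_set (x + y);
  idealMl : forall x y, ideal_set y -> ideal_set (x * y);
  idealMr : forall x y, ideal_set x -> ideal_set (x * y);
  ideal1 : ~ ideal_set 1 }.

Variable I : ideal.

Definition ideal_mem : {pred F} := fun x => `[< I x >].

Lemma ideal_memP x : reflect (I x) (x \in ideal_mem).
Proof. exact: asboolP. Qed.

Lemma ideal_zmod_closed : zmod_closed ideal_mem.
Proof.
split=> [|x y /ideal_memP Ix /ideal_memP Iy]; apply/ideal_memP.
  exact: ideal0.
by apply: idealD => //; rewrite -mulN1r; apply: idealMl.
Qed.

HB.instance Definition _ := GRing.isZmodClosed.Build F ideal_mem
  ideal_zmod_closed.

Definition quotient : Type := Quotient.quot ideal_mem.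

HB.instance Definition _ := GRing.Zmodule.on quotient.
HB.instance Definition _ := Quotient.on quotient.

Definition quo (x : F) : quotient := (\pi_(Quotient.quot ideal_mem) x)%qT.

Lemma quoP x y : quo x = quo y <-> I (x - y).
Proof.
rewrite /quo; split=> [/eqP|h].
  by rewrite -Quotient.idealrBE => /ideal_memP.
by apply/eqP; rewrite -Quotient.idealrBE; apply/ideal_memP.
Qed.

Lemma quo_surj (z : quotient) : exists x, quo x = z.
Proof. by exists (repr z); rewrite /quo reprK. Qed.

Lemma quo_is_zmod_morphism : zmod_morphism quo.
Proof. by move=> x y; rewrite /quo raddfB. Qed.

HB.instance Definition _ :=
  GRing.isZmodMorphism.Build F quotient quo quo_is_zmod_morphism.

Definition quo_repr (z : quotient) : F := repr (z : Quotient.quot ideal_mem).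

Lemma quo_reprK z : quo (quo_repr z) = z.
Proof. exact: reprK. Qed.

End Quotient.

HB.lock Definition quo_mul (K : fieldType) (F : algType K) (I : ideal F)
  (z t : quotient I) : quotient I := quo I (quo_repr z * quo_repr t).

Section QuotientAlgebra.
Variables (K : fieldType) (F : algType K) (I : ideal F).
Local Notation quotient := (quotient I).
Local Notation quo := (quo I).
Local Notation quo_mul := (@quo_mul K F I).

Definition quo_one := quo 1.
Definition quo_scale (k : K) (z : quotient) : quotient :=
  quo (k *: quo_repr z).

Lemma quo_mulE x y : quo_mul (quo x) (quo y) = quo (x * y).
Proof.
rewrite quo_mul.unlock; apply/quoP; set x' := quo_repr _; set y' := quo_repr _.
have Ix : I (x' - x) by apply/quoP; apply: quo_reprK.
have Iy : I (y' - y) by apply/quoP; apply: quo_reprK.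
rewrite -[_ - _](subrKA (x' * y)) -mulrBr -mulrBl.
by apply: idealD; [apply: idealMl | apply: idealMr].
Qed.

Lemma quo_scaleE k x : quo_scale k (quo x) = quo (k *: x).
Proof.
apply/quoP; rewrite -scalerBr -[_ - _]mul1r scalerAl.
by apply/idealMl/quoP; apply: quo_reprK.
Qed.

Fact quo_mulA : associative quo_mul.
Proof.
by move=> a b c; rewrite -[a]quo_reprK -[b]quo_reprK -[c]quo_reprK !quo_mulE mulrA.
Qed.

Fact quo_mul1 : left_id quo_one quo_mul.
Proof. by move=> a; rewrite -[a]quo_reprK quo_mulE mul1r. Qed.

Fact quo_mulr1 : right_id quo_one quo_mul.
Proof. by move=> a; rewrite -[a]quo_reprK quo_mulE mulr1. Qed.

Fact quo_mulDl : left_distributive quo_mul +%R.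
Proof.
move=> a b c; rewrite -[a]quo_reprK -[b]quo_reprK -[c]quo_reprK.
by rewrite -raddfD !quo_mulE mulrDl raddfD.
Qed.

Fact quo_mulDr : right_distributive quo_mul +%R.
Proof.
move=> a b c; rewrite -[a]quo_reprK -[b]quo_reprK -[c]quo_reprK.
by rewrite -raddfD !quo_mulE mulrDr raddfD.
Qed.

Fact quo_one_neq0 : quo_one != 0.
Proof.
by apply/eqP => /esym; rewrite -(raddf0 quo) => /esym/quoP; rewrite subr0; apply: ideal1.
Qed.

HB.instance Definition _ := GRing.Zmodule_isNzRing.Build quotient
  quo_mulA quo_mul1 quo_mulr1 quo_mulDl quo_mulDr quo_one_neq0.

Fact quo_scaleA a b z : quo_scale a (quo_scale b z) = quo_scale (a * b) z.
Proof. by rewrite -[z]quo_reprK !quo_scaleE scalerA. Qed.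

Fact quo_scale1 : left_id 1 quo_scale.
Proof. by move=> z; rewrite -[z]quo_reprK quo_scaleE scale1r. Qed.

Fact quo_scaleDr : right_distributive quo_scale +%R.
Proof.
move=> a z t; rewrite -[z]quo_reprK -[t]quo_reprK.
by rewrite -raddfD !quo_scaleE scalerDr raddfD.
Qed.

Fact quo_scaleDl z : {morph quo_scale^~ z : a b / a + b}.
Proof. by move=> a b; rewrite -[z]quo_reprK !quo_scaleE scalerDl raddfD. Qed.

HB.instance Definition _ := GRing.Zmodule_isLmodule.Build K quotient
  quo_scaleA quo_scale1 quo_scaleDr quo_scaleDl.

Lemma quo_is_monoid_morphism : monoid_morphism quo.
Proof. by split=> // x y; rewrite -quo_mulE. Qed.

HB.instance Definition _ :=
  GRing.isMonoidMorphism.Build F quotient quo quo_is_monoid_morphism.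

Lemma quo_is_scalable : scalable quo.
Proof. by move=> k x; rewrite -quo_scaleE. Qed.

HB.instance Definition _ :=
  GRing.isScalable.Build K F quotient *:%R quo quo_is_scalable.

Fact quo_scalerAl (k : K) (z t : quotient) : k *: (z * t) = (k *: z) * t.
Proof.
rewrite -[z]quo_reprK -[t]quo_reprK.
by rewrite -rmorphM -!quo_is_scalable -rmorphM scalerAl.
Qed.

Fact quo_scalerAr (k : K) (z t : quotient) : k *: (z * t) = z * (k *: t).
Proof.
rewrite -[z]quo_reprK -[t]quo_reprK.
by rewrite -rmorphM -!quo_is_scalable -rmorphM scalerAr.
Qed.

HB.instance Definition _ :=
  GRing.Lmodule_isLalgebra.Build K quotient quo_scalerAl.
HB.instance Definition _ :=
  GRing.Lalgebra_isAlgebra.Build K quotient quo_scalerAr.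

End QuotientAlgebra.

Section GeneratedIdeal.
Variables (K : fieldType) (F : algType K) (rels : seq F).

Definition gen_ideal (p : F) : Prop :=
  exists2 s : seq (F * F * F), (forall t, t \in s -> t.1.2 \in rels) &
    p = \sum_(t <- s) t.1.1 * t.1.2 * t.2.

Fact gen_ideal0 : gen_ideal 0.
Proof. by exists [::]; rewrite ?big_nil. Qed.

Fact gen_idealD p q : gen_ideal p -> gen_ideal q -> gen_ideal (p + q).
Proof.
move=> [s hs ->] [t ht ->]; exists (s ++ t); last by rewrite big_cat.
by move=> w; rewrite mem_cat => /orP[/hs|/ht].
Qed.

Fact gen_idealMl p q : gen_ideal q -> gen_ideal (p * q).
Proof.
move=> [s hs ->]; exists [seq (p * t.1.1, t.1.2, t.2) | t <- s].
  by move=> _ /mapP[t /hs ht ->].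
by rewrite big_map mulr_sumr; apply: eq_bigr => t _; rewrite !mulrA.
Qed.

Fact gen_idealMr p q : gen_ideal p -> gen_ideal (p * q).
Proof.
move=> [s hs ->]; exists [seq (t.1.1, t.1.2, t.2 * q) | t <- s].
  by move=> _ /mapP[t /hs ht ->].
by rewrite big_map mulr_suml; apply: eq_bigr => t _; rewrite !mulrA.
Qed.

Definition rel_ideal (h : ~ gen_ideal 1) : ideal F :=
  Ideal gen_ideal0 gen_idealD gen_idealMl gen_idealMr h.

Lemma gen_ideal_proper (B : comNzRingType) (chi : {rmorphism F -> B}) :
  (forall r, r \in rels -> chi r = 0) -> ~ gen_ideal 1.
Proof.
move=> chi0 [s hs] /(congr1 chi) /eqP; rewrite rmorph1 rmorph_sum /=.
rewrite big_seq big1 ?oner_eq0 // => t /hs /chi0 ht.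
by rewrite !rmorphM ht mulr0 mul0r.
Qed.

End GeneratedIdeal.

(* K<u,v>/(u^2 - q v^2), with u and v the variables true and false. *)
Section Aminus.
Variables (K : fieldType) (q : K).

Definition Aminus_rels : seq (free_alg K bool) :=
  [:: var K true ^+ 2 - q *: var K false ^+ 2].

Fact Aminus_proper : ~ gen_ideal Aminus_rels 1.
Proof.
have [chi chiX chiZ] := ex_character (fun _ : bool => 0 : K).
apply: (gen_ideal_proper (chi := chi)) => r; rewrite inE => /eqP ->.
by rewrite rmorphB chiZ !rmorphXn !chiX expr0n mulr0 subrr.
Qed.

Definition Aminus : algType K := quotient (rel_ideal Aminus_proper).

Definition Aminus_u : Aminus := quo _ (var K true).
Definition Aminus_v : Aminus := quo _ (var K false).

Definition Aminus_gr (n : nat) : set Aminus :=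
  [set x | exists2 p, homogeneous n p & x = quo _ p].

End Aminus.

(* The variables None, Some true, Some false stand for a, s_+, s_-. *)
Section B4m.
Variables (K : fieldType) (m : nat).

Definition B4m_rels : seq (free_alg K (option bool)) :=
  let a := var K None in
  let sp := var K (Some true) in
  let sm := var K (Some false) in
  [:: a * sp - sp * a; a * sm - sm * a; a ^+ 2 - 1; sp ^+ 2 - 1; sm ^+ 2 - 1;
      (sp * sm) ^+ m - a].

Fact B4m_proper : ~ gen_ideal B4m_rels 1.
Proof.
have [chi chiX _] := ex_character (fun _ : option bool => 1 : K).
apply: (gen_ideal_proper (chi := chi)) => r.
rewrite !inE => /or4P[|||/or3P[]] /eqP ->;
by rewrite rmorphB ?rmorphXn ?rmorphM ?rmorph1 !chiX ?mulr1 ?expr1n ?subrr.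
Qed.

Definition B4m : algType K := quotient (rel_ideal B4m_proper).

Definition B4m_a : B4m := quo _ (var K None).
Definition B4m_sp : B4m := quo _ (var K (Some true)).
Definition B4m_sm : B4m := quo _ (var K (Some false)).
Definition B4m_e0 : B4m := 2^-1 *: (1 + B4m_a).
Definition B4m_e1 : B4m := 2^-1 *: (1 - B4m_a).

End B4m.

Section Tensors.
Variable K : fieldType.
Implicit Types U V W Z : lmodType K.

(* A finite sum of pure tensors \sum_i x_i (x) y_i is represented by the list
   of the pairs (x_i, y_i); by the universal property, two lists represent the
   same element of U (x) V iff no bilinear map distinguishes them. *)
Definition tensor_eq U V (s t : seq (U * V)) : Prop :=
  forall (W : lmodType K) (b : U -> V -> W),
    (forall x, linear (b x)) -> (forall y, linear (b^~ y)) ->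
  \sum_(p <- s) b p.1 p.2 = \sum_(p <- t) b p.1 p.2.

Definition tensor3_eq U V W (s t : seq (U * V * W)) : Prop :=
  forall (Z : lmodType K) (b : U -> V -> W -> Z),
    (forall x y, linear (b x y)) -> (forall x z, linear (fun y => b x y z)) ->
    (forall y z, linear (fun x => b x y z)) ->
  \sum_(p <- s) b p.1.1 p.1.2 p.2 = \sum_(p <- t) b p.1.1 p.1.2 p.2.

End Tensors.

Section Hopf.
Variables (K : fieldType) (H : algType K).

Record hopf_structure := HopfStructure {
  comul : H -> seq (H * H);
  counit : {lrmorphism H -> K^o};
  antipode : {linear H -> H};
  comulP : forall c x y, tensor_eq (comul (c *: x + y))
    ([seq (c *: p.1, p.2) | p <- comul x] ++ comul y);
  comul1 : tensor_eq (comul 1) [:: (1, 1)];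
  comulM : forall x y, tensor_eq (comul (x * y))
    [seq (p.1 * q.1, p.2 * q.2) | p <- comul x, q <- comul y];
  coassoc : forall x,
    tensor3_eq [seq (q.1, q.2, p.2) | p <- comul x, q <- comul p.1]
               [seq (p.1, q.1, q.2) | p <- comul x, q <- comul p.2];
  counitl : forall x, \sum_(p <- comul x) counit p.1 *: p.2 = x;
  counitr : forall x, \sum_(p <- comul x) counit p.2 *: p.1 = x;
  antipodel : forall x,
    \sum_(p <- comul x) antipode p.1 * p.2 = counit x *: 1;
  antipoder : forall x,
    \sum_(p <- comul x) p.1 * antipode p.2 = counit x *: 1 }.

Definition left_ideal (I : set H) : Prop :=
  [/\ I 0, forall x y, I x -> I y -> I (x + y) & forall x y, I y -> I (x * y)].

Definition semisimple : Prop :=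
  forall I, left_ideal I -> exists J, [/\ left_ideal J,
    forall x, exists y z, [/\ I y, J z & x = y + z] &
    forall x, I x -> J x -> x = 0].

Variable hs : hopf_structure.

Definition hopf_ideal (I : set H) : Prop :=
  [/\ left_ideal I, forall x y, I x -> I (x * y),
      (* comul maps I into I (x) H + H (x) I *)
      forall x, I x -> exists2 t, tensor_eq (comul hs x) t &
                         forall p, p \in t -> I p.1 \/ I p.2,
      forall x, I x -> counit hs x = 0 &
      forall x, I x -> I (antipode hs x)].

Record module_algebra (A : algType K) := ModuleAlgebra {
  act :> H -> A -> A;
  act_linear : forall h, linear (act h);
  act_linearl : forall x, linear (act^~ x);
  act1 : forall x, act 1 x = x;
  actM : forall g h x, act (g * h) x = act g (act h x);
  act_one : forall h, act h 1 = counit hs h *: 1;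
  act_mul : forall h x y,
    act h (x * y) = \sum_(p <- comul hs h) act p.1 x * act p.2 y }.

Section Action.
Variables (A : algType K) (act : module_algebra A).

Definition inner_faithful : Prop :=
  forall I, hopf_ideal I -> (forall h x, I h -> act h x = 0) ->
  forall h, I h -> h = 0.

Definition preserves_grading (gr : nat -> set A) : Prop :=
  forall n h x, gr n x -> gr n (act h x).

Definition invariants : {pred A} :=
  fun x => `[< forall h, act h x = counit hs h *: x >].

Lemma invariantsP x :
  reflect (forall h, act h x = counit hs h *: x) (x \in invariants).
Proof. exact: asboolP. Qed.

Lemma invariants_subalg_closed : subalg_closed invariants.
Proof.
split=> [|c x y /invariantsP hx /invariantsP hy|
          x y /invariantsP hx /invariantsP hy].
- by apply/invariantsP => h; rewrite act_one.
- apply/invariantsP => h.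
  by rewrite act_linear hx hy scalerDr !scalerA [c * _]mulrC.
- apply/invariantsP => h; rewrite act_mul.
  under eq_bigr do rewrite hx hy -scalerAl -scalerAr scalerA.
  rewrite -scaler_suml; congr (_ *: _).
  rewrite -[in RHS](counitl hs h) raddf_sum; apply: eq_bigr => p _.
  by symmetry; apply: (linearZ_LR (counit hs)).
Qed.

HB.instance Definition _ := GRing.isSubalgClosed.Build K A invariants
  (GRing.subalg_closed_semi invariants_subalg_closed).

Definition invariant_ring : Type := {x : A | x \in invariants}.

HB.instance Definition _ := SubChoice.on invariant_ring.
HB.instance Definition _ := [SubChoice_isSubAlgebra of invariant_ring by <:].

End Action.

End Hopf.

Section Gradings.

(* M is the direct sum of its subgroups gr i. *)
Definition direct_sum (I : eqType) (M : zmodType) (gr : I -> set M) : Prop :=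
  [/\ forall i, gr i 0 /\ (forall x y, gr i x -> gr i y -> gr i (x - y)),
      forall x, exists (s : seq I) (f : I -> M),
        (forall i, gr i (f i)) /\ x = \sum_(i <- s) f i &
      forall (s : seq I) (f : I -> M), uniq s -> (forall i, gr i (f i)) ->
        \sum_(i <- s) f i = 0 -> forall i, i \in s -> f i = 0].

Variables (K : fieldType) (A : algType K) (gr : nat -> set A).

Definition connected_graded : Prop :=
  [/\ direct_sum gr,
      forall i j x y, gr i x -> gr j y -> gr (i + j)%N (x * y) &
      gr 0%N = range (fun c : K => c%:A)].

Definition grZ (j : int) : set A := if j is Posz n then gr n else [set 0].

Definition graded_module (M : lmodType A) (grM : int -> set M) : Prop :=
  direct_sum grM /\
  forall (i : nat) (j : int) a x,
    gr i a -> grM j x -> grM (i%:Z + j) (a *: x).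

End Gradings.

Section GKdim.
Variables (R : realType) (K : fieldType) (A : algType K).

Definition lin_indep (s : seq A) : Prop :=
  forall c : nat -> K, \sum_(i < size s) c i *: s`_i = 0 ->
  forall i, (i < size s)%N -> c i = 0.

Definition dim_span (s : seq A) : nat :=
  \max_(b : (size s).-tuple bool | `[< lin_indep (mask b s) >])
    size (mask b s).

(* the products of at most n elements of V *)
Fixpoint products (V : seq A) (n : nat) : seq A :=
  if n is n'.+1 then
    products V n' ++ [seq x * y | x <- V, y <- products V n']
  else [:: 1].

(* sup over the finite-dimensional subspaces, each given by a finite spanning
   family V, of limsup_n log_n dim (\sum_(i <= n) V^i) *)
Definition GKdim : \bar R :=
  ereal_sup [set limn_esup (fun n : nat =>
      (ln (dim_span (products V n))%:R / ln n%:R)%:E) | V in [set: seq A]].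

End GKdim.

Section Homological.
Variables (K : fieldType) (A : algType K).

Definition projective (P : lmodType A) : Prop :=
  forall (M N : lmodType A) (g : {linear M -> N}) (f : {linear P -> N}),
    (forall y, exists x, g x = y) ->
  exists h : {linear P -> M}, forall x, g (h x) = f x.

Record resolution (M : lmodType A) := Resolution {
  res_mod :> nat -> lmodType A;
  res_d : forall n, {linear res_mod n.+1 -> res_mod n};
  res_aug : {linear res_mod 0%N -> M};
  res_proj : forall n, projective (res_mod n);
  res_surj : forall y, exists x, res_aug x = y;
  res_exact0 : forall x, res_aug x = 0 <-> exists y, x = res_d 0 y;
  res_exact : forall n x, res_d n x = 0 <-> exists y, x = res_d n.+1 y }.

Definition pd_le (M : lmodType A) (n : nat) : Prop :=
  exists P : resolution M, forall k, (n < k)%N -> forall x : P k, x = 0.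

Definition gldim_le (n : nat) : Prop := forall M : lmodType A, pd_le M n.

Definition gldim_eq (d : nat) : Prop :=
  gldim_le d /\ forall n, gldim_le n -> (d <= n)%N.

(* K as the A-module obtained by restriction of scalars along eps *)
Definition aug_module (eps : {lrmorphism A -> K^o}) : Type := K.

Section AugModule.
Variable eps : {lrmorphism A -> K^o}.

HB.instance Definition _ := GRing.Zmodule.on (aug_module eps).

Definition aug_scale (a : A) (c : aug_module eps) : aug_module eps :=
  (eps a : K) * c.

Fact aug_scaleA a b c : aug_scale a (aug_scale b c) = aug_scale (a * b) c.
Proof. by rewrite /aug_scale rmorphM mulrA. Qed.
Fact aug_scale1 : left_id 1 aug_scale.
Proof. by move=> c; rewrite /aug_scale rmorph1 mul1r. Qed.
Fact aug_scaleDr : right_distributive aug_scale +%R.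
Proof. by move=> a c d; rewrite /aug_scale mulrDr. Qed.
Fact aug_scaleDl c : {morph aug_scale^~ c : a b / a + b}.
Proof. by move=> a b; rewrite /aug_scale rmorphD mulrDl. Qed.

HB.instance Definition _ := GRing.Zmodule_isLmodule.Build A (aug_module eps)
  aug_scaleA aug_scale1 aug_scaleDr aug_scaleDl.

End AugModule.

Variable gr : nat -> set A.

Record graded_resolution (eps : {lrmorphism A -> K^o}) := GradedResolution {
  gres :> resolution (aug_module eps);
  gres_gr : forall n, int -> set (gres n);
  gres_graded : forall n, graded_module gr (@gres_gr n);
  gres_d : forall n j x, @gres_gr n.+1 j x -> @gres_gr n j (res_d gres n x);
  gres_aug : forall j x, j != 0 -> @gres_gr 0%N j x -> res_aug gres x = 0 }.

Section Ext.
Variables (eps : {lrmorphism A -> K^o}) (P : graded_resolution eps).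

(* The n-cochains of degree j are the A-linear maps P_n -> A of degree j;
   Ext^n_A(k, A)_j is the quotient of the n-cocycles by the n-coboundaries. *)
Definition cochain (n : nat) (j : int) (f : {linear P n -> A^o}) : Prop :=
  forall t x, @gres_gr eps P n t x -> grZ gr (t + j) (f x).

Definition cocycle n j (f : {linear P n -> A^o}) : Prop :=
  cochain j f /\ forall y, f (res_d P n y) = 0.

Definition coboundary (n : nat) : int -> {linear P n -> A^o} -> Prop :=
  match n with
  | 0 => fun _ f => forall x, f x = 0
  | n'.+1 => fun j f => exists g : {linear P n' -> A^o},
      cochain j g /\ forall x, f x = g (res_d P n' x)
  end.

Definition Ext_zero (n : nat) (j : int) : Prop :=
  forall f, @cocycle n j f -> @coboundary n j f.

Definition Ext_line (n : nat) (j : int) : Prop :=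
  exists2 f0, @cocycle n j f0 /\ ~ @coboundary n j f0 &
  forall f, @cocycle n j f -> exists c : K,
    exists2 b, @coboundary n j b & forall x, f x = c *: (f0 x : A) + b x.

End Ext.

(* Ext^n_A(k, A) = delta_{n,d} k(l).  The component of degree j of k(l) is
   k_(l+j), and a graded right A-module of dimension 1 is a shift of k. *)
Definition Ext_condition (d : nat) : Prop :=
  exists (eps : {lrmorphism A -> K^o}) (P : graded_resolution eps) (l : int),
    (forall n x, (0 < n)%N -> gr n x -> eps x = 0) /\
    forall n j, if (n == d) && (j == - l) then Ext_line P n j
                else Ext_zero P n j.

End Homological.

Definition AS_regular (R : realType) (K : fieldType) (A : algType K)
    (gr : nat -> set A) (d : nat) : Prop :=
  [/\ connected_graded gr, gldim_eq A d, (GKdim R A < +oo)%E &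
      Ext_condition gr d].

Section Reflection.
Variables (R : realType) (K : fieldType) (H : algType K).
Variables (hs : hopf_structure H) (A : algType K) (act : module_algebra hs A).
Variable gr : nat -> set A.

Definition invariant_gr (n : nat) : set (invariant_ring act) :=
  [set x | gr n (val x)].

Definition reflection_hopf_algebra : Prop :=
  [/\ semisimple H, inner_faithful act, preserves_grading act gr,
      exists d, AS_regular R gr d & exists d, AS_regular R invariant_gr d].

End Reflection.

Section Masuoka.
Variables (K : fieldType) (m : nat).
Local Notation H := (B4m K m).
Local Notation a := (B4m_a K m).
Local Notation sp := (B4m_sp K m).
Local Notation sm := (B4m_sm K m).
Local Notation e0 := (B4m_e0 K m).
Local Notation e1 := (B4m_e1 K m).

Definition masuoka_structure (hs : hopf_structure H) : Prop :=
  [/\ tensor_eq (comul hs a) [:: (a, a)] /\ counit hs a = 1,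
      tensor_eq (comul hs sp) [:: (sp, e0 * sp); (sm, e1 * sp)],
      tensor_eq (comul hs sm) [:: (sm, e0 * sm); (sp, e1 * sm)],
      counit hs sp = 1 /\ counit hs sm = 1 &
      antipode hs sp = e0 * sp + e1 * sm /\
      antipode hs sm = e0 * sm + e1 * sp].

Definition acts_by_pi (lam : K) (i : nat) (hs : hopf_structure H)
    (A : algType K) (u v : A) (act : module_algebra hs A) : Prop :=
  [/\ act sp u = v /\ act sp v = u,
      act sm u = lam ^+ i *: v /\ act sm v = lam ^- i *: u &
      act a u = (-1) ^+ i *: u /\ act a v = (-1) ^+ i *: v].

End Masuoka.

Definition lambda (R : realType) (m : nat) : R[i] :=
  (cos (pi / m%:R) +i* sin (pi / m%:R))%C.

(* Main.v *)
Require Import Defs.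
From HB Require Import structures.
From mathcomp Require Import all_boot all_order all_algebra.
From mathcomp Require Import finmap complex all_classical all_reals.
From mathcomp Require Import ereal sequences exp trigo.
From mathcomp Require Import -(notations) mpoly monalg.
From mathcomp Require Import zify ring.

Set Implicit Arguments.
Unset Strict Implicit.
Unset Printing Implicit Defensive.

Import Order.TTheory GRing.Theory Num.Theory.
Local Open Scope classical_set_scope.
Local Open Scope ring_scope.

(** Write q = lambda^i, z = u^2, w = (uv)^m - (vu)^m and r = s_+ s_-.

    Regularity. If s^2 = q, then x = u + s v and y = u - s v satisfy y x = - x y,
    and the products x^i y^j form a basis of A: the algebra A is a quantum plane
    [Aminus_quantum_plane]. A polynomial ring in two variables is a quantum plane
    too, with y x = x y, and its variables may have any positive degrees. Hence
    both A and its ring of invariants are covered by one theorem,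
    [quantum_plane_AS_regular]. For a quantum plane Q and a Q-module M, put
    T = Q (x) M, the tensor product over the ground field. The Koszul complex
    0 -> T -> T + T -> T -> M -> 0 is exact [koszul_exact0, koszul_exact1,
    koszul_exact2], because its differentials are triangular with respect to the
    exponents of x and y; and T is projective [projective_tens], because
    surjective linear maps between vector spaces split. This bounds the global
    dimension by 2. For the trivial module the same complex gives the extension
    groups [qplane_Ext] and excludes a smaller dimension [gldim_ge2].

    Invariants. The element z is central and invariant, and A is spanned over
    k[z] by the alternating words (uv)^k, (vu)^k, (uv)^k u and (vu)^k v. These are
    eigenvectors of r, with eigenvalues q^(-2k), q^(2k), q^(2k+1) and q^(-2k-1).
    As q is a primitive 2m-th root of unity, the Reynolds operator kills all the
    words but (uv)^(mj) and (vu)^(mj), which it maps to multiples of the sums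
    (uv)^(mj) + (-1)^j (vu)^(mj). Newton's recursion for power sums expresses
    these in w and in (uv)^m (vu)^m, which is a scalar multiple of z^(2m)
    [power_sums]; so z and w generate the invariants [invariants_generated].
    A representation of A by matrices over k[S, T] shows that z and w are
    algebraically independent [z_w_free].

    The Hopf algebra. It is generated by the dihedral group of r and s_+, so that
    its elements are P(r) + s_+ Q(r) with polynomials P and Q, and Maschke's
    averaging argument makes it semisimple [dihedral_semisimple]. If such an
    element annihilates A, its action on the words shows that P and Q vanish at all
    the 2m-th roots of unity, so that it is 0: the action is faithful
    [act_faithful], and in particular inner-faithful. *)

(** * Subspaces of vector spaces of arbitrary dimension *)

Section LinearSection.
Variable K : fieldType.

Definition subspace (V : lmodType K) (W : set V) : Prop :=
  W 0 /\ forall c x y, W x -> W y -> W (c *: x + y).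

(** Zorn's lemma, applied to the linearly closed sets that meet [W] at most in
    0; the empty set has to be allowed as the bound of the empty chain. *)
Lemma subspace_complement (V : lmodType K) (W : set V) : subspace W ->
  exists C : set V, [/\ subspace C, forall x, W x -> C x -> x = 0 &
    forall v, exists w c, [/\ W w, C c & v = w + c]].
Proof.
move=> [W0 Wlin].
pose P (X : set V) := (forall c x y, X x -> X y -> X (c *: x + y)) /\
  (forall x, W x -> X x -> x = 0).
have [F FP Ftot|C [[Clin CW] Cmax]] := @Zorn_bigcup V P.
  split=> [c x y [X FX Xx] [Y FY Yy]|x Wx [X FX Xx]].
    have [XY|YX] := Ftot _ _ FX FY.
      by exists Y => //; apply: (FP _ FY).1 => //; exact: XY.
    by exists X => //; apply: (FP _ FX).1 => //; exact: YX.
  exact: (FP _ FX).2.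
have C0 : C 0.
  apply: contrapT => nC0; apply: (Cmax (C `|` [set 0])).
    by split=> [z Cz|/(_ 0 (or_intror erefl))//]; left.
  split=> [c x y|x Wx [/CW->//|//]].
  case=> [Cx|->]; case=> [Cy|->].
  - by left; apply: Clin.
  - left; have := Clin (c - 1) x x Cx Cx.
    by rewrite scalerBl scale1r subrK addr0.
  - by rewrite scaler0 add0r; left.
  - by right; rewrite scaler0 add0r.
exists C; split=> // v; apply: contrapT => nv.
pose B := [set z | exists d c, C c /\ z = d *: v + c].
apply: (Cmax B); split.
- by move=> z Cz; exists 0, z; rewrite scale0r add0r.
- move=> /(_ v) Cv; apply: nv; exists 0, v; split; rewrite ?add0r //.
  by apply: Cv; exists 1, 0; rewrite scale1r addr0.
- move=> c _ _ [d [a [Ca ->]]] [e [b [Cb ->]]].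
  exists (c * d + e), (c *: a + b); split; first exact: Clin.
  by rewrite scalerDr scalerA addrACA -scalerDl.
move=> z Wz [d [c [Cc def_z]]]; rewrite def_z in Wz *.
have [d0|d0] := eqVneq d 0.
  by move: Wz; rewrite d0 scale0r add0r => Wc; apply: CW.
case: nv; exists (d^-1 *: (d *: v + c)), (- (d^-1 *: c)); split.
- by have := Wlin d^-1 _ _ Wz W0; rewrite addr0.
- by have := Clin (- d^-1) _ _ Cc C0; rewrite addr0 scaleNr.
- by rewrite scalerDr scalerA mulVf // scale1r addrK.
Qed.

Lemma subspace_projection (V : lmodType K) (W : set V) : subspace W ->
  exists p : {linear V -> V}, (forall v, W (p v)) /\ (forall w, W w -> p w = w).
Proof.
move=> Wsub; have [W0 Wlin] := Wsub.
have [C [[C0 Clin] WC0 WC]] := subspace_complement Wsub.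
have WN z : W z -> W (- z) by move=> Wz; have := Wlin (-1) _ _ Wz W0; rewrite addr0 scaleN1r.
have CN z : C z -> C (- z) by move=> Cz; have := Clin (-1) _ _ Cz C0; rewrite addr0 scaleN1r.
have WD y z : W y -> W z -> W (y + z) by move=> Wy /(Wlin 1 _ _ Wy); rewrite scale1r.
have CD y z : C y -> C z -> C (y + z) by move=> Cy /(Clin 1 _ _ Cy); rewrite scale1r.
have /choice[p pP] : forall v, exists w, W w /\ C (v - w).
  move=> v; have [w [c [Ww Cc ->]]] := WC v.
  by exists w; rewrite addrC addKr.
have pE v w : W w -> C (v - w) -> p v = w.
  move=> Ww Cvw; apply/eqP; rewrite -subr_eq0; apply/eqP/WC0.
    by apply: WD; [exact: (pP v).1|exact: WN].
  have -> : p v - w = (v - w) - (v - p v) by rewrite opprB [RHS]addrC subrKA.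
  by apply: CD => //; apply/CN/(pP v).2.
have p_lin : linear p.
  move=> c x y; have [[Wx Cx] [Wy Cy]] := (pP x, pP y).
  apply: pE; first exact: Wlin.
  by rewrite opprD addrACA -scalerBr; apply: Clin.
pose pL := GRing.isLinear.Build K V V _ p p_lin.
pose ph : {linear V -> V} := HB.pack p pL.
exists ph; split=> [v|w Ww]; first exact: (pP v).1.
by apply: pE; rewrite ?subrr.
Qed.

(** This splitting is what makes the modules extended from the ground field
    projective, whatever their dimension. *)
Lemma linear_section (V U : lmodType K) (g : {linear V -> U}) :
  (forall y, exists x, g x = y) ->
  exists s : {linear U -> V}, forall y, g (s y) = y.
Proof.
move=> /choice[s0 s0K].
have [|p [gp pid]] := @subspace_projection V [set v | g v = 0].
  by split=> [|c x y /= gx gy]; rewrite /= ?raddf0 // linearP gx gy scaler0 addr0.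
pose t v := v - p v.
have tB a b : t (a - b) = t a - t b by rewrite /t raddfB opprD addrACA -opprD.
have tP c a b : t (c *: a + b) = c *: t a + t b.
  by rewrite /t linearP scalerBr opprD addrACA.
pose s y := t (s0 y).
have s_lin : linear s.
  move=> c a b; apply/eqP; rewrite -subr_eq0 -tP -tB; apply/eqP.
  rewrite /t pid ?subrr //=; by rewrite raddfB /= linearP !s0K subrr.
pose sL := GRing.isLinear.Build K U V _ s s_lin.
pose sh : {linear U -> V} := HB.pack s sL.
by exists sh => y; rewrite /= /s /t raddfB /= s0K [g (p _)]gp subr0.
Qed.

End LinearSection.

(** * Finitely supported families *)

(** Additive maps out of the direct sum of copies of [M] indexed by [I] are given
    by their components. *)
HB.lock Definition mlift (I : choiceType) (M N : zmodType)
    (f : I -> {additive M -> N}) (z : {malg M[I]}) : N :=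
  \sum_(k <- msupp z) f k (mcoeff k z).

Section FiniteFamilies.
Variables (I : choiceType) (M N : zmodType).
Implicit Types z : {malg M[I]}.

Lemma malg_add_ind (P : {malg M[I]} -> Prop) : P 0 ->
  (forall z1 z2, P z1 -> P z2 -> P (z1 + z2)) ->
  (forall k m, P (mkmalgU k m)) -> forall z, P z.
Proof.
move=> P0 PD PU z; rewrite (monalgE z).
by elim/big_rec: _ => // k z' _; apply: PD.
Qed.

Lemma malg_ext (f g : {additive {malg M[I]} -> N}) :
  (forall k m, f (mkmalgU k m) = g (mkmalgU k m)) -> f =1 g.
Proof.
move=> fg; apply: malg_add_ind => [|z1 z2 e1 e2|//]; first by rewrite !raddf0.
by rewrite !raddfD e1 e2.
Qed.

Variable f : I -> {additive M -> N}.

Local Notation mlift := (mlift f).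

Lemma mliftEw (d : {fset I}) z : (msupp z `<=` d)%fset ->
  mlift z = \sum_(k <- d) f k (mcoeff k z).
Proof.
move=> le; rewrite mlift.unlock [LHS](big_fset_incl _ le) => //= k _.
by move=> /mcoeff_outdom ->; apply: raddf0.
Qed.

Fact mlift_is_zmod_morphism : zmod_morphism mlift.
Proof.
move=> a b; pose E := (msupp a `|` msupp b)%fset.
rewrite (mliftEw (msuppB_le a b)) (mliftEw (fsubsetUl _ _ : _ `<=` E)%fset).
rewrite (mliftEw (fsubsetUr _ _ : _ `<=` E)%fset) -sumrB.
by apply/eq_bigr=> k _; rewrite !raddfB.
Qed.

HB.instance Definition _ :=
  GRing.isZmodMorphism.Build {malg M[I]} N mlift mlift_is_zmod_morphism.

Lemma mliftU k m : mlift (mkmalgU k m) = f k m.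
Proof. by rewrite (mliftEw msuppU_le) big_seq_fset1 mcoeffUU. Qed.

End FiniteFamilies.

(** * Quantum planes *)

Fact tens_key : unit. Proof. by []. Qed.

Section QuantumPlane.
Variables (K : fieldType) (A : algType K) (x y : A) (q : K).
Local Notation NN := (nat * nat)%type.
Implicit Types (k l : NN).

Definition qmon k : A := x ^+ k.1 * y ^+ k.2.

Definition qcomb (c : {malg K[NN]}) : A :=
  \sum_(k <- msupp c) mcoeff k c *: qmon k.

(** The algebra presented by [x], [y] and the relation y x = q x y; the presentation
    is encoded by the basis of normally ordered monomials, which also applies to an
    algebra that is constructed in another way. *)
Record quantum_plane : Prop := QuantumPlane {
  qp_neq0 : q != 0;
  qp_comm : y * x = q *: (x * y);
  qp_span : forall a, exists c, a = qcomb c;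
  qp_free : forall c, qcomb c = 0 -> c = 0 }.

Lemma qcombEw (d : {fset NN}) c : (msupp c `<=` d)%fset ->
  qcomb c = \sum_(k <- d) mcoeff k c *: qmon k.
Proof.
move=> le; rewrite [LHS](big_fset_incl _ le) => //= k _ /mcoeff_outdom ->.
by rewrite scale0r.
Qed.

Fact qcomb_is_zmod_morphism : zmod_morphism qcomb.
Proof.
move=> a b; pose E := (msupp a `|` msupp b)%fset.
rewrite (qcombEw (msuppB_le a b)) (qcombEw (fsubsetUl _ _ : _ `<=` E)%fset).
rewrite (qcombEw (fsubsetUr _ _ : _ `<=` E)%fset) -sumrB.
by apply/eq_bigr=> k _; rewrite mcoeffB scalerBl.
Qed.

HB.instance Definition _ :=
  GRing.isZmodMorphism.Build {malg K[NN]} A qcomb qcomb_is_zmod_morphism.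

Lemma qcombU k c : qcomb (mkmalgU k c) = c *: qmon k.
Proof. by rewrite (qcombEw msuppU_le) big_seq_fset1 mcoeffUU. Qed.

Lemma mulX_qmon k : x * qmon k = qmon (k.1.+1, k.2).
Proof. by rewrite /qmon mulrA -exprS. Qed.

Section Commutation.
Hypothesis yx : y * x = q *: (x * y).

Lemma commX j i : y ^+ j * x ^+ i = q ^+ (j * i) *: (x ^+ i * y ^+ j).
Proof.
have cx : y * x ^+ i = q ^+ i *: (x ^+ i * y).
  elim: i => [|i IH]; first by rewrite !expr0 mulr1 mul1r scale1r.
  rewrite exprS mulrA yx -scalerAl -[x * y * _]mulrA IH -scalerAr.
  by rewrite scalerA mulrA -!exprS.
elim: j => [|j IH]; first by rewrite !expr0 mulr1 mul1r scale1r.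
rewrite (exprS y) -[y * _ * _]mulrA IH -scalerAr (mulrA y) cx -scalerAl scalerA.
by rewrite -mulrA mulSn exprD (mulrC (q ^+ i)).
Qed.

Lemma mulY_qmon k : y * qmon k = q ^+ k.1 *: qmon (k.1, k.2.+1).
Proof.
by rewrite /qmon mulrA -[y]expr1 commX mul1n -scalerAl -mulrA -exprD.
Qed.

(** Normal ordering reduces a spanning family to closure under multiplication by
    the generators. *)
Lemma quantum_plane_intro : q != 0 ->
  (forall P : A -> Prop, P 1 -> (forall a b, P a -> P b -> P (a + b)) ->
    (forall c a, P a -> P (c *: a)) -> (forall a, P a -> P (x * a)) ->
    (forall a, P a -> P (y * a)) -> forall a, P a) ->
  (forall c, qcomb c = 0 -> c = 0) -> quantum_plane.
Proof.
move=> q0 gen free; split=> //; apply: gen.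
- by exists (mkmalgU (0%N, 0%N) 1); rewrite qcombU scale1r /qmon !expr0 mulr1.
- by move=> a b [c ->] [d ->]; exists (c + d); rewrite raddfD.
- move=> c a [d ->]; elim/malg_add_ind: d => [|d e [d' hd] [e' he]|k d].
  + by exists 0; rewrite raddf0 scaler0.
  + by exists (d' + e'); rewrite !raddfD /= hd he.
  + by exists (mkmalgU k (c * d)); rewrite !qcombU scalerA.
- move=> a [d ->]; elim/malg_add_ind: d => [|d e [d' hd] [e' he]|k d].
  + by exists 0; rewrite raddf0 mulr0.
  + by exists (d' + e'); rewrite [qcomb (d + e)]raddfD mulrDr hd he raddfD.
  + by exists (mkmalgU (k.1.+1, k.2) d); rewrite !qcombU -scalerAr mulX_qmon.
move=> a [d ->]; elim/malg_add_ind: d => [|d e [d' hd] [e' he]|k d].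
- by exists 0; rewrite raddf0 mulr0.
- by exists (d' + e'); rewrite [qcomb (d + e)]raddfD mulrDr hd he raddfD.
exists (mkmalgU (k.1, k.2.+1) (d * q ^+ k.1)).
by rewrite !qcombU -scalerAr mulY_qmon scalerA.
Qed.

End Commutation.

Hypothesis QP : quantum_plane.

Definition qcoef (a : A) : {malg K[NN]} := sval (cid (qp_span QP a)).

Lemma qcoefK : cancel qcoef qcomb.
Proof. by move=> a; rewrite /qcoef; case: cid. Qed.

Lemma qcombK : cancel qcomb qcoef.
Proof.
move=> c; apply/eqP; rewrite -subr_eq0; apply/eqP/(qp_free QP).
by rewrite raddfB /= qcoefK subrr.
Qed.

Fact qcoef_is_zmod_morphism : zmod_morphism qcoef.
Proof. exact: (can2_zmod_morphism qcombK qcoefK). Qed.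

HB.instance Definition _ :=
  GRing.isZmodMorphism.Build A {malg K[NN]} qcoef qcoef_is_zmod_morphism.

Lemma qcoef_mon c k : qcoef (c *: qmon k) = mkmalgU k c.
Proof. by rewrite -qcombU qcombK. Qed.

Lemma qplane_ind (P : A -> Prop) : P 0 ->
  (forall a b, P a -> P b -> P (a + b)) ->
  (forall c k, P (c *: qmon k)) -> forall a, P a.
Proof.
move=> P0 PD PU a; rewrite -[a]qcoefK; move: (qcoef a); apply: malg_add_ind.
- by rewrite raddf0.
- by move=> b c; rewrite raddfD; apply: PD.
- by move=> k c; rewrite qcombU.
Qed.

Lemma qmon0 : qmon (0%N, 0%N) = 1.
Proof. by rewrite /qmon !expr0 mulr1. Qed.

Lemma qmonM k l :
  qmon k * qmon l = q ^+ (k.2 * l.1) *: qmon (k.1 + l.1, k.2 + l.2)%N.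
Proof.
rewrite /qmon /= !exprD -mulrA [y ^+ k.2 * _]mulrA (commX (qp_comm QP)) -scalerAl.
by rewrite -scalerAr !mulrA.
Qed.

(** * Extension of scalars to a quantum plane *)

(** The vector space underlying an [A]-module: a separate name is needed, as the
    same type carries the structure of a module over [A] and over [K]. *)
Definition vspace_of (M : lmodType A) : Type := M.

Section VSpaceOf.
Variable M : lmodType A.

HB.instance Definition _ := GRing.Zmodule.on (vspace_of M).

Definition vscale (c : K) (m : vspace_of M) : vspace_of M := c%:A *: (m : M).

Fact vscaleA c d m : vscale c (vscale d m) = vscale (c * d) m.
Proof. by rewrite /vscale scalerA -scalerAl mul1r scalerA. Qed.
Fact vscale1 : left_id 1 vscale.
Proof. by move=> m; rewrite /vscale !scale1r. Qed.
Fact vscaleDr : right_distributive vscale +%R.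
Proof. by move=> c m n; rewrite /vscale scalerDr. Qed.
Fact vscaleDl m : {morph vscale^~ m : c d / c + d}.
Proof. by move=> c d; rewrite /vscale !scalerDl. Qed.

HB.instance Definition _ := GRing.Zmodule_isLmodule.Build K (vspace_of M)
  vscaleA vscale1 vscaleDr vscaleDl.

(** The module A (x) M over the ground field: the family z stands for the tensor
    \sum_k x^k.1 y^k.2 (x) z_k. *)
Definition tens of quantum_plane : Type := {malg M[NN]}.
Local Notation T := (tens QP).

HB.instance Definition _ := GRing.Zmodule.on T.

Definition tens_mon k (m : M) : T := mkmalgU k m.
Definition tens_coef k (z : T) : M := mcoeff k z.

Fact tens_mon_is_zmod_morphism k : zmod_morphism (tens_mon k).
Proof. exact: monalgU_is_additive. Qed.
HB.instance Definition _ k :=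
  GRing.isZmodMorphism.Build M T (tens_mon k) (tens_mon_is_zmod_morphism k).

Fact tens_coef_is_zmod_morphism k : zmod_morphism (tens_coef k).
Proof. exact: mcoeff_is_additive. Qed.
HB.instance Definition _ k :=
  GRing.isZmodMorphism.Build T M (tens_coef k) (tens_coef_is_zmod_morphism k).

Lemma tens_coef_mon k l m : tens_coef l (tens_mon k m) = m *+ (k == l).
Proof. exact: mcoeffU. Qed.

Lemma tens_ind (P : T -> Prop) : P 0 ->
  (forall z1 z2, P z1 -> P z2 -> P (z1 + z2)) ->
  (forall k m, P (tens_mon k m)) -> forall z, P z.
Proof. exact: malg_add_ind. Qed.

Lemma tens_ext (N : zmodType) (f g : {additive T -> N}) :
  (forall k m, f (tens_mon k m) = g (tens_mon k m)) -> f =1 g.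
Proof. exact: malg_ext. Qed.

Lemma tensP (z t : T) : (forall k, tens_coef k z = tens_coef k t) -> z = t.
Proof. by move/malgP. Qed.

(** The action of c x^k.1 y^k.2 on the left factor of the tensors. *)
Definition tens_qmon k (c : K) : T -> T :=
  mlift (fun l => tens_mon (k.1 + l.1, k.2 + l.2)%N \o
                  GRing.scale (q ^+ (k.2 * l.1) * c)%:A).
HB.instance Definition _ k c := GRing.Additive.on (tens_qmon k c).

Lemma tens_qmonU k c l m : tens_qmon k c (tens_mon l m) =
  tens_mon (k.1 + l.1, k.2 + l.2)%N ((q ^+ (k.2 * l.1) * c)%:A *: m).
Proof. exact: mliftU. Qed.

Lemma tens_qmonB k z : zmod_morphism (tens_qmon k ^~ z).
Proof.
move=> c d; elim/tens_ind: z => [|z1 z2 e1 e2|l m].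
- by rewrite /= !raddf0 addr0.
- by rewrite /= in e1 e2 *; rewrite !raddfD /= e1 e2 addrACA.
- by rewrite /= !tens_qmonU -raddfB /= mulrBr scalerBl scalerBl.
Qed.

Lemma tens_qmonM k l c d z : tens_qmon k c (tens_qmon l d z) =
  tens_qmon (k.1 + l.1, k.2 + l.2)%N (c * d * q ^+ (k.2 * l.1)) z.
Proof.
move: z; apply: (@tens_ext _ (_ \o _) (tens_qmon _ _)) => p m /=.
rewrite !tens_qmonU /= !addnA scalerA -scalerAl mul1r scalerA.
congr (tens_mon _ (_%:A *: _)).
rewrite mulnDr mulnDl !exprD; ring.
Qed.

Lemma tens_qmon1 z : tens_qmon (0%N, 0%N) 1 z = z.
Proof.
move: z; apply: (@tens_ext _ (tens_qmon _ _) idfun) => p m.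
by rewrite /= tens_qmonU /= mul0n expr0 mulr1 !scale1r; case: p.
Qed.

Definition tens_qmon_at z k (c : K) : T := tens_qmon k c z.
HB.instance Definition _ z k := GRing.isZmodMorphism.Build K T
  (tens_qmon_at z k) (tens_qmonB k z).

Definition tens_act : A -> T -> T := locked_with tens_key
  (fun a z => mlift (tens_qmon_at z) (qcoef a)).

Lemma tens_actE a z : tens_act a z = mlift (tens_qmon_at z) (qcoef a).
Proof. by rewrite /tens_act locked_withE. Qed.

Lemma tens_act_qmon c k z : tens_act (c *: qmon k) z = tens_qmon k c z.
Proof. by rewrite tens_actE qcoef_mon mliftU. Qed.

Fact tens_actDl z : {morph tens_act^~ z : a b / a + b}.
Proof. by move=> a b; rewrite !tens_actE !raddfD. Qed.

Fact tens_act0 z : tens_act 0 z = 0.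
Proof. by rewrite tens_actE !raddf0. Qed.

Fact tens_actDr : right_distributive tens_act +%R.
Proof.
move=> a z t; elim/qplane_ind: a => [|a b ea eb|c k].
- by rewrite !tens_act0 addr0.
- by rewrite !tens_actDl ea eb addrACA.
- by rewrite !tens_act_qmon raddfD.
Qed.

Fact tens_actr0 a : tens_act a 0 = 0.
Proof. by apply: (addrI (tens_act a 0)); rewrite -tens_actDr !addr0. Qed.

Fact tens_actA a b z : tens_act a (tens_act b z) = tens_act (a * b) z.
Proof.
elim/qplane_ind: a => [|a a' ea ea'|c k].
- by rewrite mul0r !tens_act0.
- by rewrite mulrDl !tens_actDl ea ea'.
elim/qplane_ind: b => [|b b' eb eb'|d l].
- by rewrite mulr0 !tens_act0 tens_actr0.
- by rewrite mulrDr !tens_actDl tens_actDr eb eb'.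
by rewrite -scalerAl -scalerAr qmonM !scalerA !tens_act_qmon tens_qmonM.
Qed.

Fact tens_act1 : left_id 1 tens_act.
Proof. by move=> z; rewrite -qmon0 -[qmon _]scale1r tens_act_qmon tens_qmon1. Qed.

HB.instance Definition _ := GRing.Zmodule_isLmodule.Build A T
  tens_actA tens_act1 tens_actDr tens_actDl.

Lemma tens_scale_mon c k l m : (c *: qmon k) *: tens_mon l m =
  tens_mon (k.1 + l.1, k.2 + l.2)%N ((q ^+ (k.2 * l.1) * c)%:A *: m).
Proof. by rewrite -tens_qmonU -tens_act_qmon. Qed.

Lemma tens_monE k m : tens_mon k m = qmon k *: tens_mon (0%N, 0%N) m.
Proof.
rewrite -[qmon k]scale1r tens_scale_mon muln0 expr0 mulr1 !scale1r !addn0.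
by case: k.
Qed.
End VSpaceOf.

End QuantumPlane.

(** * The Koszul complex of a module over a quantum plane *)

Section Koszul.
Variables (K : fieldType) (A : algType K) (x y : A) (q : K).
Hypothesis QP : quantum_plane x y q.
Local Notation NN := (nat * nat)%type.
Implicit Types (k l : NN) (M N : lmodType A).
Local Notation mon := (qmon x y).
Local Notation T M := (tens M QP).

Lemma scalerAlA M (c : K) (a : A) (m : M) : (c *: a) *: m = c%:A *: (a *: m).
Proof. by rewrite scalerA -scalerAl mul1r. Qed.

Lemma scalerArA M (c : K) (a : A) (m : M) : (c *: a) *: m = a *: (c%:A *: m).
Proof. by rewrite scalerA -scalerAr mulr1. Qed.

Definition vmul M (a : A) (m : vspace_of M) : vspace_of M := a *: (m : M).

Fact vmul_is_linear M a : linear (@vmul M a).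
Proof.
move=> c m n; rewrite /vmul scalerDr; congr (_ + _).
by rewrite -[RHS]scalerAlA -[LHS]scalerArA.
Qed.
HB.instance Definition _ M a :=
  GRing.isLinear.Build K (vspace_of M) (vspace_of M) _ (@vmul M a)
    (vmul_is_linear a).

Definition tens_unit M (m : vspace_of M) : vspace_of (T M) :=
  tens_mon QP (0%N, 0%N) (m : M).

Fact tens_unit_is_linear M : linear (@tens_unit M).
Proof.
move=> c m n; rewrite /tens_unit raddfD; congr (_ + _).
rewrite -[RHS]/(c%:A *: tens_mon QP (0%N, 0%N) (m : M)) -(qmon0 x y).
by rewrite tens_scale_mon /= expr0 mul1r.
Qed.
HB.instance Definition _ M :=
  GRing.isLinear.Build K (vspace_of M) (vspace_of (T M)) _ (@tens_unit M)
    (@tens_unit_is_linear M).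

Section Lift.
Variables (M N : lmodType A) (f : {linear vspace_of M -> vspace_of N}).

Definition vraw (m : M) : N := f m.
Fact vraw_is_zmod_morphism : zmod_morphism vraw.
Proof. exact: (raddfB f). Qed.
HB.instance Definition _ :=
  GRing.isZmodMorphism.Build M N vraw vraw_is_zmod_morphism.

Lemma vraw_scale c m : vraw (c%:A *: m) = c%:A *: vraw m.
Proof. exact: (linearZ_LR f c (m : vspace_of M)). Qed.

(** The A-linear extension of a linear map along m |-> 1 (x) m. *)
Definition tens_lift : T M -> N := mlift (fun k => GRing.scale (mon k) \o vraw).
HB.instance Definition _ := GRing.Additive.on tens_lift.

Lemma tens_lift_mon k m : tens_lift (tens_mon QP k m) = mon k *: (f m : N).
Proof. exact: mliftU. Qed.

Fact tens_lift_is_scalable : scalable tens_lift.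
Proof.
move=> a z; elim/(qplane_ind QP): a => [|a b ea eb|c k].
- by rewrite !scale0r raddf0.
- by rewrite !scalerDl raddfD /= ea eb.
elim/tens_ind: z => [|z t ez et|l m].
- by rewrite !(scaler0, raddf0).
- by rewrite !(scalerDr, raddfD) /= ez et.
rewrite tens_scale_mon !tens_lift_mon /= scalerA -scalerAl (qmonM QP).
rewrite scalerA [RHS]scalerArA; congr (_ *: _).
by rewrite mulrC; exact: vraw_scale.
Qed.
HB.instance Definition _ :=
  GRing.isScalable.Build A (T M) N *:%R tens_lift tens_lift_is_scalable.

Lemma tens_lift_unit m : tens_lift (tens_unit m) = f m.
Proof. by rewrite tens_lift_mon qmon0 scale1r. Qed.

End Lift.

Lemma tens_linear_ext M N (f g : {linear T M -> N}) :
  (forall m : M, f (tens_unit m) = g (tens_unit m)) -> f =1 g.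
Proof.
move=> fg; apply: tens_ext => k m.
by rewrite /= tens_monE !linearZ_LR /=; congr (_ *: _); apply: fg.
Qed.

Lemma tens_monZ M k c (m : M) :
  tens_mon QP k (c%:A *: m) = (c *: mon k) *: tens_mon QP (0%N, 0%N) m.
Proof. by rewrite tens_scale_mon muln0 expr0 mul1r !addn0; case: k. Qed.

End Koszul.

(** The A-linear map 1 (x) m |-> a (x) m - 1 (x) b m, out of which all the Koszul
    differentials are built. *)
HB.lock Definition tens_diff (K : fieldType) (A : algType K) (x y : A) (q : K)
    (QP : quantum_plane x y q) (M : lmodType A) (a b : A) (z : tens M QP) :
    tens M QP :=
  @tens_lift K A x y q QP M (tens M QP)
    ((vmul a \o @tens_unit K A x y q QP M) \-
     (@tens_unit K A x y q QP M \o vmul b)) z.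
Arguments tens_diff {K A x y q QP M} a b z.

Section KoszulComplex.
Variables (K : fieldType) (A : algType K) (x y : A) (q : K).
Hypothesis QP : quantum_plane x y q.
Local Notation NN := (nat * nat)%type.
Implicit Types (k l : NN) (M N : lmodType A).
Local Notation mon := (qmon x y).
Local Notation T M := (tens M QP).

Local Notation tens_unit := (@tens_unit _ _ _ _ _ QP _).
Local Notation tens_lift := (@tens_lift _ _ _ _ _ QP _ _).

Fact tens_diff_is_linear M a b : linear (@tens_diff _ _ _ _ _ QP M a b).
Proof. by rewrite tens_diff.unlock => c z t; rewrite linearP. Qed.
HB.instance Definition _ M a b :=
  GRing.isLinear.Build A (T M) (T M) _ (@tens_diff _ _ _ _ _ QP M a b)
    (@tens_diff_is_linear M a b).

Lemma tens_coef0 M k : tens_coef k (0 : T M) = 0.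
Proof. exact: raddf0. Qed.
Lemma tens_coefD M k : {morph @tens_coef _ _ _ _ _ QP M k : z t / z + t}.
Proof. exact: raddfD. Qed.
Lemma tens_coefB M k : {morph @tens_coef _ _ _ _ _ QP M k : z t / z - t}.
Proof. exact: raddfB. Qed.

Lemma tens_diff_mon M a b k (m : M) : tens_diff a b (tens_mon QP k m : T M) =
  (mon k * a) *: tens_unit m - tens_mon QP k (b *: m).
Proof.
rewrite tens_diff.unlock [LHS]tens_lift_mon /= scalerBr scalerA.
by congr (_ - _); exact/esym/tens_monE.
Qed.

Lemma tens_diff_unit M a b (m : M) : tens_diff a b (tens_unit m) =
  a *: (tens_unit m : T M) - tens_unit (b *: m).
Proof. by rewrite tens_diff_mon qmon0 mul1r. Qed.

Lemma tens_diffY_mon M b i j (m : M) : tens_diff y b (tens_mon QP (i, j) m) =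
  tens_mon QP (i, j.+1) m - tens_mon QP (i, j) (b *: m).
Proof.
rewrite tens_diff_mon; congr (_ - _).
by rewrite [RHS]tens_monE /qmon /= -mulrA -exprSr.
Qed.

Lemma tens_diffX_mon M b i j (m : M) : tens_diff x b (tens_mon QP (i, j) m) =
  tens_mon QP (i.+1, j) ((q ^+ j)%:A *: m) - tens_mon QP (i, j) (b *: m).
Proof.
have qx : mon (i, j) * x = q ^+ j *: mon (i.+1, j).
  have x1 : x = mon (1%N, 0%N) by rewrite /qmon /= mulr1.
  by rewrite [X in _ * X]x1 (qmonM QP) /= muln1 addn1 addn0.
by rewrite tens_diff_mon qx (tens_monZ QP (i.+1, j)).
Qed.

(** This and the next formula express that the maps are triangular. Their
    injectivity follows, by descending induction on one exponent. *)
Lemma tens_diffY_coef M b i j (z : T M) : tens_coef (i, j.+1) (tens_diff y b z) =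
  tens_coef (i, j) z - b *: tens_coef (i, j.+1) z.
Proof.
elim/tens_ind: z => [|z t ez et|[k l] m]; first by rewrite linear0 !tens_coef0 scaler0 subr0.
  by rewrite linearD !tens_coefD ez et scalerDr opprD addrACA.
rewrite tens_diffY_mon tens_coefB !tens_coef_mon !xpair_eqE eqSS.
by rewrite scalerMnr.
Qed.

Lemma tens_diffX_coef M b i j (z : T M) : tens_coef (i.+1, j) (tens_diff x b z) =
  (q ^+ j)%:A *: tens_coef (i, j) z - b *: tens_coef (i.+1, j) z.
Proof.
elim/tens_ind: z => [|z t ez et|[k l] m].
- by rewrite linear0 !tens_coef0 !scaler0 subr0.
- by rewrite linearD !tens_coefD ez et !scalerDr opprD addrACA.
rewrite tens_diffX_mon tens_coefB !tens_coef_mon !xpair_eqE eqSS !scalerMnr.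
by case: (l =P j) => [->|_]; rewrite ?andbF ?mulr0n ?scaler0.
Qed.

Lemma tens_diffX_coef0 M b j (z : T M) : tens_coef (0%N, j) (tens_diff x b z) =
  - (b *: tens_coef (0%N, j) z).
Proof.
elim/tens_ind: z => [|z t ez et|[k l] m].
- by rewrite linear0 !tens_coef0 scaler0 oppr0.
- by rewrite linearD !tens_coefD ez et scalerDr opprD.
rewrite tens_diffX_mon tens_coefB !tens_coef_mon !xpair_eqE /= sub0r.
by rewrite scalerMnr.
Qed.

Lemma tens_coef_bound M (z : T M) :
  exists n, forall i j, (n <= i + j)%N -> tens_coef (i, j) z = 0.
Proof.
elim/tens_ind: z => [|z t [n hz] [p ht]|[i j] m].
- by exists 0%N => i j _; rewrite raddf0.
- exists (maxn n p) => i j; rewrite geq_max => /andP[hn hp].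
  by rewrite tens_coefD hz ?ht ?addr0.
exists (i + j).+1 => k l; rewrite tens_coef_mon xpair_eqE.
by case: eqP => // ->; case: eqP => // ->; rewrite ltnn.
Qed.

(** The coefficients in which y has a positive exponent already determine z. *)
Lemma tens_diffY_eq0 M b (z : T M) :
  (forall i j, tens_coef (i, j.+1) (tens_diff y b z) = 0) -> z = 0.
Proof.
move=> h; have [n zn] := tens_coef_bound z.
suff zk p : forall i j, (n <= i + j + p)%N -> tens_coef (i, j) z = 0.
  by apply: tensP => -[i j]; rewrite tens_coef0; apply: (zk n); lia.
elim: p => [|p IH] i j le; first by apply: zn; lia.
move: (h i j); rewrite tens_diffY_coef (IH i j.+1) ?scaler0 ?subr0 //; lia.
Qed.

Lemma tens_diffX_eq0 M b (z : T M) :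
  (forall i j, tens_coef (i.+1, j) (tens_diff x b z) = 0) -> z = 0.
Proof.
move=> h; have [n zn] := tens_coef_bound z.
suff zk p : forall i j, (n <= i + j + p)%N -> tens_coef (i, j) z = 0.
  by apply: tensP => -[i j]; rewrite tens_coef0; apply: (zk n); lia.
elim: p => [|p IH] i j le; first by apply: zn; lia.
move: (h i j); rewrite tens_diffX_coef (IH i.+1) ?scaler0 ?subr0; last by lia.
move/(congr1 (fun m => (q ^- j)%:A *: m)).
by rewrite scaler0 scalerA -scalerAl mul1r scalerA mulVf ?scale1r // expf_neq0 // (qp_neq0 QP).
Qed.

Definition koszul_aug M : {linear T M -> M} :=
  tens_lift (idfun : {linear vspace_of M -> vspace_of M}).

(** The kernel of the augmentation is generated by the tensors
    x (x) m - 1 (x) x m and y (x) m - 1 (x) y m. *)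
Definition koszul_d1 M (p : (T M * T M)%type) : T M :=
  tens_diff x x p.1 + tens_diff y y p.2.

Fact koszul_d1_is_linear M : linear (@koszul_d1 M).
Proof.
move=> a p r; rewrite /koszul_d1.
rewrite -[(a *: p + r).1]/(a *: p.1 + r.1) -[(a *: p + r).2]/(a *: p.2 + r.2).
by rewrite 2!linearP scalerDr addrACA.
Qed.
HB.instance Definition _ M := GRing.isLinear.Build A (T M * T M)%type (T M) _
  (@koszul_d1 M) (@koszul_d1_is_linear M).

(** The relation y x = q x y, differentiated. *)
Definition koszul_d2 M (z : T M) : (T M * T M)%type :=
  (tens_diff y (q *: y) z, - tens_diff (q *: x) x z).

Fact koszul_d2_is_linear M : linear (@koszul_d2 M).
Proof.
move=> a p r; rewrite /koszul_d2 2!linearP.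
by rewrite opprD -scalerN.
Qed.
HB.instance Definition _ M := GRing.isLinear.Build A (T M) (T M * T M)%type _
  (@koszul_d2 M) (@koszul_d2_is_linear M).

Lemma koszul_aug_unit M (m : M) : koszul_aug M (tens_unit m) = m.
Proof. exact: tens_lift_unit. Qed.

Lemma koszul_aug_d1 M p : koszul_aug M (koszul_d1 p) = 0.
Proof.
have aug_diff a z : koszul_aug M (tens_diff a a z) = 0.
  move: z; apply: (@tens_linear_ext _ _ _ _ _ QP _ _ (koszul_aug M \o tens_diff a a) \0) => m.
  by rewrite /= tens_diff_unit linearB /= linearZ_LR /= !koszul_aug_unit subrr.
by rewrite /koszul_d1 raddfD /= !aug_diff addr0.
Qed.

Lemma koszul_d1_d2 M (z : T M) : koszul_d1 (koszul_d2 z) = 0.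
Proof.
have cancel4 (V : zmodType) (a b c d : V) :
    (a - b) - (c - d) + (- (a - c) + (b - d)) = 0.
  rewrite !opprB addrACA [a - b + _]addrC subrKA.
  by rewrite [d - c + _]addrC subrKA addrC subrKA subrr.
move: z; apply: (@tens_linear_ext _ _ _ _ _ QP _ _ (@koszul_d1 M \o @koszul_d2 M) \0) => m.
rewrite /= /koszul_d1 /koszul_d2 /= !tens_diff_unit.
rewrite raddfN /= !raddfB /= !linearZ_LR /= !tens_diff_unit !scalerBr.
rewrite !scalerA.
have -> : tens_unit ((q *: y) *: m) = q%:A *: tens_unit (y *: m) :> T M.
  by rewrite scalerAlA; exact: (linearZ_LR tens_unit q (y *: m : vspace_of M)).
rewrite scalerN scalerBr !scalerA -!scalerAr mulr1 -scalerAl -(qp_comm QP) opprK.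
exact: cancel4.
Qed.

(** Modulo the image of d1, a tensor x^i y^j (x) m is congruent to
    1 (x) x^i y^j m. *)
Lemma koszul_exact0 M (z : T M) : koszul_aug M z = 0 -> exists p, z = koszul_d1 p.
Proof.
suff [p def_z] : exists p, z - tens_unit (koszul_aug M z) = koszul_d1 p.
  by move=> z0; exists p; rewrite -def_z z0 [tens_unit 0]raddf0 subr0.
elim/tens_ind: z => [|z t [p hz] [r ht]|[i j] m].
- by exists 0; rewrite !linear0 addr0.
- exists (p + r); rewrite [RHS]linearD /= -hz -ht linearD [tens_unit _]linearD.
  by rewrite opprD addrACA.
elim: j m => [|j IHj] m; last first.
  have [p hp] := IHj (y *: m); exists (p + (0, tens_mon QP (i, j) m)).
  rewrite linearD /= -hp {1}/koszul_d1 /= linear0 add0r tens_diffY_mon.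
  rewrite [RHS]addrC subrKA; congr (_ - tens_unit _).
  by rewrite /koszul_aug !tens_lift_mon /= scalerA /qmon /= exprSr mulrA.
elim: i m => [|i IHi] m.
  by exists 0; rewrite linear0 koszul_aug_unit subrr.
have [p hp] := IHi (x *: m); exists (p + (tens_mon QP (i, 0%N) m, 0)).
rewrite linearD /= -hp {1}/koszul_d1 /= linear0 addr0 tens_diffX_mon.
rewrite expr0 !scale1r [RHS]addrC subrKA; congr (_ - tens_unit _).
by rewrite /koszul_aug !tens_lift_mon /= scalerA /qmon /= !mulr1 exprSr.
Qed.

(** Once the first component of a cycle is free of y, the equation d1 = 0 forces
    the second component to vanish, by looking at the coefficients in which y has a
    positive exponent; then the first one vanishes as well. *)
Lemma koszul_exact1 M (p : (T M * T M)%type) : koszul_d1 p = 0 ->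
  exists z, p = koszul_d2 z.
Proof.
case: p => p1 p2 dp.
(* The first component of d2 rewrites y^(j+1) (x) m as y^j (x) q y m. *)
have [w p1w] : exists w, forall i j,
    tens_coef (i, j.+1) (p1 - tens_diff y (q *: y) w) = 0.
  elim/tens_ind: p1 {dp} => [|z t [p hz] [r ht]|[i j] m].
  - by exists 0 => i j; rewrite linear0 subrr tens_coef0.
  - exists (p + r) => i j; rewrite linearD opprD addrACA tens_coefD.
    by rewrite hz ht addr0.
  elim: j m => [|j IHj] m.
    by exists 0 => k l; rewrite linear0 subr0 tens_coef_mon xpair_eqE andbF.
  have [w hw] := IHj ((q *: y) *: m); exists (w + tens_mon QP (i, j) m) => k l.
  rewrite [tens_diff _ _ _]linearD /= tens_diffY_mon opprD opprB addrCA.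
  by rewrite [X in _ + X]addrC subrK addrC hw.
set p' := p1 - _ in p1w; pose p2' := p2 + tens_diff (q *: x) x w.
have dp' : tens_diff x x p' + tens_diff y y p2' = 0.
  have -> : tens_diff x x p' + tens_diff y y p2' =
      koszul_d1 (p1, p2) - koszul_d1 (koszul_d2 w).
    rewrite /koszul_d1 /= /p' /p2' linearB linearD linearN opprD opprK addrACA.
    by [].
  by rewrite dp koszul_d1_d2 subrr.
have p2'0 : p2' = 0.
  apply: (@tens_diffY_eq0 _ y) => i j.
  move/eqP: dp'; rewrite addr_eq0 eq_sym eqr_oppLR => /eqP ->.
  rewrite raddfN /=; case: i => [|i].
    by rewrite tens_diffX_coef0 p1w scaler0 !oppr0.
  by rewrite tens_diffX_coef !p1w !scaler0 subr0 oppr0.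
have p'0 : p' = 0.
  apply: (@tens_diffX_eq0 _ x) => i j.
  by move: dp'; rewrite p2'0 linear0 addr0 => ->; rewrite tens_coef0.
exists w; rewrite /koszul_d2; congr (_, _).
  by apply/eqP; rewrite -subr_eq0; apply/eqP.
by apply/eqP; rewrite -addr_eq0; apply/eqP.
Qed.

Lemma koszul_exact2 M (z : T M) : koszul_d2 z = 0 -> z = 0.
Proof.
move=> [dz _]; apply: (@tens_diffY_eq0 _ (q *: y)) => i j.
by rewrite dz tens_coef0.
Qed.

End KoszulComplex.

(** * Projective modules *)

Section Projective.
Variables (K : fieldType) (A : algType K).
Implicit Types (M N P Q : lmodType A).

Lemma projective_prod P Q :
  projective P -> projective Q -> projective (P * Q)%type.
Proof.
move=> projP projQ M N g f gsurj.
have inl_lin : linear (fun p : P => (p, 0) : P * Q).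
  by move=> a p p'; congr (_, _); rewrite /= scaler0 addr0.
have inr_lin : linear (fun p : Q => (0, p) : P * Q).
  by move=> a p p'; congr (_, _); rewrite /= scaler0 addr0.
pose inl : {linear P -> (P * Q)%type} :=
  HB.pack (fun p : P => (p, 0) : P * Q) (GRing.isLinear.Build A _ _ _ _ inl_lin).
pose inr : {linear Q -> (P * Q)%type} :=
  HB.pack (fun p : Q => (0, p) : P * Q) (GRing.isLinear.Build A _ _ _ _ inr_lin).
have [h hP] := projP _ _ g (f \o inl) gsurj.
have [k kP] := projQ _ _ g (f \o inr) gsurj.
exists ((h \o fst) \+ (k \o snd)) => -[p r] /=.
rewrite raddfD /= hP kP /= -raddfD /=; congr (f _).
by congr (_, _); rewrite ?addr0 ?add0r.
Qed.

Lemma projective_trivial P : (forall x : P, x = 0) -> projective P.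
Proof.
move=> P0 M N g f _; exists \0 => x.
by rewrite (P0 x) !linear0.
Qed.

Section Image.
Variables (X Y : lmodType A) (d : {linear X -> Y}).

Definition image_mem : {pred Y} := fun y => `[< exists x, d x = y >].

Lemma image_memP y : reflect (exists x, d x = y) (y \in image_mem).
Proof. exact: asboolP. Qed.

Fact image_submod_closed : submod_closed image_mem.
Proof.
split=> [|a _ _ /image_memP[x <-] /image_memP[x' <-]]; apply/image_memP.
  by exists 0; rewrite linear0.
by exists (a *: x + x'); rewrite linearP.
Qed.
HB.instance Definition _ := GRing.isSubmodClosed.Build A Y image_mem
  (GRing.submod_closed_semi image_submod_closed).

Definition image_module : Type := {y : Y | y \in image_mem}.
HB.instance Definition _ := SubChoice.on image_module.
HB.instance Definition _ := [SubChoice_isSubLmodule of image_module by <:].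

(** The step of the comparison of resolutions: projectivity is applied to the
    corestriction of d to its image. *)
Lemma projective_lift P (f : {linear P -> Y}) : projective P ->
  (forall p, exists x, f p = d x) ->
  exists h : {linear P -> X}, forall p, d (h p) = f p.
Proof.
move=> projP fd.
have f_im p : f p \in image_mem.
  by apply/image_memP; have [x ->] := fd p; exists x.
have d_im x : d x \in image_mem by apply/image_memP; exists x.
pose f' p : image_module := Sub (f p) (f_im p).
pose d' x : image_module := Sub (d x) (d_im x).
have f'_lin : linear f' by move=> a p p'; apply: val_inj; rewrite [RHS]linearP /= linearP.
have d'_lin : linear d' by move=> a p p'; apply: val_inj; rewrite [RHS]linearP /= linearP.
pose fL : {linear P -> image_module} :=
  HB.pack f' (GRing.isLinear.Build A _ _ _ f' f'_lin).
pose dL : {linear X -> image_module} :=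
  HB.pack d' (GRing.isLinear.Build A _ _ _ d' d'_lin).
have [|h hP] := projP _ _ dL fL.
  by move=> [y hy]; have /image_memP[x dx] := hy; exists x; apply: val_inj.
by exists h => p; have /(congr1 val) := hP p.
Qed.

End Image.
End Projective.

Section KoszulResolution.
Variables (K : fieldType) (A : algType K) (x y : A) (q : K).
Hypothesis QP : quantum_plane x y q.
Implicit Types (M N : lmodType A).
Local Notation T M := (tens M QP).

(** The A-linear maps out of A (x) M are the linear maps out of M, and these lift
    along surjections because the latter have linear sections. *)
Lemma projective_tens M : projective (T M).
Proof.
move=> N' N g f gsurj.
have restrict_linear (U V : lmodType A) (h : {linear U -> V}) :
    linear (h : vspace_of U -> vspace_of V).
  by move=> c u v; apply: (linearP h).
pose restr (U V : lmodType A) (h : {linear U -> V}) :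
    {linear vspace_of U -> vspace_of V} :=
  HB.pack (h : vspace_of U -> vspace_of V)
    (GRing.isLinear.Build K _ _ _ _ (restrict_linear _ _ h)).
have [s gs] := @linear_section K _ _ (restr _ _ g) gsurj.
exists (tens_lift (QP := QP) (s \o restr _ _ f \o @tens_unit _ _ _ _ _ QP M)).
apply: (@tens_linear_ext _ _ _ _ _ QP _ _ (g \o _) f) => m.
rewrite [LHS]/= tens_lift_unit; exact: gs.
Qed.

Definition koszul_mod M n : lmodType A :=
  match n with
  | 0 => T M
  | 1 => (T M * T M)%type
  | 2 => T M
  | _ => 'rV[A]_0
  end.

Definition koszul_d M n : {linear koszul_mod M n.+1 -> koszul_mod M n} :=
  match n with
  | 0 => @koszul_d1 _ _ _ _ _ QP M
  | 1 => @koszul_d2 _ _ _ _ _ QP M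
  | _ => \0
  end.

Lemma koszul_mod_trivial M n (z : koszul_mod M n.+3) : z = 0.
Proof. by apply/rowP; case. Qed.

Fact koszul_projective M n : projective (koszul_mod M n).
Proof.
case: n => [|[|[|n]]]; try exact: projective_tens.
  by apply: projective_prod; apply: projective_tens.
exact/projective_trivial/koszul_mod_trivial.
Qed.

Fact koszul_surj M (m : M) : exists z : koszul_mod M 0, koszul_aug QP M z = m.
Proof. by exists (tens_unit QP m); rewrite koszul_aug_unit. Qed.

Fact koszul_exact_aug M (z : koszul_mod M 0) :
  koszul_aug QP M z = 0 <-> exists p, z = koszul_d M 0 p.
Proof.
by split=> [/koszul_exact0|[p ->]]; last exact: koszul_aug_d1.
Qed.

Fact koszul_exact M n (z : koszul_mod M n.+1) :
  koszul_d M n z = 0 <-> exists t, z = koszul_d M n.+1 t.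
Proof.
case: n z => [|[|n]] z.
- by split=> [/koszul_exact1|[p ->]]; last exact: koszul_d1_d2.
- split=> [/koszul_exact2 ->|[t ->]]; last exact: linear0.
  by exists 0.
- by split=> // _; exists 0; rewrite (koszul_mod_trivial z).
Qed.

Definition koszul_resolution M : resolution M :=
  Resolution (@koszul_projective M) (@koszul_surj M) (@koszul_exact_aug M)
    (@koszul_exact M).

Lemma gldim_le2 : gldim_le A 2.
Proof.
move=> M; exists (koszul_resolution M) => -[|[|[|n]]] // _ z.
exact: koszul_mod_trivial.
Qed.

Section Trivial.
Variable eps : {lrmorphism A -> K^o}.

Lemma aug_scale_eq0 a (m : aug_module eps) : eps a = 0 -> a *: m = 0.
Proof. by move=> a0; rewrite [LHS]/((eps a : K) * (m : K)) a0; apply: mul0r. Qed.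

Lemma tens_diff_unit_aug a b (m : aug_module eps) : eps b = 0 ->
  tens_diff a b (tens_unit QP m) = a *: (tens_unit QP m : T (aug_module eps)).
Proof.
move=> b0; rewrite tens_diff_unit aug_scale_eq0 // [tens_unit QP 0]linear0.
exact: subr0.
Qed.

(** Otherwise a resolution P of length 1 of the trivial module K could be
    compared with the Koszul resolution, giving a retraction of d2; but d2 maps
    the generator into the multiples of x and y. *)
Lemma gldim_ge2 : eps x = 0 -> eps y = 0 ->
  forall n, gldim_le A n -> (2 <= n)%N.
Proof.
move=> epsx epsy n /(_ (aug_module eps))[P Ptriv].
rewrite leqNgt; apply/negP => n_lt2.
have P2 (t : P 2) : t = 0 by apply: Ptriv; lia.
pose M : lmodType A := aug_module eps.
pose aug := koszul_aug QP M.
pose d1 : {linear (T M * T M)%type -> T M} := @koszul_d1 _ _ _ _ _ QP M.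
pose d2 : {linear T M -> (T M * T M)%type} := @koszul_d2 _ _ _ _ _ QP M.
have projT := @projective_tens M; have projTT := projective_prod projT projT.
have [f0 f0P] := projT _ _ (res_aug P) aug (@res_surj _ _ _ P).
have [p|f1 f1P] := @projective_lift _ _ _ _ (res_d P 0) _ (f0 \o d1) projTT.
  by apply/res_exact0; rewrite /= f0P; apply: koszul_aug_d1.
have f1d2 z : f1 (d2 z) = 0.
  have /res_exact[t ->] : res_d P 0 (f1 (d2 z)) = 0.
    by rewrite f1P /= [d1 _]koszul_d1_d2 linear0.
  by rewrite (P2 t) linear0.
have [g0 g0P] := @res_proj _ _ _ P 0 _ _ aug (res_aug P) (@koszul_surj M).
have [p|g1 g1P] := @projective_lift _ _ _ _ d1 _ (g0 \o res_d P 0) (@res_proj _ _ _ P 1).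
  by apply: koszul_exact0; rewrite [LHS]g0P; apply/res_exact0; exists p.
have [z|s0 s0P] := @projective_lift _ _ _ _ d1 _ (idfun \- (g0 \o f0)) projT.
  by apply: koszul_exact0; rewrite linearB /= g0P f0P subrr.
have [p|s1 s1P] := @projective_lift _ _ _ _ d2 _
    (idfun \- (g1 \o f1) \- (s0 \o d1)) projTT.
  apply: koszul_exact1; rewrite -[koszul_d1 _]/(d1 _) /= !linearB /=.
  by rewrite g1P s0P /= f1P /= opprB addrC subrKA subrr.
have s1d2 z : s1 (d2 z) = z.
  apply/eqP; rewrite -subr_eq0; apply/eqP/koszul_exact2.
  rewrite -[koszul_d2 _]/(d2 _) linearB /= s1P /= f1d2 [d1 _]koszul_d1_d2.
  by rewrite (linear0 g1) (linear0 s0) !subr0 subrr.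
pose u : T M := tens_unit QP (1 : M).
have epsZ c a : eps a = 0 -> eps (c *: a) = 0.
  by move=> a0; rewrite linearZ_LR /= a0; apply: scaler0.
have [epsqx epsqy] := (epsZ q _ epsx, epsZ q _ epsy).
have d2u : d2 u = y *: (u, 0) - (q *: x) *: (0, u).
  rewrite [LHS]/(koszul_d2 _) !tens_diff_unit_aug //.
  by congr (_, _); rewrite /= scaler0 ?subr0 ?sub0r.
have aug1 : aug u = 0.
  have augZ a t : eps a = 0 -> aug (s1 (a *: t)) = 0.
    by move=> a0; rewrite !linearZ_LR; apply: aug_scale_eq0.
  by rewrite -(s1d2 u) d2u linearB /= linearB /= !augZ // subrr.
by move/eqP: aug1; rewrite [aug u]koszul_aug_unit oner_eq0.
Qed.

End Trivial.

End KoszulResolution.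

(** * Gradings of a quantum plane and of its Koszul complex *)

(** In the decompositions provided by [direct_sum] an index may occur several times;
    here the components with the same index are added up. *)
Lemma collect_components (I : eqType) (M : zmodType) (gr : I -> set M)
    (l : seq (I * M)) :
  (forall i, gr i 0 /\ (forall x y, gr i x -> gr i y -> gr i (x - y))) ->
  (forall p, p \in l -> gr p.1 p.2) ->
  exists (s : seq I) (f : I -> M),
    [/\ uniq s, forall i, gr i (f i) & \sum_(p <- l) p.2 = \sum_(i <- s) f i].
Proof.
move=> gr_sub grl.
have grD i a b : gr i a -> gr i b -> gr i (a + b).
  have [gr0 grB] := gr_sub i; move=> ga gb.
  by rewrite -[b]opprK; apply: (grB _ _ ga); rewrite -[- b]sub0r; apply: grB.
exists (undup [seq p.1 | p <- l]), (fun i => \sum_(p <- l | p.1 == i) p.2).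
split=> [|i|]; first exact: undup_uniq.
  rewrite big_seq_cond; elim/big_rec: _ => [|p a /andP[pl /eqP <-]].
    exact: (gr_sub i).1.
  by apply: grD; apply: grl.
rewrite (exchange_big_dep predT) //= [RHS]big_seq [LHS]big_seq.
apply: eq_bigr => p pl; rewrite -big_filter (_ : seq.filter _ _ = [:: p.1]).
  by rewrite big_seq1.
rewrite (eq_filter (a2 := pred1 p.1)) => [|j]; last by rewrite eq_sym.
by rewrite filter_pred1_uniq ?undup_uniq // mem_undup map_f.
Qed.

Section GradedFamilies.
Variables (I : choiceType) (J : eqType) (M : zmodType) (deg : I -> J).
Implicit Types z : {malg M[I]}.

Definition family_gr (j : J) : set {malg M[I]} :=
  [set z | forall k, mcoeff k z != 0 -> deg k = j].

Lemma family_gr0 j : family_gr j 0.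
Proof. by move=> k; rewrite mcoeff0 eqxx. Qed.

Lemma family_grD j z t : family_gr j z -> family_gr j t -> family_gr j (z + t).
Proof.
move=> hz ht k; rewrite mcoeffD; have [z0|/hz//] := eqVneq (mcoeff k z) 0.
by rewrite z0 add0r => /ht.
Qed.

Lemma family_grN j z : family_gr j z -> family_gr j (- z).
Proof. by move=> hz k; rewrite mcoeffN oppr_eq0 => /hz. Qed.

Lemma family_grU j k m : deg k = j -> family_gr j (mkmalgU k m).
Proof.
move=> <- l; rewrite mcoeffU; have [->//|_] := eqVneq k l.
by rewrite mulr0n eqxx.
Qed.

Lemma family_gr_ind j (P : {malg M[I]} -> Prop) : P 0 ->
  (forall z t, P z -> P t -> P (z + t)) ->
  (forall k m, deg k = j -> P (mkmalgU k m)) -> forall z, family_gr j z -> P z.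
Proof.
move=> P0 PD PU z zj; rewrite (monalgE z) big_seq.
elim/big_rec: _ => // k t kz; apply: PD; apply/PU/zj.
by rewrite mcoeff_neq0.
Qed.

Lemma family_direct_sum : direct_sum family_gr.
Proof.
split=> [j|z|s f us fs sum0 i si].
- split=> [|z t hz ht]; first exact: family_gr0.
  exact/family_grD/family_grN.
- pose l := [seq (deg k, mkmalgU k (mcoeff k z)) | k <- msupp z].
  have [|p /mapP[k _ ->]|s [f [_ fs lf]]] := @collect_components _ _ family_gr l.
  + move=> j; split=> [|t w ht hw]; first exact: family_gr0.
    exact/family_grD/family_grN.
  + exact: family_grU.
  by exists s, f; split=> //; rewrite -lf big_map -monalgE.
apply/malgP => k; rewrite mcoeff0.
have [//|fk] := eqVneq (mcoeff k (f i)) 0.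
have := congr1 (mcoeff k) sum0; rewrite raddf_sum mcoeff0 (bigD1_seq i) //=.
rewrite big1 ?addr0 // => j ji; apply/eqP/contraT => fjk.
by rewrite -(fs i _ fk) -(fs j _ fjk) eqxx in ji.
Qed.

End GradedFamilies.

Lemma direct_sum_preim (I : eqType) (M N : zmodType) (f : {additive M -> N})
    (g : {additive N -> M}) (gr : I -> set N) :
  cancel f g -> cancel g f -> direct_sum gr ->
  direct_sum (fun i => [set x | gr i (f x)]).
Proof.
move=> fK gK [gr_sub gr_sum gr_free]; split=> [i|x|s h us hs sum0 i si] /=.
- have [gr0 grB] := gr_sub i; split=> [|x y hx hy]; rewrite ?raddf0 ?raddfB //.
  exact: grB.
- have [s [h [hh e]]] := gr_sum (f x); exists s, (g \o h).
  split=> [i|]; first by rewrite /= gK.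
  by rewrite -[x]fK e raddf_sum.
apply: (can_inj fK); rewrite raddf0.
apply: (gr_free s (f \o h)) => //.
by rewrite -raddf_sum sum0 raddf0.
Qed.

Lemma direct_sum_prod (I : eqType) (M N : zmodType) (gr1 : I -> set M)
    (gr2 : I -> set N) : direct_sum gr1 -> direct_sum gr2 ->
  direct_sum (fun i => [set p : M * N | gr1 i p.1 /\ gr2 i p.2]).
Proof.
move=> [sub1 sum1 free1] [sub2 sum2 free2].
split=> [i|[x y]|s h us hs sum0 i si] /=.
- have [[z1 B1] [z2 B2]] := (sub1 i, sub2 i); split=> // p r [? ?] [? ?].
  by split; [apply: B1|apply: B2].
- have [s [f [fs ->]]] := sum1 x; have [t [g [gt ->]]] := sum2 y.
  pose l := [seq (i, (f i, 0)) | i <- s] ++ [seq (i, (0, g i)) | i <- t].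
  have [|p|r [h [_ hr lh]]] := @collect_components _ _
      (fun i => [set p : M * N | gr1 i p.1 /\ gr2 i p.2]) l.
  + move=> i; have [[z1 B1] [z2 B2]] := (sub1 i, sub2 i).
    by split=> // p r [? ?] [? ?]; split; [apply: B1|apply: B2].
  + rewrite mem_cat => /orP[] /mapP[i _ ->] /=; split=> //.
      exact: (sub2 i).1.
    exact: (sub1 i).1.
  exists r, h; split=> //; rewrite -lh big_cat !big_map /=.
  congr (_, _); rewrite !raddf_sum /=.
    by rewrite [X in _ + X]big1 ?addr0.
  by rewrite [X in X + _]big1 ?add0r.
have [h1 h2] : \sum_(j <- s) (h j).1 = 0 /\ \sum_(j <- s) (h j).2 = 0.
  by rewrite -(raddf_sum fst) -(raddf_sum snd) sum0.
have := free1 s (fst \o h) us (fun j => (hs j).1) h1 i si.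
have := free2 s (snd \o h) us (fun j => (hs j).2) h2 i si.
by move=> /= e2 e1; rewrite [h i]surjective_pairing e1 e2.
Qed.

Section QuantumPlaneGrading.
Variables (K : fieldType) (A : algType K) (x y : A) (q : K).
Hypothesis QP : quantum_plane x y q.
Variables d1 d2 : nat.
Hypotheses (d1_gt0 : (0 < d1)%N) (d2_gt0 : (0 < d2)%N).
Local Notation NN := (nat * nat)%type.
Local Notation qcoef := (qcoef QP).
Local Notation mon := (qmon x y).

Definition qdeg (k : NN) : nat := (k.1 * d1 + k.2 * d2)%N.

(** The grading with x in degree d1 and y in degree d2. *)
Definition qplane_gr (n : nat) : set A := [set a | family_gr qdeg n (qcoef a)].

Lemma qdegD k l : qdeg (k.1 + l.1, k.2 + l.2)%N = (qdeg k + qdeg l)%N.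
Proof. by rewrite /qdeg !mulnDl addnACA. Qed.

Lemma qdeg_eq0 k : (qdeg k == 0%N) = (k == (0%N, 0%N)).
Proof.
rewrite /qdeg addn_eq0 !muln_eq0 (gtn_eqF d1_gt0) (gtn_eqF d2_gt0) !orbF.
by case: k.
Qed.

Lemma qplane_gr0 n : qplane_gr n 0.
Proof. by rewrite /qplane_gr /= raddf0; apply: family_gr0. Qed.

Lemma qplane_grD n a b : qplane_gr n a -> qplane_gr n b -> qplane_gr n (a + b).
Proof. by rewrite /qplane_gr /= raddfD; apply: family_grD. Qed.

Lemma qplane_gr_mon n c k : qdeg k = n -> qplane_gr n (c *: mon k).
Proof. by rewrite /qplane_gr /= qcoef_mon; apply: family_grU. Qed.

Lemma qplane_gr_ind n (P : A -> Prop) : P 0 ->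
  (forall a b, P a -> P b -> P (a + b)) ->
  (forall c k, qdeg k = n -> P (c *: mon k)) ->
  forall a, qplane_gr n a -> P a.
Proof.
move=> P0 PD PU a; rewrite -{2}[a](qcoefK QP) /qplane_gr /=.
move: (qcoef a); apply: family_gr_ind.
- by rewrite raddf0.
- by move=> z t; rewrite raddfD; apply: PD.
- by move=> k c kn; rewrite qcombU; apply: PU.
Qed.

Lemma qplane_grM n p a b :
  qplane_gr n a -> qplane_gr p b -> qplane_gr (n + p) (a * b).
Proof.
move=> an bp; elim/qplane_gr_ind: a / an => [|a a' ha ha'|c k kn].
- by rewrite mul0r; apply: qplane_gr0.
- by rewrite mulrDl; apply: qplane_grD.
elim/qplane_gr_ind: b / bp => [|b b' hb hb'|d l lp].
- by rewrite mulr0; apply: qplane_gr0.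
- by rewrite mulrDr; apply: qplane_grD.
rewrite -scalerAl -scalerAr (qmonM QP) !scalerA.
by apply: qplane_gr_mon; rewrite qdegD kn lp.
Qed.

Lemma qplane_grX : qplane_gr d1 x.
Proof.
have -> : x = 1 *: mon (1%N, 0%N) by rewrite scale1r /qmon /= mulr1.
by apply: qplane_gr_mon; rewrite /qdeg mul1n addn0.
Qed.

Lemma qplane_grY : qplane_gr d2 y.
Proof.
have -> : y = 1 *: mon (0%N, 1%N) by rewrite scale1r /qmon /= mul1r.
by apply: qplane_gr_mon; rewrite /qdeg mul1n.
Qed.

Lemma qplane_grZ n c a : qplane_gr n a -> qplane_gr n (c *: a).
Proof.
move=> an; elim/qplane_gr_ind: a / an => [|a a' ha ha'|d k kn].
- by rewrite scaler0; apply: qplane_gr0.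
- by rewrite scalerDr; apply: qplane_grD.
- by rewrite scalerA; apply: qplane_gr_mon.
Qed.

Lemma qplane_connected : connected_graded qplane_gr.
Proof.
split.
- pose f : {additive A -> _} := qcoef.
  pose g : {additive _ -> A} := @qcomb K A x y.
  apply: (@direct_sum_preim _ _ _ f g (family_gr qdeg)).
  + exact: qcoefK.
  + exact: qcombK.
  + exact: family_direct_sum.
- by move=> n p a b; apply: qplane_grM.
apply/seteqP; split=> [a a0|_ [c _ <-]] /=.
  elim/qplane_gr_ind: a / a0 => [|_ _ [c _ <-] [d _ <-]|c k /eqP].
  + by exists 0; rewrite ?scale0r.
  + by exists (c + d); rewrite ?scalerDl.
  + by rewrite qdeg_eq0 => /eqP ->; exists c; rewrite ?qmon0.
by rewrite -(qmon0 x y); apply: qplane_gr_mon.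
Qed.

(** The augmentation, which maps x and y to 0. *)
Definition qplane_eps (a : A) : K^o := mcoeff (0%N, 0%N) (qcoef a).

Lemma qplane_eps_mon c k : qplane_eps (c *: mon k) = c *+ (k == (0%N, 0%N)).
Proof. by rewrite /qplane_eps qcoef_mon mcoeffU. Qed.

Fact qplane_eps_is_zmod_morphism : zmod_morphism qplane_eps.
Proof. by move=> a b; rewrite /qplane_eps !raddfB. Qed.
HB.instance Definition _ :=
  GRing.isZmodMorphism.Build A K^o qplane_eps qplane_eps_is_zmod_morphism.

Fact qplane_eps_is_scalable : scalable qplane_eps.
Proof.
move=> c a; elim/(qplane_ind QP): a => [|a b ea eb|d k].
- by rewrite !(scaler0, raddf0).
- by rewrite scalerDr !raddfD /= ea eb -scalerDr.
by rewrite scalerA !qplane_eps_mon [RHS]mulrnAr.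
Qed.
HB.instance Definition _ :=
  GRing.isScalable.Build K A K^o *:%R qplane_eps qplane_eps_is_scalable.

Fact qplane_eps_is_monoid_morphism : monoid_morphism qplane_eps.
Proof.
split=> [|a b].
  by rewrite -(qmon0 x y) -[mon _]scale1r qplane_eps_mon.
elim/(qplane_ind QP): a => [|a a' ea ea'|c k].
- by rewrite mul0r !raddf0 mul0r.
- by rewrite mulrDl !raddfD /= ea ea' mulrDl.
elim/(qplane_ind QP): b => [|b b' eb eb'|d l].
- by rewrite mulr0 !raddf0 mulr0.
- by rewrite mulrDr !raddfD /= eb eb' mulrDr.
rewrite -scalerAl -scalerAr (qmonM QP) !scalerA !qplane_eps_mon.
have -> : ((k.1 + l.1, k.2 + l.2)%N == (0%N, 0%N)) =
    (k == (0%N, 0%N)) && (l == (0%N, 0%N)).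
  by case: k l => [k1 k2] [l1 l2]; rewrite !xpair_eqE !addn_eq0 andbACA.
case: eqP => [->|_]; last by rewrite !mulr0n mul0r.
by case: eqP => [->|_]; rewrite ?mulr0n ?mulr0 // muln0 expr0 mulr1.
Qed.
HB.instance Definition _ :=
  GRing.isMonoidMorphism.Build A K^o qplane_eps qplane_eps_is_monoid_morphism.

Definition qplane_aug : {lrmorphism A -> K^o} := qplane_eps.

Lemma qplane_aug_gr n a : (0 < n)%N -> qplane_gr n a -> qplane_aug a = 0.
Proof.
move=> n_gt0 an; elim/qplane_gr_ind: a / an => [|a b ea eb|c k kn].
- exact: raddf0.
- by rewrite raddfD /= ea eb addr0.
rewrite [LHS]qplane_eps_mon -qdeg_eq0 kn.
by case: n n_gt0 {kn}.
Qed.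

Lemma qplane_augX : qplane_aug x = 0.
Proof.
have -> : x = 1 *: mon (1%N, 0%N) by rewrite scale1r /qmon /= mulr1.
exact: qplane_eps_mon.
Qed.

Lemma qplane_augY : qplane_aug y = 0.
Proof.
have -> : y = 1 *: mon (0%N, 1%N) by rewrite scale1r /qmon /= mul1r.
exact: qplane_eps_mon.
Qed.

End QuantumPlaneGrading.

(** * The extension groups of the trivial module *)

Section GradedKoszul.
Variables (K : fieldType) (A : algType K) (x y : A) (q : K).
Hypothesis QP : quantum_plane x y q.
Variables d1 d2 : nat.
Hypotheses (d1_gt0 : (0 < d1)%N) (d2_gt0 : (0 < d2)%N).
Local Notation mon := (qmon x y).
Local Notation deg := (qdeg d1 d2).
Local Notation gr := (qplane_gr QP d1 d2).
Local Notation eps := (qplane_aug QP).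
Local Notation M := (aug_module eps).
Local Notation T := (tens M QP).
Local Notation u := (tens_unit QP (1 : M)).

(** The grading of A (x) K with 1 (x) 1 in degree s. *)
Definition tens_gr (s : nat) (j : int) : set T :=
  [set z | family_gr (fun k => (deg k + s)%N%:Z) j z].

Lemma tens_gr0 s j : tens_gr s j 0.
Proof. exact: family_gr0. Qed.

Lemma tens_grD s j z t : tens_gr s j z -> tens_gr s j t -> tens_gr s j (z + t).
Proof. exact: family_grD. Qed.

Lemma tens_grN s j z : tens_gr s j z -> tens_gr s j (- z).
Proof. exact: family_grN. Qed.

Lemma tens_gr_mon s (j : int) k m : (deg k + s)%N = j :> int ->
  tens_gr s j (tens_mon QP k m).
Proof. exact: family_grU. Qed.

Lemma tens_gr_ind s j (P : T -> Prop) : P 0 ->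
  (forall z t, P z -> P t -> P (z + t)) ->
  (forall k m, (deg k + s)%N = j :> int -> P (tens_mon QP k m)) ->
  forall z, tens_gr s j z -> P z.
Proof. exact: family_gr_ind. Qed.

Lemma tens_gr_scale s (i : nat) (j : int) a z :
  gr i a -> tens_gr s j z -> tens_gr s (i%:Z + j) (a *: z).
Proof.
move=> ai zj; elim/qplane_gr_ind: a / ai => [|a b ha hb|c k ki].
- by rewrite scale0r; apply: tens_gr0.
- by rewrite scalerDl; apply: tens_grD.
elim/tens_gr_ind: z / zj => [|z t hz ht|l m lj].
- by rewrite scaler0; apply: tens_gr0.
- by rewrite scalerDr; apply: tens_grD.
rewrite tens_scale_mon; apply: tens_gr_mon.
by rewrite qdegD ki -lj; lia.
Qed.

Lemma tens_graded_module s : graded_module gr (tens_gr s).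
Proof.
by split; [exact: family_direct_sum | move=> i j a z; apply: tens_gr_scale].
Qed.

Lemma tens_diff_gr (n s : nat) (j : int) a b z : gr n a -> eps b = 0 ->
  tens_gr (n + s)%N j z -> tens_gr s j (tens_diff a b z).
Proof.
move=> an b0 zj; elim/tens_gr_ind: z / zj => [|z t hz ht|k m kj].
- by rewrite linear0; apply: tens_gr0.
- by rewrite linearD; apply: tens_grD.
rewrite tens_diff_mon aug_scale_eq0 // [tens_mon _ _ 0]raddf0 subr0.
have -> : j = (deg k + n)%N%:Z + s%:Z by rewrite -kj; lia.
apply: tens_gr_scale; last by apply: tens_gr_mon; rewrite /qdeg !mul0n.
by apply: qplane_grM => //; rewrite -[mon k]scale1r; apply: qplane_gr_mon.
Qed.

(** The shifts make the differentials homogeneous of degree 0. *)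
Definition koszul_gr (n : nat) : int -> set (koszul_mod QP M n) :=
  match n with
  | 0 => tens_gr 0
  | 1 => fun j => [set p : T * T | tens_gr d1 j p.1 /\ tens_gr d2 j p.2]
  | 2 => tens_gr (d1 + d2)
  | _ => fun _ => setT
  end.

Lemma koszul_graded n : graded_module gr (@koszul_gr n).
Proof.
case: n => [|[|[|n]]] /=; try exact: tens_graded_module.
- have [ds1 gs1] := tens_graded_module d1; have [ds2 gs2] := tens_graded_module d2.
  split; first exact: (direct_sum_prod ds1 ds2).
  by move=> i j a p ai [p1 p2]; split; [apply: gs1|apply: gs2].
split=> //; split=> // [z|s f _ _ _ i _]; last exact: (@koszul_mod_trivial _ _ _ _ _ QP M n).
exists [::], (fun=> 0); split=> //.
by rewrite big_nil; exact: (@koszul_mod_trivial _ _ _ _ _ QP M n).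
Qed.

Lemma koszul_d_gr n j z : koszul_gr (n := n.+1) j z ->
  koszul_gr (n := n) j (koszul_d QP M n z).
Proof.
have [epsx epsy] := (qplane_augX QP, qplane_augY QP).
have [grx gry] := (@qplane_grX _ _ _ _ _ QP d1 d2, @qplane_grY _ _ _ _ _ QP d1 d2).
have epsZ a : eps a = 0 -> eps (q *: a) = 0.
  by move=> a0; rewrite linearZ_LR /= a0; apply: scaler0.
case: n z => [|[|[|n]]] //= z.
  move=> [z1 z2]; apply: tens_grD.
    by apply: (tens_diff_gr grx); rewrite ?addn0.
  by apply: (tens_diff_gr gry); rewrite ?addn0.
  move=> zj; split.
    by apply: (tens_diff_gr gry); rewrite ?epsZ // addnC.
  apply/tens_grN; apply: (@tens_diff_gr d1) => //.
  exact: qplane_grZ.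
by move=> _; apply: tens_gr0.
Qed.

Lemma koszul_aug_gr j z : j != 0 -> tens_gr 0 j z -> koszul_aug QP M z = 0.
Proof.
move=> j0 zj; elim/tens_gr_ind: z / zj => [|z t hz ht|k m kj].
- exact: linear0.
- by rewrite linearD /= hz ht addr0.
rewrite [LHS]tens_lift_mon /=; apply: aug_scale_eq0.
rewrite -[mon k]scale1r [LHS]qplane_eps_mon.
case: eqP => // k0; move: kj j0; rewrite k0 /qdeg /= => <-.
by rewrite !mul0n eqxx.
Qed.

Definition graded_koszul : graded_resolution gr eps :=
  @GradedResolution _ _ gr eps (koszul_resolution QP M) koszul_gr koszul_graded
    koszul_d_gr koszul_aug_gr.

End GradedKoszul.

Section ExtTrivial.
Variables (K : fieldType) (A : algType K) (x y : A) (q : K).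
Hypothesis QP : quantum_plane x y q.
Variables d1 d2 : nat.
Hypotheses (d1_gt0 : (0 < d1)%N) (d2_gt0 : (0 < d2)%N).
Local Notation qcoef := (qcoef QP).
Local Notation mon := (qmon x y).
Local Notation deg := (qdeg d1 d2).
Local Notation gr := (qplane_gr QP d1 d2).
Local Notation eps := (qplane_aug QP).
Local Notation M := (aug_module eps).
Local Notation T := (tens M QP).
Local Notation u := (tens_unit QP (1 : M) : T).

Lemma qcoefP a b : (forall k, mcoeff k (qcoef a) = mcoeff k (qcoef b)) -> a = b.
Proof. by move/malgP => ab; apply: (can_inj (qcoefK QP)). Qed.

Lemma qcoef_mulX i j a :
  mcoeff (i.+1, j) (qcoef (x * a)) = mcoeff (i, j) (qcoef a).
Proof.
elim/(qplane_ind QP): a => [|a b ea eb|c [k l]].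
- by rewrite mulr0 !raddf0.
- by rewrite mulrDr !raddfD /= ea eb.
by rewrite -scalerAr mulX_qmon !qcoef_mon !mcoeffU !xpair_eqE eqSS.
Qed.

Lemma qcoef_mulX0 j a : mcoeff (0%N, j) (qcoef (x * a)) = 0.
Proof.
elim/(qplane_ind QP): a => [|a b ea eb|c [k l]].
- by rewrite mulr0 !raddf0.
- by rewrite mulrDr !raddfD /= ea eb addr0.
by rewrite -scalerAr mulX_qmon !qcoef_mon !mcoeffU !xpair_eqE.
Qed.

Lemma qcoef_mulY i j a :
  mcoeff (i, j.+1) (qcoef (y * a)) = q ^+ i * mcoeff (i, j) (qcoef a).
Proof.
elim/(qplane_ind QP): a => [|a b ea eb|c [k l]].
- by rewrite mulr0 !raddf0 mulr0.
- by rewrite mulrDr !raddfD /= ea eb mulrDr.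
rewrite -scalerAr (mulY_qmon (qp_comm QP)) scalerA !qcoef_mon !mcoeffU !xpair_eqE eqSS.
by have [->|_] := eqVneq k i; rewrite ?mulr0 // mulrnAr [c * _]mulrC.
Qed.

Lemma mulX_inj : injective (fun a : A => x * a).
Proof.
move=> a b /= e; apply: qcoefP => -[i j].
by rewrite -qcoef_mulX e qcoef_mulX.
Qed.

Lemma qplane_divX a : (forall j, mcoeff (0%N, j) (qcoef a) = 0) ->
  exists b, a = x * b.
Proof.
have [b [c [-> c0]]] : exists b c, a = x * b + c /\
    forall i j, mcoeff (i.+1, j) (qcoef c) = 0.
  elim/(qplane_ind QP): a => [|a a' [b [c [-> hc]]] [b' [c' [-> hc']]]|c k].
  - by exists 0, 0; rewrite mulr0 addr0; split=> // i j; rewrite !raddf0.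
  - exists (b + b'), (c + c'); split; first by rewrite mulrDr addrACA.
    by move=> i j; rewrite !raddfD /= hc hc' addr0.
  case: k => -[|k] l.
    exists 0, (c *: mon (0%N, l)); rewrite mulr0 add0r; split=> // i j.
    by rewrite qcoef_mon mcoeffU.
  exists (c *: mon (k, l)), 0; rewrite addr0 -scalerAr mulX_qmon.
  by split=> // i j; rewrite !raddf0.
move=> a0; exists b; rewrite [c](_ : _ = 0) ?addr0 //.
apply: qcoefP => -[[|i] j]; rewrite raddf0 mcoeff0 // -(a0 j).
by rewrite raddfD /= mcoeffD qcoef_mulX0 add0r.
Qed.

Lemma grZP (j : int) a :
  grZ gr j a <-> family_gr (fun k => (deg k)%:Z) j (qcoef a).
Proof.
case: j => n /=; split.
- by move=> an k /an ->.
- by move=> an k /an [].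
- by move=> ->; rewrite raddf0; apply: family_gr0.
move=> an; apply: qcoefP => k; rewrite raddf0 mcoeff0; apply/eqP/contraT.
by move=> /an.
Qed.

Lemma grZ0 (j : int) : grZ gr j 0.
Proof. by apply/grZP; rewrite raddf0; apply: family_gr0. Qed.

Lemma grZD (j : int) a b : grZ gr j a -> grZ gr j b -> grZ gr j (a + b).
Proof.
by move=> /grZP ha /grZP hb; apply/grZP; rewrite raddfD; apply: family_grD.
Qed.

Lemma grZM (n : nat) (j : int) a b :
  gr n a -> grZ gr j b -> grZ gr (n%:Z + j) (a * b).
Proof.
case: j => p an; last by move=> /= ->; rewrite mulr0; apply: grZ0.
exact: qplane_grM.
Qed.

Lemma grZ_scale (j : int) c a : grZ gr j a -> grZ gr j (c *: a).
Proof.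
rewrite -mulr_algl -{2}[j]add0r; apply: grZM.
by rewrite -(qmon0 x y); apply: qplane_gr_mon.
Qed.

Lemma grZ_mulX (j : int) a : grZ gr (d1%:Z + j) (x * a) -> grZ gr j a.
Proof.
move=> /grZP xa; apply/grZP => -[k l] kl; have := xa (k.+1, l).
by rewrite qcoef_mulX => /(_ kl); rewrite /qdeg /= mulSn; lia.
Qed.

(** The augmentation ideal is generated by x and y, compatibly with the degrees. *)
Lemma grZ_decomp (j : int) a : grZ gr j a -> j != 0 ->
  exists b c, [/\ a = x * b + y * c, grZ gr (j - d1%:Z) b & grZ gr (j - d2%:Z) c].
Proof.
case: j => n /=; last first.
  by move=> -> _; exists 0, 0; rewrite !mulr0 addr0; split=> //; apply: grZ0.
move=> an n0; elim/qplane_gr_ind: a / an.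
- by exists 0, 0; rewrite !mulr0 addr0; split=> //; apply: grZ0.
- move=> _ _ [b [c [-> hb hc]]] [b' [c' [-> hb' hc']]].
  exists (b + b'), (c + c'); rewrite !mulrDr addrACA.
  by split=> //; apply: grZD.
move=> c [[|i] [|j]] ijn.
- by move: n0; rewrite -ijn /qdeg !mul0n eqxx.
- exists 0, (c *: mon (0%N, j)); rewrite mulr0 add0r -scalerAr (mulY_qmon (qp_comm QP)).
  rewrite expr0 scale1r; split=> //; first exact: grZ0.
  apply/grZP; rewrite qcoef_mon; apply: family_grU.
  by rewrite -ijn /qdeg /= mulSn; lia.
- exists (c *: mon (i, 0%N)), 0; rewrite mulr0 addr0 -scalerAr mulX_qmon.
  split=> //; last exact: grZ0.
  apply/grZP; rewrite qcoef_mon; apply: family_grU.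
  by rewrite -ijn /qdeg /= mulSn; lia.
exists (c *: mon (i, j.+1)), 0; rewrite mulr0 addr0 -scalerAr mulX_qmon.
split=> //; last exact: grZ0.
apply/grZP; rewrite qcoef_mon; apply: family_grU.
by rewrite -ijn /qdeg /= !mulSn; lia.
Qed.

Lemma aug_scale_alg c (m : M) : c%:A *: m = (c * (m : K))%R :> K.
Proof.
have epsc : eps c%:A = c by rewrite linearZ_LR rmorph1; apply: mulr1.
by rewrite -[X in _ = X * _]epsc.
Qed.

Definition cst_map (a : A) (m : vspace_of M) : vspace_of A^o :=
  (m : K)%:A * a : A.

Fact cst_map_is_linear a : linear (cst_map a).
Proof.
move=> c m n.
have -> : c *: m + n = (c * (m : K) + (n : K) : K) :> K.
  congr (_ + _); exact: aug_scale_alg.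
rewrite /cst_map scalerDl mulrDl; congr (_ + _).
suff: (c * (m : K))%:A * a = c%:A * ((m : K)%:A * a) by [].
by rewrite mulrA -[c%:A * _]scalerAl mul1r scalerA.
Qed.
HB.instance Definition _ a :=
  GRing.isLinear.Build K (vspace_of M) (vspace_of A^o) _ (cst_map a)
    (cst_map_is_linear a).

(** A cochain on a free module of rank 1 is determined by its value [a] on the
    generator. *)
Definition cochain_of (a : A) : {linear T -> A^o} :=
  tens_lift (QP := QP) (cst_map a).

Lemma cochain_of_unit a (m : M) :
  cochain_of a (tens_unit QP m) = (m : K)%:A * a :> A.
Proof. by have := @tens_lift_unit _ _ _ _ _ QP M A^o (cst_map a) m. Qed.

Lemma cochain_ofZ c a z : cochain_of (c *: a) z = c *: (cochain_of a z : A).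
Proof.
elim/tens_ind: z => [|z t ez et|k m].
- by rewrite !linear0.
- by rewrite !linearD /= ez et.
rewrite [LHS]tens_lift_mon [cochain_of a _]tens_lift_mon.
suff: mon k * ((m : K)%:A * (c *: a)) = c *: (mon k * ((m : K)%:A * a)) by [].
by rewrite -!scalerAr.
Qed.

Lemma cochain_of_gr a (s : nat) (j t : int) z : grZ gr (s%:Z + j) a ->
  tens_gr d1 d2 s t z -> grZ gr (t + j) (cochain_of a z).
Proof.
move=> aj zt; elim/tens_gr_ind: z / zt => [|z w hz hw|k m kt].
- by rewrite linear0; apply: grZ0.
- by rewrite linearD; apply: grZD.
have -> : t + j = (deg k)%:Z + (s%:Z + j) by rewrite -kt; lia.
rewrite [cochain_of a _]tens_lift_mon.
suff: grZ gr ((deg k)%:Z + (s%:Z + j)) (mon k * ((m : K)%:A * a)) by [].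
apply: grZM; first by rewrite -[mon k]scale1r; apply: qplane_gr_mon.
by rewrite mulr_algl; apply: grZ_scale.
Qed.

Lemma tens_linear_unit (N : lmodType A) (f : {linear T -> N}) (m : M) :
  f (tens_unit QP m) = (m : K)%:A *: f u.
Proof.
rewrite -linearZ_LR /=; congr (f _).
rewrite -[RHS](linearZ_LR (@tens_unit _ _ _ _ _ QP M) (m : K) (1 : M)).
congr (tens_unit QP _).
by apply/esym; rewrite [LHS]aug_scale_alg; apply: mulr1.
Qed.

Lemma tens_linear_ext1 (N : lmodType A) (f g : {linear T -> N}) :
  f u = g u -> f =1 g.
Proof. by move=> fg; apply: tens_linear_ext => m; rewrite [LHS]tens_linear_unit fg -tens_linear_unit. Qed.

Lemma tens_unit_gr s : tens_gr d1 d2 s s%:Z u.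
Proof. exact: tens_gr_mon. Qed.

Local Notation P := (graded_koszul QP d1_gt0 d2_gt0).

Lemma koszul_d1_x : koszul_d1 (u, 0) = x *: u.
Proof.
rewrite /koszul_d1 /= linear0 addr0.
by apply: tens_diff_unit_aug; apply: qplane_augX.
Qed.

Lemma koszul_d1_y : koszul_d1 (0, u) = y *: u.
Proof.
rewrite /koszul_d1 /= linear0 add0r.
by apply: tens_diff_unit_aug; apply: qplane_augY.
Qed.

Lemma koszul_d2_unit : koszul_d2 u = y *: (u, 0) - (q *: x) *: (0, u).
Proof.
have epsZ a : eps a = 0 -> eps (q *: a) = 0.
  by move=> a0; rewrite linearZ_LR /= a0; apply: scaler0.
rewrite /koszul_d2 !tens_diff_unit_aug ?qplane_augX ?epsZ ?qplane_augY //.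
by congr (_, _); rewrite /= scaler0 ?subr0 ?sub0r.
Qed.

Lemma tens_pair_ext (N : lmodType A) (f g : {linear (T * T)%type -> N}) :
  f (u, 0) = g (u, 0) -> f (0, u) = g (0, u) -> f =1 g.
Proof.
move=> f1 f2 [z t].
have inl_lin : linear (fun p : T => (p, 0) : T * T).
  by move=> a p p'; congr (_, _); rewrite /= scaler0 addr0.
have inr_lin : linear (fun p : T => (0, p) : T * T).
  by move=> a p p'; congr (_, _); rewrite /= scaler0 addr0.
pose inl : {linear T -> (T * T)%type} :=
  HB.pack (fun p : T => (p, 0) : T * T) (GRing.isLinear.Build A _ _ _ _ inl_lin).
pose inr : {linear T -> (T * T)%type} :=
  HB.pack (fun p : T => (0, p) : T * T) (GRing.isLinear.Build A _ _ _ _ inr_lin).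
have -> : (z, t) = inl z + inr t by congr (_, _); rewrite ?addr0 ?add0r.
have e1 : (f \o inl) =1 (g \o inl) by apply: tens_linear_ext1.
have e2 : (f \o inr) =1 (g \o inr) by apply: tens_linear_ext1.
by rewrite !linearD; congr (_ + _); [apply: e1|apply: e2].
Qed.

(** A 0-cocycle is an element annihilated by x, and x is not a zero divisor. *)
Lemma Ext_zero0 (j : int) : Ext_zero P 0 j.
Proof.
move=> f [fj fd]; apply: (@tens_linear_ext1 A^o f \0).
apply: mulX_inj; rewrite mulr0.
rewrite -[LHS]/(x *: (f u : A^o)) -linearZ_LR /=.
rewrite -koszul_d1_x; exact: fd.
Qed.

(** A 1-cocycle is a pair (b, c) with y b = q x c. Comparing coefficients, x divides
    b, say b = x a; then c = y a, and the cocycle is the coboundary of a. *)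
Lemma Ext_zero1 (j : int) : Ext_zero P 1 j.
Proof.
move=> f [fj fd].
pose b : A := f (u, 0); pose c : A := f (0, u).
have bj : grZ gr (d1%:Z + j) b.
  by apply: fj; split; [apply: tens_unit_gr|apply: tens_gr0].
have /(congr1 (fun a => a + q *: (x * c))) : y * b - q *: (x * c) = 0.
  rewrite scalerAl; have := fd u.
  by rewrite [res_d _ _ _]koszul_d2_unit linearB !linearZ_LR.
rewrite subrK add0r => bc.
have [k|a def_b] := @qplane_divX b.
  have := qcoef_mulY 0 k b; rewrite expr0 mul1r => <-.
  by rewrite bc scalerAr qcoef_mulX0.
have def_c : c = y * a.
  apply: mulX_inj => /=.
  apply: (can_inj (scalerK (qp_neq0 QP))).
  by rewrite -bc def_b !mulrA (qp_comm QP) -scalerAl.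
have aj : grZ gr j a by apply: grZ_mulX; rewrite -def_b.
exists (cochain_of a); split.
  by move=> t z; apply: cochain_of_gr; rewrite add0r.
apply: (@tens_pair_ext A^o f (cochain_of a \o koszul_d QP M 0)).
  rewrite [RHS]/= koszul_d1_x linearZ_LR /= cochain_of_unit scale1r mul1r.
  exact: def_b.
rewrite [RHS]/= koszul_d1_y linearZ_LR /= cochain_of_unit scale1r mul1r.
exact: def_c.
Qed.

Lemma koszul2_coboundary (j : int) (f : {linear P 2 -> A^o}) (b c : A) :
  grZ gr (d1%:Z + j) b -> grZ gr (d2%:Z + j) c -> f u = y * b - q *: (x * c) ->
  coboundary j f.
Proof.
move=> bj cj fu.
pose h : {linear (T * T)%type -> A^o} :=
  (cochain_of b \o fst) \+ (cochain_of c \o snd).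
exists h; split.
  move=> t p [p1 p2]; apply: grZD.
    exact: cochain_of_gr bj p1.
  exact: cochain_of_gr cj p2.
apply: (@tens_linear_ext1 A^o f (h \o koszul_d QP M 1)).
rewrite fu scalerAl -[RHS]/(h (koszul_d2 u)) koszul_d2_unit.
have hb : h (u, 0) = b.
  by rewrite /h /= linear0 addr0 cochain_of_unit scale1r mul1r.
have hc : h (0, u) = c.
  by rewrite /h /= linear0 add0r cochain_of_unit scale1r mul1r.
by rewrite linearB !(linearZ_LR h) hb hc.
Qed.

(** A 2-cochain is an element of A and the coboundaries are the augmentation ideal,
    which contains everything in nonzero degree; the generator of the last module
    of the complex has degree d1 + d2. *)
Lemma Ext_zero2 (j : int) : j != - (d1 + d2)%N%:Z -> Ext_zero P 2 j.
Proof.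
move=> j0 f [fj _].
have uj : grZ gr ((d1 + d2)%N%:Z + j) (f u) by apply/fj/tens_unit_gr.
have [|b [c [def_fu bj cj]]] := grZ_decomp uj; first by lia.
have q0 := qp_neq0 QP.
apply: (@koszul2_coboundary _ f c (- q^-1 *: b)).
- by have -> : d1%:Z + j = (d1 + d2)%N%:Z + j - d2%:Z by lia.
- apply: grZ_scale.
  by have -> : d2%:Z + j = (d1 + d2)%N%:Z + j - d1%:Z by lia.
by rewrite def_fu addrC -scalerAr scalerA mulrN mulfV // scaleN1r opprK.
Qed.

Lemma Ext_line2 : Ext_line P 2 (- (d1 + d2)%N%:Z).
Proof.
set j := - _.
have cocycle2 (f : {linear P 2 -> A^o}) : cochain j f -> cocycle j f.
  by split=> // t; rewrite [res_d P 2 t](_ : _ = 0) ?linear0.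
have fu (a : A) : cochain_of a u = a by rewrite cochain_of_unit scale1r mul1r.
exists (cochain_of 1); first split.
- apply: cocycle2 => t z; apply: cochain_of_gr.
  by rewrite subrr -[1]scale1r -(qmon0 x y); apply: qplane_gr_mon.
- move=> [g [_ gP]]; have := gP u.
  rewrite fu [res_d _ _ _]koszul_d2_unit linearB !(linearZ_LR g).
  move=> /(congr1 eps); rewrite rmorph1 rmorphB /=.
  have epsZ a (b : A) : eps a = 0 -> eps (a * b) = 0.
    by move=> a0; rewrite rmorphM /= a0 mul0r.
  rewrite !epsZ ?subrr ?qplane_augY //; first by move/eqP; rewrite oner_eq0.
  by rewrite linearZ_LR /= qplane_augX; apply: scaler0.
move=> f [fj _]; have : grZ gr ((d1 + d2)%N%:Z + j) (f u) by apply/fj/tens_unit_gr.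
rewrite subrr => f0; have [_ _ gr0] := qplane_connected QP d1_gt0 d2_gt0.
have : (range (fun c : K => c%:A : A)) (f u) by rewrite -gr0; exact: f0.
move=> [c _ def_c]; exists c, \0.
  exists \0; split=> // t z _; exact: grZ0.
move=> z; rewrite addr0.
pose h : {linear T -> A^o} := cochain_of c%:A.
rewrite (_ : f z = h z); first exact: cochain_ofZ.
by move: z; apply: tens_linear_ext1; rewrite [RHS]fu.
Qed.

Lemma Ext_zero_ge3 n (j : int) : Ext_zero P n.+3 j.
Proof.
move=> f _; exists \0; split=> [t z _|z]; first exact: grZ0.
by rewrite (@koszul_mod_trivial _ _ _ _ _ QP M n z) linear0.
Qed.

Lemma qplane_Ext : Ext_condition gr 2.
Proof.
exists eps, P, (d1 + d2)%N%:Z; split.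
  by move=> n a; apply: qplane_aug_gr.
move=> [|[|[|n]]] j /=.
- exact: Ext_zero0.
- exact: Ext_zero1.
- case: eqP => [->|/eqP j0]; first exact: Ext_line2.
  exact: Ext_zero2.
- exact: Ext_zero_ge3.
Qed.

End ExtTrivial.

(** * Growth, and regularity of quantum planes *)

Section Growth.
Variables (K : fieldType) (A : algType K) (x y : A) (q : K).
Hypothesis QP : quantum_plane x y q.
Local Notation qcoef := (qcoef QP).
Local Notation mon := (qmon x y).

(** The monomials with both exponents at most e span a space of dimension (e + 1)^2;
    these spaces serve to bound the growth of A. *)
Definition exponents_le (e : nat) (a : A) : Prop :=
  forall k, mcoeff k (qcoef a) != 0 -> (k.1 <= e)%N /\ (k.2 <= e)%N.

Lemma exponents_le0 e : exponents_le e 0.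
Proof. by move=> k; rewrite raddf0 mcoeff0 eqxx. Qed.

Lemma exponents_leD e a b :
  exponents_le e a -> exponents_le e b -> exponents_le e (a + b).
Proof.
move=> ha hb k; rewrite raddfD mcoeffD.
have [->|/ha//] := eqVneq (mcoeff k (qcoef a)) 0.
by rewrite add0r => /hb.
Qed.

Lemma exponents_le_mon e c k : (k.1 <= e)%N -> (k.2 <= e)%N ->
  exponents_le e (c *: mon k).
Proof.
move=> h1 h2 l; rewrite qcoef_mon mcoeffU; have [<-//|_] := eqVneq k l.
by rewrite mulr0n eqxx.
Qed.

Lemma exponents_le_ind e (P : A -> Prop) : P 0 ->
  (forall a b, P a -> P b -> P (a + b)) ->
  (forall c k, (k.1 <= e)%N -> (k.2 <= e)%N -> P (c *: mon k)) ->
  forall a, exponents_le e a -> P a.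
Proof.
move=> P0 PD PU a ae; rewrite -[a](qcoefK QP) /qcomb big_seq.
elim/big_rec: _ => // k b; rewrite -mcoeff_neq0 => /ae[k1 k2].
by apply: PD; apply: PU.
Qed.

Lemma exponents_leM e f a b :
  exponents_le e a -> exponents_le f b -> exponents_le (e + f) (a * b).
Proof.
move=> ae bf; elim/exponents_le_ind: a / ae => [|a a' ha ha'|c k k1 k2].
- by rewrite mul0r; apply: exponents_le0.
- by rewrite mulrDl; apply: exponents_leD.
elim/exponents_le_ind: b / bf => [|b b' hb hb'|d l l1 l2].
- by rewrite mulr0; apply: exponents_le0.
- by rewrite mulrDr; apply: exponents_leD.
rewrite -scalerAl -scalerAr (qmonM QP) !scalerA.
by apply: exponents_le_mon; rewrite leq_add.
Qed.

Lemma exponents_le_trans e f a : (e <= f)%N -> exponents_le e a -> exponents_le f a.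
Proof. by move=> ef ae k /ae[k1 k2]; split; apply: leq_trans ef. Qed.

Lemma ex_exponents_le (V : seq A) : exists e, forall a, a \in V -> exponents_le e a.
Proof.
have ex1 a : exists e, exponents_le e a.
  elim/(qplane_ind QP): a => [|a b [e ae] [f bf]|c k].
  - by exists 0%N; apply: exponents_le0.
  - exists (maxn e f); apply: exponents_leD.
      by apply: exponents_le_trans ae; apply: leq_maxl.
    by apply: exponents_le_trans bf; apply: leq_maxr.
  by exists (maxn k.1 k.2); apply: exponents_le_mon; rewrite ?leq_maxl ?leq_maxr.
elim: V => [|a V [e Ve]]; first by exists 0%N.
have [f af] := ex1 a; exists (maxn e f) => b; rewrite inE => /predU1P[->|/Ve be].
  by apply: exponents_le_trans af; apply: leq_maxr.
by apply: exponents_le_trans be; apply: leq_maxl.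
Qed.

Lemma exponents_le_products (V : seq A) e : (forall a, a \in V -> exponents_le e a) ->
  forall n a, a \in products V n -> exponents_le (n * e) a.
Proof.
move=> Ve; elim=> [|n IH] a /=.
  rewrite inE => /eqP ->; rewrite -(qmon0 x y) -[mon _]scale1r.
  exact: exponents_le_mon.
rewrite mem_cat => /orP[/IH|/allpairsP[[b c] /= [/Ve be /IH cn ->]]].
  by apply: exponents_le_trans; rewrite leq_mul2r leqnSn orbT.
by rewrite mulSn; apply: exponents_leM.
Qed.

Lemma lin_indep_size (s : seq A) e : (forall a, a \in s -> exponents_le e a) ->
  lin_indep s -> (size s <= e.+1 ^ 2)%N.
Proof.
move=> se s_free; rewrite leqNgt; apply/negP => lt_s.
pose J : finType := ('I_e.+1 * 'I_e.+1)%type.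
have cardJ : #|J| = (e.+1 ^ 2)%N by rewrite card_prod !card_ord.
pose C : 'M[K]_(size s, #|J|) := \matrix_(i, j)
  mcoeff ((enum_val j : J).1 : nat, (enum_val j : J).2 : nat) (qcoef s`_i).
have : kermx C != 0.
  rewrite kermx_eq0 /row_free; apply/eqP => rC.
  by move: lt_s; rewrite -cardJ -rC ltnNge rank_leq_col.
case/rowV0Pn => v /sub_kermxP vC /negP[].
pose c i := if insub i is Some j then v 0 j else 0.
have cE (j : 'I_(size s)) : c j = v 0 j by rewrite /c valK.
apply/eqP/rowP => j; rewrite mxE -cE; apply: s_free; last exact: ltn_ord.
apply: (can_inj (qcoefK QP)); rewrite raddf0; apply/malgP => k.
rewrite raddf_sum raddf_sum mcoeff0 /=.
have coefZ d a : mcoeff k (qcoef (d *: a)) = d * mcoeff k (qcoef a).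
  elim/(qplane_ind QP): a => [|a b ea eb|d' l].
  - by rewrite scaler0 !raddf0 mulr0.
  - by rewrite scalerDr !raddfD /= ea eb mulrDr.
  by rewrite scalerA !qcoef_mon !mcoeffU mulrnAr.
under eq_bigr => i _ do rewrite coefZ.
have [k_le|k_big] := boolP ((k.1 <= e)%N && (k.2 <= e)%N); last first.
  apply: big1 => i _; apply/eqP; rewrite mulf_eq0; apply/orP; right.
  apply/contraT => /(se _ (mem_nth 0 (ltn_ord i)))[k1 k2].
  by rewrite k1 k2 in k_big.
have /andP[k1 k2] := k_le.
have := congr1 (fun w : 'rV_#|J| => w 0 (enum_rank (Ordinal (k1 : (k.1 < e.+1)%N), Ordinal (k2 : (k.2 < e.+1)%N)))) vC.
rewrite !mxE => {2}<-; apply: eq_bigr => i _.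
by rewrite cE mxE enum_rankK /=; case: (k).
Qed.

Lemma dim_span_le (s : seq A) e : (forall a, a \in s -> exponents_le e a) ->
  (Defs.dim_span s <= e.+1 ^ 2)%N.
Proof.
move=> se; apply/bigmax_leqP => b /asboolP; apply: lin_indep_size => a.
by move=> /mem_mask; apply: se.
Qed.

(** If the exponents in V are at most e, those in the products of at most n elements
    of V are at most n e; so these products span at most (n e + 1)^2 dimensions,
    which is at most n^4 when n > e + 1. *)
Lemma GKdim_lty (R : realType) : (GKdim R A < +oo)%E.
Proof.
apply: (@le_lt_trans _ _ 4%:E); last exact: ltry.
apply: ge_ereal_sup => _ [V _ <-].
have [e Ve] := ex_exponents_le V.
pose U : set nat := [set n | (e.+2 <= n)%N].
have U_oo : \oo U by exists e.+2.
apply: (@le_trans _ _ _ _ _ (ereal_inf_lbound _)).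
  by exists U; [exact: U_oo|].
apply: ge_ereal_sup => _ [n Un <-]; rewrite lee_fin.
have {}Un : (e.+2 <= n)%N := Un.
have n1 : 1 < n%:R :> R by rewrite ltr1n; lia.
have n0 : 0 < n%:R :> R by apply: lt_trans n1.
rewrite ler_pdivrMr ?ln_gt0 // mulr_natl -lnXn // -natrX.
have dim_le : (Defs.dim_span (products V n) <= n ^ 4)%N.
  apply: leq_trans (dim_span_le (exponents_le_products Ve (n := n))) _.
  rewrite (expnM n 2 2) leq_sqr; nia.
have [->|d_gt0] := posnP (Defs.dim_span (products V n)).
  rewrite ln0 // ln_ge0 // natrX exprn_ege1 // ltW //.
rewrite ler_ln ?posrE ?ler_nat ?ltr0n ?expn_gt0 //; lia.
Qed.

End Growth.

Theorem quantum_plane_AS_regular (R : realType) (K : fieldType) (A : algType K)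
    (x y : A) (q : K) (QP : quantum_plane x y q) (d1 d2 : nat) :
  (0 < d1)%N -> (0 < d2)%N -> AS_regular R (qplane_gr QP d1 d2) 2.
Proof.
move=> d1_gt0 d2_gt0; split.
- exact: qplane_connected.
- split; first exact: (gldim_le2 QP).
  exact: (@gldim_ge2 _ _ _ _ _ QP _ (qplane_augX QP) (qplane_augY QP)).
- exact: (GKdim_lty QP).
- exact: qplane_Ext.
Qed.

(** * Free algebras *)

Section FreeAlgebraInduction.
Variables (K : comNzRingType) (X : choiceType).
Local Notation F := (free_alg K X).

Definition word (s : seq X) : F := \prod_(x <- s) var K x.

Lemma free_valU (w : fmonom X) c : Free (mkmalgU w c) = c *: word w :> F.
Proof.
have fD (a b : fmonom X) : Free (mkmalgU (mmul a b) 1) =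
    Free (mkmalgU a 1) * Free (mkmalgU b 1) :> F.
  apply: free_val_inj; rewrite free_valM /= -[RHS]/(fgmul _ _) fgmulUU.
  by rewrite mulr1.
have f1 s : Free (mkmalgU (FMonom s) 1) = word s :> F.
  elim: s => [|x s IH].
    rewrite /word big_nil; apply: free_val_inj; rewrite free_val1 /=.
    by congr (mkmalgU _ _); apply/eqP; rewrite fmP fm1.
  rewrite /word big_cons -/(word s) -IH var.unlock -fD.
  congr (Free (mkmalgU _ _)); apply/eqP; rewrite fmP.
  by rewrite fmM fmU.
case: w => s; rewrite -f1; apply: free_val_inj; rewrite free_valZ /=.
by apply/malgP => k; rewrite mcoeffZ !mcoeffU mulrnAr mulr1.
Qed.

Lemma homogeneous_ind (P : nat -> F -> Prop) :
  (forall n, P n 0) -> (forall n p r, P n p -> P n r -> P n (p + r)) ->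
  (forall n c p, P n p -> P n (c *: p)) -> P 0%N 1 ->
  (forall n x p, P n p -> P n.+1 (var K x * p)) ->
  forall n p, homogeneous n p -> P n p.
Proof.
move=> P0 PD PZ P1 PX n [p] pn.
apply: (@family_gr_ind _ _ _ (@fdeg X) n (fun p => P n (Free p))) pn.
- exact: P0.
- by move=> z t; apply: PD.
move=> w c <-; rewrite free_valU; apply: PZ; rewrite fdegE.
case: w => s /=; rewrite /word; elim: s => [|x s IH]; first by rewrite big_nil.
by rewrite big_cons; apply: PX.
Qed.

Lemma free_alg_ind (P : F -> Prop) : P 1 ->
  (forall p r, P p -> P r -> P (p + r)) -> (forall c p, P p -> P (c *: p)) ->
  (forall x p, P p -> P (var K x * p)) -> forall p, P p.
Proof.
move=> P1 PD PZ PX [p].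
apply: (@malg_add_ind _ _ (fun p => P (Free p))) p.
- by have := PZ 0 1 P1; rewrite scale0r.
- by move=> z t; apply: PD.
move=> w c; rewrite free_valU; apply: PZ.
case: w => s /=; rewrite /word; elim: s => [|x s IH]; first by rewrite big_nil.
by rewrite big_cons; apply: PX.
Qed.

Lemma homogeneous0 n : homogeneous n (0 : F).
Proof. by move=> w; rewrite mcoeff0 eqxx. Qed.

Lemma homogeneousD n (p r : F) :
  homogeneous n p -> homogeneous n r -> homogeneous n (p + r).
Proof. exact: (@family_grD _ _ _ (@fdeg X)). Qed.

Lemma homogeneousZ n c (p : F) : homogeneous n p -> homogeneous n (c *: p).
Proof.
move=> pn w; rewrite free_valZ mcoeffZ.
by have [->|/pn//] := eqVneq (mcoeff w (free_val p)) 0; rewrite mulr0 eqxx.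
Qed.

Lemma homogeneous1 : homogeneous 0 (1 : F).
Proof. apply: (@family_grU _ _ _ (@fdeg X)); exact: fdeg1. Qed.

Lemma homogeneous_varM n x (p : F) :
  homogeneous n p -> homogeneous n.+1 (var K x * p).
Proof.
case: p => p; apply: (@family_gr_ind _ _ _ (@fdeg X) n
    (fun p => homogeneous n.+1 (var K x * Free p))).
- by rewrite [X in homogeneous _ X]mulr0; apply: homogeneous0.
- move=> z t hz ht; rewrite [Free _](_ : _ = Free z + Free t) // mulrDr.
  exact: homogeneousD.
move=> w c; rewrite fdegE => wn; rewrite free_valU -scalerAr.
apply: homogeneousZ.
have -> : var K x * word w = word (FMonom (x :: w)) by rewrite /word big_cons.
rewrite -[word _]scale1r -free_valU.
by apply: (@family_grU _ _ _ (@fdeg X)); rewrite fdegE /= wn.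
Qed.

End FreeAlgebraInduction.

(** Evaluation in a noncommutative ring in which the scalars are central. *)
Lemma ex_evaluation (K : comNzRingType) (X : choiceType) (B : nzRingType)
    (iota : {rmorphism K -> B}) (f : X -> B) :
  (forall c b, GRing.comm (iota c) b) ->
  exists2 ev : {rmorphism free_alg K X -> B},
    forall x, ev (var K x) = f x & forall c p, ev (c *: p) = iota c * ev p.
Proof.
move=> iota_central.
pose h (w : fmonom X) : B := \prod_(x <- (w : seq X)) f x.
have h_mm : mmorphism h.
  by split=> [w1 w2|]; rewrite /h ?fmM ?big_cat // fm1 big_nil.
pose hM : MMorphism.type (fmonom X) B :=
  HB.pack h (isMultiplicative.Build _ _ h h_mm).
pose ev (p : free_alg K X) : B := monalg.mmap iota hM (free_val p).
have evB : zmod_morphism ev by move=> p r; rewrite /ev -raddfB.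
have evM : monoid_morphism ev.
  have [mM m1] := @commr_mmap_is_multiplicative _ _ _ iota hM
    (fun g m m' => iota_central _ _).
  by split=> [|p r]; rewrite /ev ?free_val1 ?free_valM ?m1 ?mM.
pose evL : {rmorphism free_alg K X -> B} := HB.pack ev
  (GRing.isZmodMorphism.Build _ _ ev evB)
  (GRing.isMonoidMorphism.Build _ _ ev evM).
exists evL => [x|c p].
  by rewrite /= /ev var.unlock /= monalg.mmapU /= rmorph1 mul1r /h fmU big_seq1.
by rewrite /= /ev free_valZ monalg.mmapZ.
Qed.

Section Presentations.
Variables (K : fieldType) (F : algType K) (rels : seq F).
Hypothesis proper : ~ gen_ideal rels 1.
Local Notation Q := (quotient (rel_ideal proper)).

Lemma quo_rel r : r \in rels -> quo (rel_ideal proper) r = 0.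
Proof.
move=> r_rel; rewrite -(raddf0 (quo (rel_ideal proper))).
apply/quoP; rewrite subr0; exists [:: (1, r, 1)].
  by move=> t; rewrite inE => /eqP ->.
by rewrite big_seq1 mul1r mulr1.
Qed.

Lemma quotient_rmorphism (B : nzRingType) (ev : {rmorphism F -> B}) :
  (forall r, r \in rels -> ev r = 0) ->
  exists rho : {rmorphism Q -> B}, forall p, rho (quo _ p) = ev p.
Proof.
move=> ev0; pose rho (z : Q) : B := ev (quo_repr z).
have rhoE p : rho (quo _ p) = ev p.
  have /quoP[s hs e] := quo_reprK (quo (rel_ideal proper) p).
  apply/eqP; rewrite /rho -subr_eq0 -rmorphB e rmorph_sum big_seq.
  rewrite big1 // => t /hs /ev0 ht.
  by rewrite !rmorphM ht mulr0 mul0r.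
have quoE (z : Q) : exists p, z = quo _ p by have [p <-] := quo_surj z; exists p.
have rhoB : zmod_morphism rho.
  move=> z t; have [[p ->] [r ->]] := (quoE z, quoE t).
  by rewrite -raddfB !rhoE raddfB.
have rhoM : monoid_morphism rho.
  split=> [|z t]; first by rewrite -(rmorph1 (quo _)) rhoE rmorph1.
  have [[p ->] [r ->]] := (quoE z, quoE t).
  by rewrite -rmorphM !rhoE rmorphM.
pose rhoL : {rmorphism Q -> B} := HB.pack rho
  (GRing.isZmodMorphism.Build _ _ rho rhoB)
  (GRing.isMonoidMorphism.Build _ _ rho rhoM).
by exists rhoL.
Qed.

End Presentations.

(** * Algebras generated by a dihedral group *)

Section Dihedral.
Variables (K : fieldType) (H : algType K) (s r : H) (n : nat).
Hypothesis n_gt0 : (0 < n)%N.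
Hypotheses (ss : s * s = 1) (rn : r ^+ n = 1) (srs : s * r * (s * r) = 1).
Hypothesis gen : forall P : H -> Prop, P 1 ->
  (forall g h, P g -> P h -> P (g + h)) -> (forall c h, P h -> P (c *: h)) ->
  (forall h, P h -> P (s * h)) -> (forall h, P h -> P (r * h)) -> forall h, P h.

Let r' := r ^+ n.-1.

Let rr' : r * r' = 1. Proof. by rewrite /r' -exprS prednK. Qed.
Let r'r : r' * r = 1. Proof. by rewrite /r' -exprSr prednK. Qed.

Let sr : s * r = r' * s.
Proof.
have e : r * (s * r) = s by rewrite -[LHS]mul1r -ss -!mulrA (mulrA s r) srs mulr1.
by rewrite -[LHS]mul1r -r'r -!mulrA e.
Qed.

Let rs : r * s = s * r'.
Proof. by rewrite -[LHS]mulr1 -rr' !mulrA -(mulrA r s r) sr (mulrA r) rr' mul1r. Qed.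

(** Normal form: the relation r s = s r^-1 moves all the factors s to the left. *)
Lemma dihedral_span (h : H) :
  exists P Q : {poly K}, h = horner_alg r P + s * horner_alg r Q.
Proof.
have sR P : r * (s * horner_alg r P) = s * horner_alg r ('X^(n.-1) * P).
  by rewrite mulrA rs rmorphM /= rmorphXn /= horner_algX -mulrA.
elim/gen: h => [|g h [P [Q ->]] [P' [Q' ->]]|c h [P [Q ->]]|h [P [Q ->]]|h [P [Q ->]]].
- by exists 1, 0; rewrite rmorph1 rmorph0 mulr0 addr0.
- by exists (P + P'), (Q + Q'); rewrite !rmorphD mulrDr addrACA.
- exists (c *: P), (c *: Q).
  rewrite scalerDr scalerAr -!mul_polyC.
  by rewrite !rmorphM /= horner_algC !mulr_algl.
- by exists Q, P; rewrite mulrDr mulrA ss mul1r addrC.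
exists ('X * P), ('X^(n.-1) * Q).
by rewrite mulrDr sR [horner_alg r ('X * P)]rmorphM /= horner_algX.
Qed.

(** Such a P is a multiple of X^n - 1. *)
Lemma dihedral_poly_eq0 (w : K) (P : {poly K}) : n.-primitive_root w ->
  (forall k, root P (w ^+ k)) -> horner_alg r P = 0.
Proof.
move=> wP rootP.
have /dvdpP[Q ->] : 'X^n - 1 %| P.
  rewrite -(factor_Xn_sub_1 wP) big_mkord.
  rewrite -(big_map (fun k : 'I_n => w ^+ k) predT (fun z => 'X - z%:P)) /=.
  apply: uniq_roots_dvdp.
    by apply/allP => _ /mapP[k _ ->]; apply: rootP.
  rewrite uniq_rootsE map_inj_uniq ?index_enum_uniq // => j k /eqP.
  by rewrite (eq_prim_root_expr wP) !modn_small // => /eqP/val_inj.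
rewrite rmorphM rmorphB rmorphXn rmorph1 /= horner_algX rn.
by rewrite subrr mulr0.
Qed.

Hypotheses (n_neq0 : n%:R != 0 :> K) (two_neq0 : 2 != 0 :> K).

(** Maschke's theorem: a linear projection onto a left ideal is averaged first over
    the powers of r, and then over s; the kernel of the average is a complement. *)
Lemma dihedral_semisimple : semisimple H.
Proof.
move=> I [I0 ID IM].
have IZ c x : I x -> I (c *: x) by move=> Ix; rewrite -mulr_algl; apply: IM.
have [|p [pI pid]] := @subspace_projection K H I.
  by split=> // c x y Ix Iy; apply: ID => //; apply: IZ.
pose p1 x := n%:R^-1 *: \sum_(k < n) r ^+ k * p (r ^+ (n - k) * x).
have p1_lin c x y : p1 (c *: x + y) = c *: p1 x + p1 y.
  rewrite /p1 scalerA mulrC -scalerA -scalerDr; congr (_ *: _).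
  rewrite scaler_sumr -big_split; apply: eq_bigr => k _ /=.
  by rewrite mulrDr -scalerAr linearP mulrDr -scalerAr.
have p1I x : I (p1 x).
  by apply: IZ; elim/big_rec: _ => // k y _; apply: ID; apply: IM.
have p1id x : I x -> p1 x = x.
  move=> Ix; rewrite /p1 (eq_bigr (fun=> x)) => [|k _]; last first.
    by rewrite pid ?mulrA -?exprD ?subnKC ?rn ?mul1r //; [apply: ltnW|apply: IM].
  by rewrite sumr_const card_ord -scaler_nat scalerA mulVf // scale1r.
have p1r x : p1 (r * x) = r * p1 x.
  rewrite /p1 -scalerAr; congr (_ *: _); rewrite mulr_sumr.
  pose F k := r ^+ k * p (r ^+ (n.+1 - k) * x).
  have -> : \sum_(k < n) r ^+ k * p (r ^+ (n - k) * (r * x)) = \sum_(0 <= k < n) F k.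
    rewrite big_mkord; apply: eq_bigr => k _.
    by rewrite /F mulrA -exprSr subSn // ltnW.
  have -> : \sum_(k < n) r * (r ^+ k * p (r ^+ (n - k) * x)) = \sum_(1 <= k < n.+1) F k.
    rewrite big_add1 big_mkord; apply: eq_bigr => k _.
    by rewrite /F mulrA -exprS subSS.
  rewrite big_nat_recr //= [LHS]big_ltn // addrC; congr (_ + _).
  by rewrite /F rn expr0 subn0 exprS rn subSnn mulr1.
have p1r' x : p1 (r' * x) = r' * p1 x.
  by rewrite -[LHS]mul1r -r'r -mulrA -p1r mulrA rr' mul1r.
clearbody p1; pose p2 x := 2^-1 *: (p1 x + s * p1 (s * x)).
have p2_lin c x y : p2 (c *: x + y) = c *: p2 x + p2 y.
  rewrite /p2 mulrDr -scalerAr !p1_lin mulrDr -scalerAr addrACA -scalerDr.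
  by rewrite [LHS]scalerDr !scalerA (mulrC 2^-1).
have p20 : p2 0 = 0.
  have := p2_lin (-1) 0 0; rewrite scaler0 addr0 scaleN1r => ->.
  exact: addNr.
have p2H h x : p2 (h * x) = h * p2 x.
  elim/gen: h x => [|g h hg hh|c h hh|h hh|h hh] x.
  - by rewrite !mul1r.
  - rewrite !mulrDl -[g * x]scale1r p2_lin !scale1r hg hh.
    by [].
  - by rewrite -!scalerAl -[c *: (h * x)]addr0 p2_lin hh p20 addr0.
  - rewrite -!mulrA -hh /p2 -scalerAr; congr (_ *: _).
    by rewrite mulrDr !mulrA ss !mul1r addrC.
  rewrite -!mulrA -hh /p2 -scalerAr; congr (_ *: _).
  by rewrite mulrDr p1r !mulrA sr rs -!mulrA p1r'.
have p2I x : I (p2 x) by apply/IZ/ID; rewrite ?p1I //; apply/IM/p1I.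
have p2id x : I x -> p2 x = x.
  move=> Ix; rewrite /p2 !p1id //; last exact: IM.
  by rewrite mulrA ss mul1r -mulr2n -scaler_nat scalerA mulVf // scale1r.
exists [set x | p2 x = 0]; split.
- split=> [|x y /= x0 y0|x y /= y0].
  + exact: p20.
  + by rewrite -[x]scale1r p2_lin x0 y0 scaler0 addr0.
  + by rewrite p2H y0 mulr0.
- move=> x; exists (p2 x), (x - p2 x); split=> //=; last by rewrite addrC subrK.
  by rewrite addrC -scaleN1r p2_lin (p2id (p2 x)) // scaleN1r addNr.
by move=> x Ix /= x0; rewrite -(p2id x Ix).
Qed.

End Dihedral.

Section B4mDihedral.
Variables (K : fieldType) (m : nat).
Local Notation H := (B4m K m).
Local Notation a := (B4m_a K m).
Local Notation sp := (B4m_sp K m).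
Local Notation sm := (B4m_sm K m).

Let rel_quo j : (j < 6)%N ->
  quo (rel_ideal (@B4m_proper K m)) (nth 0 (B4m_rels K m) j) = 0.
Proof. by move=> j6; apply/quo_rel/mem_nth. Qed.

Lemma B4m_spsp : sp * sp = 1.
Proof.
by have := @rel_quo 3 isT; rewrite rmorphB rmorphXn rmorph1 => /subr0_eq; rewrite expr2.
Qed.

Lemma B4m_smsm : sm * sm = 1.
Proof.
by have := @rel_quo 4 isT; rewrite rmorphB rmorphXn rmorph1 => /subr0_eq; rewrite expr2.
Qed.

Lemma B4m_aa : a * a = 1.
Proof.
by have := @rel_quo 2 isT; rewrite rmorphB rmorphXn rmorph1 => /subr0_eq; rewrite expr2.
Qed.

Lemma B4m_asp : a * sp = sp * a.
Proof.
by have := @rel_quo 0 isT; rewrite rmorphB !rmorphM => /subr0_eq.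
Qed.

Lemma B4m_asm : a * sm = sm * a.
Proof.
by have := @rel_quo 1 isT; rewrite rmorphB !rmorphM => /subr0_eq.
Qed.

Lemma B4m_rm : (sp * sm) ^+ m = a.
Proof.
by have := @rel_quo 5 isT; rewrite rmorphB rmorphXn rmorphM => /subr0_eq.
Qed.

Lemma B4m_r2m : (sp * sm) ^+ (2 * m) = 1.
Proof. by rewrite mulnC exprM B4m_rm expr2 B4m_aa. Qed.

Lemma B4m_sprspr : sp * (sp * sm) * (sp * (sp * sm)) = 1.
Proof. by rewrite !(mulrA sp sp) B4m_spsp !mul1r B4m_smsm. Qed.

Lemma B4m_ind (P : H -> Prop) : P 1 -> (forall g h, P g -> P h -> P (g + h)) ->
  (forall c h, P h -> P (c *: h)) -> (forall h, P h -> P (sp * h)) ->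
  (forall h, P h -> P (sm * h)) -> (forall h, P h -> P (a * h)) ->
  forall h, P h.
Proof.
move=> P1 PD PZ Psp Psm Pa h; have [p <-] := quo_surj h.
elim/free_alg_ind: p => [|p r hp hr|c p hp|x p hp].
- by rewrite rmorph1.
- by rewrite rmorphD; apply: PD.
- by rewrite linearZ; apply: PZ.
rewrite rmorphM; case: x => [[]|]; [exact: Psp|exact: Psm|exact: Pa].
Qed.

(** The subalgebra generated by s_+ and r = s_+ s_- contains s_- = s_+ r and a = r^m. *)
Lemma B4m_dihedral_ind (P : H -> Prop) : P 1 ->
  (forall g h, P g -> P h -> P (g + h)) -> (forall c h, P h -> P (c *: h)) ->
  (forall h, P h -> P (sp * h)) -> (forall h, P h -> P (sp * sm * h)) ->
  forall h, P h.
Proof.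
move=> P1 PD PZ Psp Pr; apply: B4m_ind => // h Ph.
  by rewrite -[sm]mul1r -B4m_spsp -!mulrA; apply: Psp; rewrite mulrA; apply: Pr.
have Prk k : P ((sp * sm) ^+ k * h).
  elim: k => [|k IH]; first by rewrite expr0 mul1r.
  by rewrite exprS -mulrA; apply: Pr.
by have := Prk m; rewrite B4m_rm.
Qed.

End B4mDihedral.

(** * The algebra u^2 = q v^2 *)

Section AminusRepresentation.
Variables (K : fieldType) (q : K).
Local Notation A := (Aminus q).
Local Notation u := (Aminus_u q).
Local Notation v := (Aminus_v q).

Lemma Aminus_rel : u ^+ 2 = q *: v ^+ 2.
Proof.
have := quo_rel (@Aminus_proper K q) (mem_head _ _).
by rewrite rmorphB /= linearZ /= !rmorphXn => /subr0_eq.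
Qed.

Lemma Aminus_ind (P : A -> Prop) : P 1 -> (forall b c, P b -> P c -> P (b + c)) ->
  (forall d b, P b -> P (d *: b)) -> (forall b, P b -> P (u * b)) ->
  (forall b, P b -> P (v * b)) -> forall b, P b.
Proof.
move=> P1 PD PZ Pu Pv b; have [p <-] := quo_surj b.
elim/free_alg_ind: p => [|p r hp hr|c p hp|x p hp].
- by rewrite rmorph1.
- by rewrite rmorphD; apply: PD.
- by rewrite linearZ; apply: PZ.
by rewrite rmorphM; case: x; [exact: Pu|exact: Pv].
Qed.

Lemma Aminus_representation (B : nzRingType) (iota : {rmorphism K -> B}) (U V : B) :
  (forall c b, GRing.comm (iota c) b) -> U ^+ 2 = iota q * V ^+ 2 ->
  exists2 rho : {rmorphism A -> B}, rho u = U /\ rho v = V &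
    forall c b, rho (c *: b) = iota c * rho b.
Proof.
move=> iota_central UV.
have [ev evX evZ] := @ex_evaluation _ _ B iota (fun x => if x then U else V) iota_central.
have [|rho rhoE] := quotient_rmorphism (@Aminus_proper K q) (ev := ev).
  by move=> r; rewrite inE => /eqP ->; rewrite rmorphB evZ !rmorphXn !evX UV subrr.
exists rho; first by rewrite !rhoE !evX.
by move=> c b; have [p <-] := quo_surj b; rewrite -linearZ !rhoE evZ.
Qed.

End AminusRepresentation.

Section AminusQuantumPlane.
Variables (K : fieldType) (q s : K).
Hypotheses (s2 : s ^+ 2 = q) (s_neq0 : s != 0) (two_neq0 : 2 != 0 :> K).
Local Notation A := (Aminus q).
Local Notation u := (Aminus_u q).
Local Notation v := (Aminus_v q).

(** As s^2 v^2 = u^2, these two elements anticommute. *)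
Definition Aminus_x : A := u + s *: v.
Definition Aminus_y : A := u - s *: v.
Local Notation x := Aminus_x.
Local Notation y := Aminus_y.

Lemma Aminus_uE : u = 2^-1 *: (x + y).
Proof.
rewrite /x /y addrACA subrr addr0 -mulr2n -scaler_nat scalerA mulVf //.
by rewrite scale1r.
Qed.

Lemma Aminus_vE : v = (2 * s)^-1 *: (x - y).
Proof.
rewrite /x /y opprB [s *: v - u]addrC addrACA subrr add0r -mulr2n -scaler_nat.
by rewrite !scalerA -mulrA mulVf ?scale1r // mulf_neq0.
Qed.

Lemma Aminus_yx : y * x = -1 *: (x * y).
Proof.
have vv : (s *: v) * (s *: v) = u * u.
  by rewrite -scalerAl -scalerAr scalerA -!expr2 s2 -Aminus_rel.
rewrite /x /y !(mulrDl, mulrDr, mulNr, mulrN) vv scaleN1r.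
rewrite [u * u + _]addrC addrACA subrr addr0 opprD !opprB.
by rewrite subrKA.
Qed.

Local Notation NN := (nat * nat)%type.
Local Notation R := {poly {poly K}}.
Local Notation S := ('X%:P : R).
Local Notation T := ('X : R).

Let iota : {rmorphism K -> 'M[R]_2} := @scalar_mx R 2 \o polyC \o polyC.
Let X : 'M[R]_2 := \matrix_(i, j) (if i == j then if val i == 0%N then S else - S else 0).
Let Y : 'M[R]_2 := \matrix_(i, j) (if i == j then 0 else T).
Let U := iota 2^-1 * (X + Y).
Let V := iota (2 * s)^-1 * (X - Y).
Let e : 'rV[R]_2 := delta_mx 0 0.
Let f : 'cV[R]_2 := const_mx 1.

Let iotaC c b : GRing.comm (iota c) b.
Proof. by rewrite /GRing.comm /= -[LHS]scalar_mxC. Qed.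

Let YX : Y * X = - (X * Y).
Proof.
apply/matrixP => i j; rewrite !mxE !big_ord_recl !big_ord0 !mxE.
case: i j => [[|[|]]//= ?] [[|[|]]//= ?];
by rewrite -?val_eqE /=; ring.
Qed.

Let UV : U ^+ 2 = iota q * V ^+ 2.
Proof.
have XY2 : (X - Y) ^+ 2 = (X + Y) ^+ 2.
  rewrite !expr2 !(mulrDl, mulrDr, mulrN, mulNr) YX !opprK.
  by rewrite subrKA [RHS]addrA addrK.
rewrite /U /V !exprMn_comm; try exact: iotaC.
rewrite XY2 mulrA -!rmorphXn -rmorphM; congr (iota _ * _).
by rewrite -s2 invfM exprMn mulrCA [s^-1 ^+ 2]exprVn mulfV ?mulr1 // expf_neq0.
Qed.

Let half (Z : 'M[R]_2) : iota 2^-1 * (Z + Z) = Z.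
Proof.
have -> : Z + Z = iota 2 * Z.
  by rewrite -[2]/(1 + 1) rmorphD rmorph1 mulrDl mul1r.
by rewrite mulrA -rmorphM mulVf // rmorph1 mul1r.
Qed.

Let sV : iota s * V = iota 2^-1 * (X - Y).
Proof.
rewrite /V mulrA -rmorphM; congr (iota _ * _).
by rewrite invfM mulrCA mulfV ?mulr1.
Qed.

Let UX : U + iota s * V = X.
Proof. by rewrite sV /U -mulrDr addrACA subrr addr0 half. Qed.

Let UY : U - iota s * V = Y.
Proof. by rewrite sV /U -mulrBr opprB addrC addrA subrK half. Qed.

Let eX i : e *m X ^+ i = S ^+ i *: e.
Proof.
have e1 : e *m X = S *: e.
  apply/rowP => j; rewrite !mxE big_ord_recl big_ord1 !mxE /=.
  by case: j => [[|[|]]//= ?]; rewrite -?val_eqE /=; ring.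
elim: i => [|i IH]; first by rewrite !expr0 mulmx1 scale1r.
by rewrite exprS mulmxA e1 -scalemxAl IH scalerA -exprS.
Qed.

Let Yf j : Y ^+ j *m f = T ^+ j *: f.
Proof.
have f1 : Y *m f = T *: f.
  apply/colP => i; rewrite !mxE big_ord_recl big_ord1 !mxE /=.
  by case: i => [[|[|]]//= ?]; rewrite -?val_eqE /=; ring.
elim: j => [|j IH]; first by rewrite !expr0 mul1mx scale1r.
by rewrite exprSr -mulmxA f1 -scalemxAr IH scalerA -exprS.
Qed.

(** The products x^i y^j are separated by a matrix coefficient of the
    representation of x and y by the two matrices above. *)
Lemma Aminus_free (c : {malg K[NN]}) : qcomb x y c = 0 -> c = 0.
Proof.
have [rho [rho_u rho_v] rhoZ] := Aminus_representation iotaC UV.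
pose L b : R := (e *m rho b *m f) 0 0.
have LD b d : L (b + d) = L b + L d by rewrite /L rmorphD mulmxDr mulmxDl mxE.
have Lmon d k : L (d *: qmon x y k) = d%:P%:P * (S ^+ k.1 * T ^+ k.2).
  rewrite /L rhoZ /qmon rmorphM !rmorphXn /= {1}/x {1}/y rmorphD rmorphB /= !rhoZ.
  rewrite rho_u rho_v UX UY -mulmxE mul_scalar_mx -scalemxAr -scalemxAl.
  rewrite mulmxA eX -!mulmxA Yf -scalemxAl -scalemxAr !mxE big_ord_recl big_ord1 !mxE /=.
  by rewrite mul1r mul0r addr0 mulr1.
have L0 : L 0 = 0 by rewrite /L rmorph0 mulmx0 mul0mx mxE.
have coefL l : forall c, ((L (qcomb x y c))`_l.2)`_l.1 = mcoeff l c.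
  pose g c := ((L (qcomb x y c))`_l.2)`_l.1.
  have g0 : g 0 = 0 by rewrite /g [qcomb _ _ 0]raddf0 L0 !coef0.
  have gD b d : g (b + d) = g b + g d.
    by rewrite /g [qcomb _ _ _]raddfD LD !coefD.
  have gU k d : g (mkmalgU k d) = mcoeff l (mkmalgU k d).
    rewrite /g qcombU Lmon mcoeffU -rmorphXn mulrA -polyCM coefCM coefXn.
    have -> : (k == l) = (l.1 == k.1) && (l.2 == k.2).
      by case: (k) (l) => [k1 k2] [l1 l2] /=; rewrite eq_sym xpair_eqE.
    have [_|_] := eqVneq l.2 k.2; last by rewrite mulr0 coef0 andbF.
    by rewrite mulr1 coefCM coefXn andbT mulr_natr.
  suff gE b : g b = mcoeff l b by exact: gE.
  clearbody g; elim/malg_add_ind: b => [|b d hb hd|//].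
    by rewrite g0 mcoeff0.
  by rewrite gD hb hd mcoeffD.
by move=> c0; apply/malgP => l; rewrite -coefL c0 L0 !coef0 mcoeff0.
Qed.

Lemma Aminus_quantum_plane : quantum_plane x y (-1).
Proof.
apply: quantum_plane_intro; first exact: Aminus_yx.
- by rewrite oppr_eq0 oner_eq0.
- move=> P P1 PD PZ Px Py; apply: Aminus_ind => // b Pb.
    rewrite Aminus_uE -scalerAl; apply: (PZ); rewrite mulrDl.
    by apply: PD; [apply: Px|apply: Py].
  rewrite Aminus_vE -scalerAl; apply: (PZ); rewrite mulrBl -scaleN1r.
  by apply: PD; [apply: Px|apply/PZ/Py].
- exact: Aminus_free.
Qed.

Lemma Aminus_gr0 n : Aminus_gr n (0 : A).
Proof. by exists 0; [exact: homogeneous0|rewrite raddf0]. Qed.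

Lemma Aminus_gr1 : Aminus_gr 0 (1 : A).
Proof. by exists 1; [exact: homogeneous1|rewrite rmorph1]. Qed.

Lemma Aminus_grD n (b c : A) :
  Aminus_gr n b -> Aminus_gr n c -> Aminus_gr n (b + c).
Proof.
move=> [p pn ->] [r rn ->]; exists (p + r); last by rewrite raddfD.
exact: homogeneousD.
Qed.

Lemma Aminus_grZ n d (b : A) : Aminus_gr n b -> Aminus_gr n (d *: b).
Proof.
move=> [p pn ->]; exists (d *: p); last by rewrite linearZ.
exact: homogeneousZ.
Qed.

Lemma Aminus_gr_mulu n (b : A) : Aminus_gr n b -> Aminus_gr n.+1 (u * b).
Proof.
move=> [p pn ->]; exists (var K true * p); last by rewrite rmorphM.
exact: homogeneous_varM.
Qed.

Lemma Aminus_gr_mulv n (b : A) : Aminus_gr n b -> Aminus_gr n.+1 (v * b).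
Proof.
move=> [p pn ->]; exists (var K false * p); last by rewrite rmorphM.
exact: homogeneous_varM.
Qed.

Lemma Aminus_gr_ind (P : nat -> A -> Prop) :
  (forall n, P n 0) -> (forall n b c, P n b -> P n c -> P n (b + c)) ->
  (forall n d b, P n b -> P n (d *: b)) -> P 0%N 1 ->
  (forall n b, P n b -> P n.+1 (u * b)) ->
  (forall n b, P n b -> P n.+1 (v * b)) ->
  forall n b, Aminus_gr n b -> P n b.
Proof.
move=> P0 PD PZ P1 Pu Pv n _ [p pn ->]; move: n p pn.
apply: homogeneous_ind => [n|n p r hp hr|n d p hp||n z p hp].
- by rewrite raddf0.
- by rewrite raddfD; apply: PD.
- by rewrite linearZ; apply: PZ.
- by rewrite rmorph1.
by rewrite rmorphM; case: z; [apply: Pu|apply: Pv].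
Qed.

Lemma Aminus_grE : @Aminus_gr K q = qplane_gr Aminus_quantum_plane 1 1.
Proof.
have QP := Aminus_quantum_plane.
have [_ grM _] := qplane_connected QP (ltn0Sn 0) (ltn0Sn 0).
apply/funext => n; apply/seteqP; split=> b.
  move: n b; apply: Aminus_gr_ind => [n|n b c|n d b||n b hb|n b hb].
  - exact: qplane_gr0.
  - exact: qplane_grD.
  - exact: qplane_grZ.
  - by rewrite -(qmon0 x y) -[qmon _ _ _]scale1r; apply: qplane_gr_mon.
  - rewrite -[n.+1]add1n; apply: qplane_grM hb; rewrite Aminus_uE.
    by apply/qplane_grZ/qplane_grD; [apply: qplane_grX|apply: qplane_grY].
  - rewrite -[n.+1]add1n; apply: qplane_grM hb; rewrite Aminus_vE -scaleN1r.
    by apply/qplane_grZ/qplane_grD; [apply: qplane_grX|apply/qplane_grZ/qplane_grY].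
have gx k c : Aminus_gr k c -> Aminus_gr k.+1 (x * c).
  move=> ck; rewrite mulrDl -scalerAl; apply: Aminus_grD; first exact: Aminus_gr_mulu.
  exact/Aminus_grZ/Aminus_gr_mulv.
have gy k c : Aminus_gr k c -> Aminus_gr k.+1 (y * c).
  move=> ck; rewrite mulrBl -scalerAl -scaleNr; apply: Aminus_grD; first exact: Aminus_gr_mulu.
  exact/Aminus_grZ/Aminus_gr_mulv.
move=> bn; elim/qplane_gr_ind: b / bn => [|b c|c [i j] <-].
- exact: Aminus_gr0.
- exact: Aminus_grD.
apply: Aminus_grZ; rewrite /qdeg /= !muln1 /qmon /=.
elim: i => [|i IH]; last by rewrite exprS -mulrA; apply: gx.
rewrite mul1r; elim: j => [|j IH]; last by rewrite exprS; apply: gy.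
by exists 1; [exact: homogeneous1|rewrite rmorph1].
Qed.

End AminusQuantumPlane.

(** * Alternating words *)

Section Words.
Variables (K : fieldType) (A : algType K) (q : K) (u v : A).
Hypotheses (q_neq0 : q != 0) (uv2 : u ^+ 2 = q *: v ^+ 2).
Hypothesis gen : forall P : A -> Prop, P 1 ->
  (forall b c, P b -> P c -> P (b + c)) -> (forall d b, P b -> P (d *: b)) ->
  (forall b, P b -> P (u * b)) -> (forall b, P b -> P (v * b)) -> forall b, P b.
Local Notation z := (u ^+ 2).

Let vv : v * v = q^-1 *: z.
Proof. by rewrite uv2 scalerA mulVf // scale1r expr2. Qed.

Lemma square_central b : z * b = b * z.
Proof.
elim/gen: b => [|b c hb hc|d b hb|b hb|b hb].
- by rewrite mulr1 mul1r.
- by rewrite mulrDl mulrDr hb hc.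
- by rewrite -scalerAl -scalerAr hb.
- by rewrite -[RHS]mulrA -hb !mulrA -exprSr exprS.
have zv : z * v = v * z.
  by rewrite uv2 -[LHS]scalerAl -[RHS]scalerAr -exprSr exprS.
by rewrite -[RHS]mulrA -hb mulrA zv -mulrA.
Qed.

Lemma u_vu k : u * (v * u) ^+ k = (u * v) ^+ k * u.
Proof.
elim: k => [|k IH]; first by rewrite !expr0 mulr1 mul1r.
by rewrite exprSr mulrA IH exprSr -!mulrA.
Qed.

Lemma v_uv k : v * (u * v) ^+ k = (v * u) ^+ k * v.
Proof.
elim: k => [|k IH]; first by rewrite !expr0 mulr1 mul1r.
by rewrite exprSr mulrA IH exprSr -!mulrA.
Qed.

(** The set of combinations of alternating words with coefficients in k[z] is stable
    under multiplication by u and v, since uu and vv are multiples of the central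
    element z. *)
Lemma words_span (Q : A -> Prop) : (forall b c, Q b -> Q c -> Q (b + c)) ->
  (forall d b, Q b -> Q (d *: b)) -> (forall b, Q b -> Q (z * b)) ->
  (forall k, Q ((u * v) ^+ k)) -> (forall k, Q ((v * u) ^+ k)) ->
  (forall k, Q ((u * v) ^+ k * u)) -> (forall k, Q ((v * u) ^+ k * v)) ->
  forall b, Q b.
Proof.
move=> QD QZ Qz Quv Qvu Quvu Qvuv b; move: b Q QD QZ Qz Quv Qvu Quvu Qvuv.
elim/gen => [|b c hb hc|d b hb|b hb|b hb] Q QD QZ Qz Quv Qvu Quvu Qvuv.
- by have := Quv 0%N; rewrite expr0.
- by apply: (QD); [apply: hb|apply: hc].
- by apply: (QZ); apply: hb.
- apply: (hb (fun b => Q (u * b))) => [c d hc hd|d c hc|c hc|k|k|k|k].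
  + by rewrite mulrDr; apply: QD.
  + by rewrite -scalerAr; apply: QZ.
  + by rewrite mulrA -square_central -mulrA; apply: Qz.
  + case: k => [|k]; first by have := Quvu 0%N; rewrite !expr0 mulr1 mul1r.
    have -> : u * (u * v) ^+ k.+1 = z * ((v * u) ^+ k * v).
      by rewrite -v_uv exprS expr2 !mulrA.
    exact: Qz.
  + by rewrite u_vu; apply: Quvu.
  + by rewrite -u_vu mulrA -expr2; apply/Qz/Qvu.
  + by rewrite mulrA u_vu -mulrA -exprSr; apply: Quv.
apply: (hb (fun b => Q (v * b))) => [c d hc hd|d c hc|c hc|k|k|k|k].
- by rewrite mulrDr; apply: QD.
- by rewrite -scalerAr; apply: QZ.
- by rewrite mulrA -square_central -mulrA; apply: Qz.
- by rewrite v_uv; apply: Qvuv.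
- case: k => [|k]; first by have := Qvuv 0%N; rewrite !expr0 mulr1 mul1r.
  have -> : v * (v * u) ^+ k.+1 = q^-1 *: (z * ((u * v) ^+ k * u)).
    by rewrite -u_vu exprS !mulrA vv -!scalerAl.
  exact/QZ/Qz.
- by rewrite mulrA v_uv -mulrA -exprSr; apply: Qvu.
- rewrite -v_uv mulrA vv -scalerAl.
  exact/QZ/Qz.
Qed.

Variable m : nat.
Local Notation w := ((u * v) ^+ m - (v * u) ^+ m).

(** Newton's recursion: g = (uv)^m and g' = (vu)^m commute, so that g^j + (- g')^j is
    a polynomial in g - g' and g g', and g g' is a multiple of a power of u^2. *)
Lemma power_sums (Q : A -> Prop) : Q 1 -> (forall b c, Q b -> Q c -> Q (b + c)) ->
  (forall d b, Q b -> Q (d *: b)) -> (forall b, Q b -> Q (z * b)) ->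
  (forall b, Q b -> Q (w * b)) ->
  forall j, Q ((u * v) ^+ (m * j) + (-1) ^+ j *: (v * u) ^+ (m * j)).
Proof.
move=> Q1 QD QZ Qz Qw.
pose g := (u * v) ^+ m; pose g' := (v * u) ^+ m.
have uvvu : (u * v) * (v * u) = q^-1 *: (z * z).
  rewrite mulrA -[u * v * v]mulrA vv -scalerAr -scalerAl.
  by rewrite -(square_central u) -mulrA.
have vuuv : (v * u) * (u * v) = q^-1 *: (z * z).
  by rewrite mulrA -[v * u * u]mulrA -expr2 -square_central -mulrA vv -scalerAr.
have uvC : GRing.comm (u * v) (v * u) by rewrite /GRing.comm uvvu vuuv.
have gC : GRing.comm g' g by apply/commrX/commr_sym/commrX.
have gg' : g * g' = (q^-1 *: (z * z)) ^+ m by rewrite -uvvu exprMn_comm.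
have Qgg' b : Q b -> Q (g * g' * b).
  rewrite gg'; elim: (m) => [|k IH] Qb; first by rewrite mul1r.
  rewrite exprS -mulrA -scalerAl -mulrA; apply/QZ/Qz/Qz/IH.
  exact: Qb.
have ps j : g ^+ j.+2 + (-1) ^+ j.+2 *: g' ^+ j.+2 =
    w * (g ^+ j.+1 + (-1) ^+ j.+1 *: g' ^+ j.+1) +
    g * g' * (g ^+ j + (-1) ^+ j *: g' ^+ j).
  have e1 : g * ((-1) ^+ j.+1 *: g' ^+ j.+1) = - (g * g' * ((-1) ^+ j *: g' ^+ j)).
    by rewrite exprS mulN1r scaleNr mulrN -!scalerAr exprS mulrA.
  have e2 : g' * g ^+ j.+1 = g * g' * g ^+ j by rewrite exprS mulrA gC.
  have e3 : g' * ((-1) ^+ j.+1 *: g' ^+ j.+1) = - ((-1) ^+ j *: g' ^+ j.+2).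
    by rewrite exprS mulN1r scaleNr mulrN -scalerAr -exprS.
  have abel (V : zmodType) (a b p r : V) : a + b = a - p - (r - b) + (r + p).
    by rewrite opprB -[RHS]addrA subrKA [b + p]addrC subrKA.
  have s2 : (-1) ^+ j.+2 = (-1) ^+ j :> K by rewrite !exprS !mulN1r opprK.
  rewrite s2 -/g -/g' mulrBl !mulrDr -exprS e1 e2 e3.
  exact: abel.
suff main j : Q (g ^+ j + (-1) ^+ j *: g' ^+ j) /\
    Q (g ^+ j.+1 + (-1) ^+ j.+1 *: g' ^+ j.+1).
  by move=> j; rewrite !exprM; apply: (main j).1.
elim: j => [|j [IH1 IH2]].
  rewrite !expr0 !expr1 scale1r scaleN1r; split; first exact: QD.
  by rewrite -[_ - _]mulr1; apply: Qw.
split; first exact: IH2.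
rewrite ps; exact: QD (Qw _ IH2) (Qgg' _ IH1).
Qed.

End Words.

Section AminusWords.
Variables (K : fieldType) (q : K).
Hypothesis q_neq0 : q != 0.
Local Notation A := (Aminus q).
Local Notation u := (Aminus_u q).
Local Notation v := (Aminus_v q).
Local Notation z := (u ^+ 2).

(** Modulo u^2, the algebra acts on K^2 by elementary matrices, and these separate
    the four kinds of words. *)
Lemma words_representation : exists rho : {rmorphism A -> 'M[K]_2},
  [/\ forall k, rho ((u * v) ^+ k.+1) = delta_mx 0 0,
      forall k, rho ((v * u) ^+ k.+1) = delta_mx 1 1,
      forall k, rho ((u * v) ^+ k * u) = delta_mx 0 1,
      forall k, rho ((v * u) ^+ k * v) = delta_mx 1 0 &
      forall c b, rho (c *: b) = c *: rho b].
Proof.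
have [||rho [ru rv] rZ] := @Aminus_representation K q 'M[K]_2 (@scalar_mx K 2)
    (delta_mx 0 1) (delta_mx 1 0).
- by move=> c b; rewrite /GRing.comm /= -[LHS]scalar_mxC.
- by rewrite !expr2 -!mulmxE !mul_delta_mx_0 // mulmx0.
have ruv : rho (u * v) = delta_mx 0 0 by rewrite rmorphM ru rv [LHS]mul_delta_mx.
have rvu : rho (v * u) = delta_mx 1 1 by rewrite rmorphM ru rv [LHS]mul_delta_mx.
have dM (i j : 'I_2) l : (delta_mx i i : 'M[K]_2) ^+ l * delta_mx i j = delta_mx i j.
  elim: l => [|l IH]; first by rewrite mul1r.
  by rewrite exprS -mulrA IH; apply: mul_delta_mx.
exists rho; split=> [k|k|k|k|c b].
- by rewrite rmorphXn ruv exprSr dM.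
- by rewrite rmorphXn rvu exprSr dM.
- by rewrite rmorphM rmorphXn ruv ru dM.
- by rewrite rmorphM rmorphXn rvu rv dM.
- by rewrite rZ -mulmxE mul_scalar_mx.
Qed.

Lemma even_words_free k (c d : K) :
  c *: (u * v) ^+ k.+1 + d *: (v * u) ^+ k.+1 = 0 -> c = 0 /\ d = 0.
Proof.
have [rho [ruv rvu _ _ rZ]] := words_representation.
move=> cd0; have /matrixP cd : c *: delta_mx 0 0 + d *: delta_mx 1 1 = 0 :> 'M[K]_2.
  by rewrite -(ruv k) -(rvu k) -!rZ -rmorphD cd0 rmorph0.
by have := cd 0 0; have := cd 1 1; rewrite !mxE /= !(mulr0, mulr1, addr0, add0r).
Qed.

Lemma odd_words_free k (c d : K) :
  c *: ((u * v) ^+ k * u) + d *: ((v * u) ^+ k * v) = 0 -> c = 0 /\ d = 0.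
Proof.
have [rho [_ _ ru rv rZ]] := words_representation.
move=> cd0; have /matrixP cd : c *: delta_mx 0 1 + d *: delta_mx 1 0 = 0 :> 'M[K]_2.
  by rewrite -(ru k) -(rv k) -!rZ -rmorphD cd0 rmorph0.
by have := cd 0 1; have := cd 1 0; rewrite !mxE /= !(mulr0, mulr1, addr0, add0r).
Qed.

Variable m : nat.
Hypothesis m_gt0 : (0 < m)%N.
Local Notation w := ((u * v) ^+ m - (v * u) ^+ m).

Local Notation R := {poly {poly K}}.
Local Notation S := ('X%:P : R).
Local Notation T := ('X : R).

(** In the representation of u and v by the matrices with rows (0, S), (T, 0)
    and (0, S T / q), (1, 0), the row (1, 0) is an eigenvector of u^2, of uv and
    of vu. *)
Lemma z_w_eigenrow : exists2 L : A -> R,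
  (forall b c, L (b + c) = L b + L c) &
  forall d i j, L (d *: (z ^+ i * w ^+ j)) = d%:P%:P *
    ((S * T) ^+ i * (S ^+ m - (S * T * (q^-1)%:P%:P * T) ^+ m) ^+ j).
Proof.
pose iota : {rmorphism K -> 'M[R]_2} := @scalar_mx R 2 \o polyC \o polyC.
pose e0 : 'rV[R]_2 := delta_mx 0 0; pose e1 : 'rV[R]_2 := delta_mx 0 1.
pose V12 : R := S * T * (q^-1)%:P%:P.
pose U : 'M[R]_2 := S *: delta_mx 0 1 + T *: delta_mx 1 0.
pose V : 'M[R]_2 := V12 *: delta_mx 0 1 + delta_mx 1 0.
have e0U : e0 *m U = S *: e1.
  by rewrite mulmxDr -!scalemxAr !mul_delta_mx_cond /= mulr0n scaler0 addr0 mulr1n.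
have e1U : e1 *m U = T *: e0.
  by rewrite mulmxDr -!scalemxAr !mul_delta_mx_cond /= mulr0n scaler0 add0r mulr1n.
have e0V : e0 *m V = V12 *: e1.
  by rewrite mulmxDr -!scalemxAr !mul_delta_mx_cond /= mulr0n addr0 mulr1n.
have e1V : e1 *m V = e0.
  by rewrite mulmxDr -!scalemxAr !mul_delta_mx_cond /= mulr0n scaler0 add0r mulr1n.
have rows2 (M N : 'M[R]_2) : e0 *m M = e0 *m N -> e1 *m M = e1 *m N -> M = N.
  move=> h0 h1; apply/row_matrixP => i; rewrite !rowE.
  by case: i => [[|[|]]//= ?].
have UV : U ^+ 2 = iota q * V ^+ 2.
  rewrite !expr2 -!mulmxE mul_scalar_mx; apply: rows2; rewrite -scalemxAr.
    rewrite mulmxA e0U -scalemxAl e1U mulmxA e0V -scalemxAl e1V !scalerA.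
    congr (_ *: _); rewrite mulrCA -!polyCM mulfV // polyC1 !mulr1.
    by [].
  rewrite mulmxA e1U -scalemxAl e0U mulmxA e1V e0V !scalerA.
  by congr (_ *: _); rewrite mulrCA -!polyCM mulfV // polyC1 !mulr1 mulrC.
have iotaC c b : GRing.comm (iota c) b by rewrite /GRing.comm /= -[LHS]scalar_mxC.
have [rho [ru rv] rZ] := Aminus_representation iotaC UV.
pose eig b r := e0 *m rho b = r *: e0.
have eigM b c r t : eig b r -> eig c t -> eig (b * c) (r * t).
  by move=> hb hc; rewrite /eig rmorphM -mulmxE mulmxA hb -scalemxAl hc scalerA.
have eigX b r n : eig b r -> eig (b ^+ n) (r ^+ n).
  move=> hb; elim: n => [|n IH]; last by rewrite !exprS; apply: eigM.
  by rewrite /eig !expr0 rmorph1 mulmx1 scale1r.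
have eigB b c r t : eig b r -> eig c t -> eig (b - c) (r - t).
  by move=> hb hc; rewrite /eig rmorphB mulmxBr hb hc -scalerBl.
have eig_z : eig z (S * T).
  by rewrite /eig rmorphXn ru expr2 -mulmxE mulmxA e0U -scalemxAl e1U scalerA.
have eig_uv : eig (u * v) S.
  by rewrite /eig rmorphM ru rv -mulmxE mulmxA e0U -scalemxAl e1V.
have eig_vu : eig (v * u) (V12 * T).
  by rewrite /eig rmorphM ru rv -mulmxE mulmxA e0V -scalemxAl e1U scalerA.
exists (fun b => (e0 *m rho b) 0 0) => [b c|d i j].
  by rewrite rmorphD mulmxDr mxE.
have E : eig (z ^+ i * w ^+ j) ((S * T) ^+ i * (S ^+ m - (V12 * T) ^+ m) ^+ j).
  by apply: eigM; apply: (eigX) => //; apply: eigB; apply: (eigX).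
by rewrite rZ -mulmxE mul_scalar_mx -scalemxAr [e0 *m _]E !mxE /= mulr1.
Qed.

(** The eigenvalue of z^i w^j starts with the term S^(i + m j) T^i in the order of
    increasing powers of T. *)
Lemma z_w_free (c : {malg K[(nat * nat)%type]}) : qcomb z w c = 0 -> c = 0.
Proof.
have [L LD LE] := z_w_eigenrow; move=> c0.
have L0 : L 0 = 0 by apply: (addrI (L 0)); rewrite -LD !addr0.
have sum0 : \sum_(k <- msupp c) L (mcoeff k c *: qmon z w k) = 0.
  by rewrite -(big_morph L LD L0) -/(qcomb z w c) c0.
have ST i : (S * T) ^+ i = ('X^i)%:P * 'X^i :> R.
  by rewrite exprMn rmorphXn.
have coef_lt d i j n N : (n < i)%N -> (L (d *: (z ^+ i * w ^+ j)))`_n`_N = 0.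
  move=> n_lt_i; rewrite LE ST -(mulrA ('X^i)%:P) (coefCM d%:P) (coefCM 'X^i).
  by rewrite coefXnM n_lt_i !mulr0 coef0.
have coef_eq d n j N :
    (L (d *: (z ^+ n * w ^+ j)))`_n`_N = d *+ (N == n + m * j)%N.
  rewrite LE ST -(mulrA ('X^n)%:P) (coefCM d%:P) (coefCM 'X^n) coefXnM ltnn subnn.
  rewrite -horner_coef0 horner_exp hornerD hornerN !horner_exp !hornerM hornerX.
  rewrite mulr0 expr0n (gtn_eqF m_gt0) subr0 hornerC -!exprM -exprD coefCM coefXn.
  by rewrite mulr_natr.
suff main n k : (k.1 < n)%N -> mcoeff k c = 0.
  by apply/malgP => k; rewrite (main k.1.+1) // mcoeff0.
elim: n k => [//|n IH] k; rewrite ltnS leq_eqVlt => /predU1P[k1|/IH//].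
have [//|ck] := eqVneq (mcoeff k c) 0.
have := congr1 (fun p : R => p`_n`_(n + m * k.2)) sum0.
rewrite !coef0 !coef_sum (bigD1_seq k) ?fset_uniq //=; last by rewrite -mcoeff_neq0.
rewrite [X in _ + X]big1 => [|l lk].
  by rewrite addr0 /qmon k1 coef_eq eqxx.
have [ln|nl|ln] := ltngtP l.1 n; rewrite /qmon.
- by rewrite (IH l ln) scale0r L0 !coef0.
- exact: coef_lt.
rewrite ln coef_eq eqn_add2l eqn_pmul2l //.
case: eqP => [e|_]; last exact: mulr0n.
by move: lk; rewrite (surjective_pairing l) (surjective_pairing k) ln k1 e eqxx.
Qed.

End AminusWords.

(** * The action of the Hopf algebra *)

Section Action.
Variables (K : fieldType) (H A : algType K) (a sp sm : H) (u v : A) (om : K).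
Variables (hs : hopf_structure H) (act : module_algebra hs A).
Hypothesis two_neq0 : 2 != 0 :> K.
Hypotheses (asp : a * sp = sp * a) (asm : a * sm = sm * a).
Local Notation e0 := (2^-1 *: (1 + a)).
Local Notation e1 := (2^-1 *: (1 - a)).
Hypothesis comul_a : tensor_eq (comul hs a) [:: (a, a)].
Hypothesis comul_sp :
  tensor_eq (comul hs sp) [:: (sp, e0 * sp); (sm, e1 * sp)].
Hypothesis comul_sm :
  tensor_eq (comul hs sm) [:: (sm, e0 * sm); (sp, e1 * sm)].
Hypotheses (eps_a : counit hs a = 1) (eps_sp : counit hs sp = 1).
Hypothesis eps_sm : counit hs sm = 1.
Hypotheses (spu : act sp u = v) (spv : act sp v = u).
Hypotheses (smu : act sm u = om *: v) (smv : act sm v = om^-1 *: u).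
Hypotheses (au : act a u = - u) (av : act a v = - v).
Local Notation r := (sp * sm).

Lemma actD g h b : act (g + h) b = act g b + act h b.
Proof. by have := act_linearl act b 1 g h; rewrite !scale1r. Qed.

Lemma act0 h : act h 0 = 0.
Proof. by have := act_linear act h (-1) 0 0; rewrite scaler0 addr0 scaleN1r addNr. Qed.

Lemma actDr h b c : act h (b + c) = act h b + act h c.
Proof. by have := act_linear act h 1 b c; rewrite !scale1r. Qed.

Lemma actZr h d b : act h (d *: b) = d *: act h b.
Proof. by have := act_linear act h d b 0; rewrite act0 !addr0. Qed.

Lemma act0l b : act 0 b = 0.
Proof. by have := act_linearl act b (-1) 0 0; rewrite scaler0 addr0 scaleN1r addNr. Qed.

Lemma actZ d h b : act (d *: h) b = d *: act h b.
Proof. by have := act_linearl act b d h 0; rewrite act0l !addr0. Qed.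

Lemma actNr h b : act h (- b) = - act h b.
Proof. by rewrite -scaleN1r actZr scaleN1r. Qed.

Lemma act_tensor h t b c : tensor_eq (comul hs h) t ->
  act h (b * c) = \sum_(p <- t) act p.1 b * act p.2 c.
Proof.
move=> ht; rewrite act_mul.
apply: (ht A (fun g k => act g b * act k c)) => [g d k l|k d g l].
  by rewrite (act_linearl act) mulrDr -scalerAr.
by rewrite (act_linearl act) mulrDl -scalerAl.
Qed.

Lemma act_a_mul b c : act a (b * c) = act a b * act a c.
Proof. by rewrite (act_tensor _ _ comul_a) big_seq1. Qed.

(** The comultiplication of s_+ and s_- involves the projections e0 and e1 onto the
    eigenspaces of a. As a acts by the parity of the degree, only one of its two
    terms is nonzero on a product with a homogeneous right factor. *)
Section Parity.
Variables (h h' : H).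
Hypothesis ah : a * h = h * a.
Hypothesis comul_h : tensor_eq (comul hs h) [:: (h, e0 * h); (h', e1 * h)].

Let act_e0 c : act (e0 * h) c = 2^-1 *: (act h c + act h (act a c)).
Proof. by rewrite -scalerAl mulrDl mul1r ah actZ actD actM. Qed.

Let act_e1 c : act (e1 * h) c = 2^-1 *: (act h c - act h (act a c)).
Proof.
rewrite -scalerAl mulrBl mul1r ah -scaleN1r actZ actD actZ actM.
by rewrite scaleN1r.
Qed.

Let half (b : A) : 2^-1 *: (b + b) = b.
Proof. by rewrite -mulr2n -scaler_nat scalerA mulVf // scale1r. Qed.

Lemma act_mul_even b c : act a c = c -> act h (b * c) = act h b * act h c.
Proof.
move=> ac; rewrite (act_tensor _ _ comul_h) big_cons big_seq1 /= act_e0 act_e1 ac.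
by rewrite subrr scaler0 mulr0 addr0 half.
Qed.

Lemma act_mul_odd b c : act a c = - c -> act h (b * c) = act h' b * act h c.
Proof.
move=> ac; rewrite (act_tensor _ _ comul_h) big_cons big_seq1 /= act_e0 act_e1 ac.
by rewrite actNr subrr scaler0 mulr0 add0r opprK half.
Qed.

End Parity.

Let sp_even := act_mul_even asp comul_sp.
Let sm_even := act_mul_even asm comul_sm.
Let sp_odd := act_mul_odd asp comul_sp.
Let sm_odd := act_mul_odd asm comul_sm.

Let act_1 h : act h 1 = counit hs h *: 1. Proof. exact: act_one. Qed.

Lemma sp_uv : act sp (u * v) = om *: (v * u).
Proof. by rewrite sp_odd // smu spv scalerAl. Qed.
Lemma sp_vu : act sp (v * u) = om^-1 *: (u * v).
Proof. by rewrite sp_odd // smv spu scalerAl. Qed.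
Lemma sm_uv : act sm (u * v) = om^-1 *: (v * u).
Proof. by rewrite sm_odd // spu smv scalerAr. Qed.
Lemma sm_vu : act sm (v * u) = om *: (u * v).
Proof. by rewrite sm_odd // spv smu scalerAr. Qed.

Let a_uv : act a (u * v) = u * v. Proof. by rewrite act_a_mul au av mulrNN. Qed.
Let a_vu : act a (v * u) = v * u. Proof. by rewrite act_a_mul au av mulrNN. Qed.

Let act_1K h : counit hs h = 1 -> act h 1 = 1.
Proof. by move=> e; rewrite act_1 e scale1r. Qed.

Lemma a_uvX k : act a ((u * v) ^+ k) = (u * v) ^+ k.
Proof.
elim: k => [|k IH]; first by rewrite expr0 act_1K.
by rewrite exprS act_a_mul a_uv IH.
Qed.

Lemma a_vuX k : act a ((v * u) ^+ k) = (v * u) ^+ k.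
Proof.
elim: k => [|k IH]; first by rewrite expr0 act_1K.
by rewrite exprS act_a_mul a_vu IH.
Qed.

Lemma sp_uvX k : act sp ((u * v) ^+ k) = om ^+ k *: (v * u) ^+ k.
Proof.
elim: k => [|k IH]; first by rewrite !expr0 act_1K // scale1r.
by rewrite exprS sp_even ?a_uvX // IH sp_uv -scalerAl -scalerAr scalerA -!exprS.
Qed.

Lemma sp_vuX k : act sp ((v * u) ^+ k) = om ^- k *: (u * v) ^+ k.
Proof.
elim: k => [|k IH]; first by rewrite !expr0 act_1K // invr1 scale1r.
rewrite exprS sp_even ?a_vuX // IH sp_vu -scalerAl -scalerAr scalerA -!exprVn.
by rewrite -!exprS.
Qed.

Lemma sm_uvX k : act sm ((u * v) ^+ k) = om ^- k *: (v * u) ^+ k.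
Proof.
elim: k => [|k IH]; first by rewrite !expr0 act_1K // invr1 scale1r.
rewrite exprS sm_even ?a_uvX // IH sm_uv -scalerAl -scalerAr scalerA -!exprVn.
by rewrite -!exprS.
Qed.

Lemma sm_vuX k : act sm ((v * u) ^+ k) = om ^+ k *: (u * v) ^+ k.
Proof.
elim: k => [|k IH]; first by rewrite !expr0 act_1K // scale1r.
by rewrite exprS sm_even ?a_vuX // IH sm_vu -scalerAl -scalerAr scalerA -!exprS.
Qed.

Lemma sp_uvXu k : act sp ((u * v) ^+ k * u) = om ^- k *: ((v * u) ^+ k * v).
Proof. by rewrite sp_odd // sm_uvX spu scalerAl. Qed.

Lemma sm_uvXu k : act sm ((u * v) ^+ k * u) = om ^+ k.+1 *: ((v * u) ^+ k * v).
Proof. by rewrite sm_odd // sp_uvX smu -scalerAl -scalerAr scalerA -exprSr. Qed.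

Lemma sp_vuXv k : act sp ((v * u) ^+ k * v) = om ^+ k *: ((u * v) ^+ k * u).
Proof. by rewrite sp_odd // sm_vuX spv scalerAl. Qed.

Lemma sm_vuXv k : act sm ((v * u) ^+ k * v) = om ^- k.+1 *: ((u * v) ^+ k * u).
Proof.
rewrite sm_odd // sp_vuX smv -scalerAl -scalerAr scalerA -!exprVn.
by rewrite -exprSr.
Qed.

Lemma r_uvX k : act r ((u * v) ^+ k) = om ^- (2 * k) *: (u * v) ^+ k.
Proof.
rewrite actM sm_uvX actZr sp_vuX scalerA -!exprVn -exprD.
by rewrite addnn mul2n.
Qed.

Lemma r_vuX k : act r ((v * u) ^+ k) = om ^+ (2 * k) *: (v * u) ^+ k.
Proof.
by rewrite actM sm_vuX actZr sp_uvX scalerA -exprD addnn mul2n.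
Qed.

Lemma r_uvXu k : act r ((u * v) ^+ k * u) = om ^+ (2 * k).+1 *: ((u * v) ^+ k * u).
Proof.
by rewrite actM sm_uvXu actZr sp_vuXv scalerA -exprD addSn addnn mul2n.
Qed.

Lemma r_vuXv k : act r ((v * u) ^+ k * v) = om ^- (2 * k).+1 *: ((v * u) ^+ k * v).
Proof.
rewrite actM sm_vuXv actZr sp_uvXu scalerA -!exprVn -exprD.
by rewrite addSn addnn mul2n.
Qed.

Lemma act_horner b mu (P : {poly K}) : act r b = mu *: b ->
  act (horner_alg r P) b = P.[mu] *: b.
Proof.
move=> rb; elim/poly_ind: P => [|P c IH].
  by rewrite rmorph0 act0l horner0 scale0r.
rewrite rmorphD rmorphM /= horner_algX horner_algC actD actM rb actZr IH.
by rewrite hornerMXaddC actZ act1 scalerA scalerDl mulrC.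
Qed.

Variable n : nat.
Hypotheses (n_gt0 : (0 < n)%N) (om_prim : n.-primitive_root om).

(** Every n-th root of unity mu is the eigenvalue of r on some word, and P(r) + s_+ Q(r)
    maps this word to P(mu) times itself plus a nonzero multiple of Q(mu) times an
    independent word. Hence P and Q vanish at mu. *)
Lemma act_faithful (h : H) :
  (exists P Q : {poly K}, h = horner_alg r P + sp * horner_alg r Q) ->
  (forall P : {poly K}, (forall k, root P (om ^+ k)) -> horner_alg r P = 0) ->
  (forall k (c d : K), c *: (u * v) ^+ k.+1 + d *: (v * u) ^+ k.+1 = 0 ->
    c = 0 /\ d = 0) ->
  (forall k (c d : K), c *: ((u * v) ^+ k * u) + d *: ((v * u) ^+ k * v) = 0 ->
    c = 0 /\ d = 0) ->
  (forall b, act h b = 0) -> h = 0.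
Proof.
move=> [P [Q def_h]] root0 even_free odd_free h0.
have om0 : om != 0.
  apply/eqP => om0; have := prim_expr_order om_prim.
  by rewrite om0 expr0n gtn_eqF // => /eqP; rewrite eq_sym oner_eq0.
suff rootPQ k : root P (om ^+ k) /\ root Q (om ^+ k).
  by rewrite def_h !root0 ?mulr0 ?addr0 // => k; have [] := rootPQ k.
have kill b b' mu c : act r b = mu *: b -> act sp b = c *: b' ->
    P.[mu] *: b + (Q.[mu] * c) *: b' = 0.
  move=> rb spb; rewrite -(h0 b) def_h actD actM !(act_horner _ rb) actZr spb.
  by rewrite scalerA.
have [k_odd|k_even] := boolP (odd k).
  have -> : k = (2 * k./2).+1 by rewrite -{1}[k]odd_double_half k_odd mul2n.
  have /odd_free[/eqP rP /eqP] := kill _ _ _ _ (r_uvXu k./2) (sp_uvXu k./2).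
  by rewrite mulf_eq0 invr_eq0 expf_eq0 (negPf om0) andbF orbF => rQ.
(* For k = 2 k', the word (uv)^l' with l' = n (k' + 1) - k' has eigenvalue om^k; the
   exponent l' is positive, as needed for the two words to be independent. *)
pose l := (n * k./2.+1 - k./2.+1)%N.
have -> : om ^+ k = om ^- (2 * l.+1).
  have e : (k + 2 * l.+1 = n * (2 * k./2.+1))%N.
    rewrite -{1}[k]odd_double_half (negPf k_even) /l; nia.
  apply: (mulIf (expf_neq0 (2 * l.+1) om0)); rewrite -exprD e exprM.
  by rewrite (prim_expr_order om_prim) expr1n mulVf // expf_neq0.
have /even_free[/eqP rP /eqP] := kill _ _ _ _ (r_uvX l.+1) (sp_uvX l.+1).
by rewrite mulf_eq0 expf_eq0 (negPf om0) andbF orbF => rQ.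
Qed.

Lemma act_mul_invariant h b c : b \in invariants act -> act h (b * c) = b * act h c.
Proof.
move=> /invariantsP b_inv; rewrite act_mul.
under eq_bigr do rewrite b_inv -scalerAl scalerAr -actZ.
rewrite -mulr_sumr; congr (_ * _); rewrite -[h in RHS](counitl hs).
elim: (comul hs h) => [|p t IH]; first by rewrite !big_nil act0l.
by rewrite !big_cons actD IH.
Qed.

Hypothesis H_gen : forall P : H -> Prop, P 1 ->
  (forall g h, P g -> P h -> P (g + h)) -> (forall c h, P h -> P (c *: h)) ->
  (forall h, P h -> P (sp * h)) -> (forall h, P h -> P (sm * h)) ->
  (forall h, P h -> P (a * h)) -> forall h, P h.

Lemma invariants_gen b : act sp b = b -> act sm b = b -> act a b = b ->
  b \in invariants act.
Proof.
move=> spb smb ab; apply/invariantsP; elim/H_gen => [|g h hg hh|c h hh|h hh|h hh|h hh].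
- by rewrite act1 rmorph1 scale1r.
- by rewrite actD hg hh rmorphD scalerDl.
- by rewrite actZ hh (linearZ_LR (counit hs)) scalerA.
- by rewrite actM hh actZr spb rmorphM /= eps_sp mul1r.
- by rewrite actM hh actZr smb rmorphM /= eps_sm mul1r.
- by rewrite actM hh actZr ab rmorphM /= eps_a mul1r.
Qed.

(** The span of u and v is stable; this is why the action preserves the degree. *)
Lemma act_generators h : (exists c d, act h u = c *: u + d *: v) /\
  (exists c d, act h v = c *: u + d *: v).
Proof.
have mono g : (exists k, act g u = k *: v /\ exists l, act g v = l *: u) ->
    forall b, (exists c d, b = c *: u + d *: v) ->
    exists c d, act g b = c *: u + d *: v.
  move=> [k [gu [l gv]]] _ [c [d ->]]; exists (d * l), (c * k).
  by rewrite actDr !actZr gu gv !scalerA addrC.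
have diag b : (exists c d, b = c *: u + d *: v) ->
    exists c d, act a b = c *: u + d *: v.
  move=> [c [d ->]]; exists (- c), (- d).
  by rewrite actDr !actZr au av !scalerN !scaleNr.
have spm : exists k, act sp u = k *: v /\ exists l, act sp v = l *: u.
  by exists 1; rewrite spu scale1r; split=> //; exists 1; rewrite spv scale1r.
have smm : exists k, act sm u = k *: v /\ exists l, act sm v = l *: u.
  by exists om; rewrite smu; split=> //; exists om^-1; rewrite smv.
elim/H_gen: h => [|g h [[c [d gu]] [c' [d' gv]]] [[e [f hu]] [e' [f' hv]]]||||].
- split; first by exists 1, 0; rewrite act1 scale1r scale0r addr0.
  by exists 0, 1; rewrite act1 scale1r scale0r add0r.
- split; first by exists (c + e), (d + f); rewrite actD gu hu addrACA -!scalerDl.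
  by exists (c' + e'), (d' + f'); rewrite actD gv hv addrACA -!scalerDl.
- move=> e h [[c [d hu]] [c' [d' hv]]]; split.
    by exists (e * c), (e * d); rewrite actZ hu scalerDr !scalerA.
  by exists (e * c'), (e * d'); rewrite actZ hv scalerDr !scalerA.
- by move=> h [hu hv]; rewrite !actM; split; apply: mono.
- by move=> h [hu hv]; rewrite !actM; split; apply: mono.
by move=> h [hu hv]; rewrite !actM; split; apply: diag.
Qed.

Hypothesis uv2 : u ^+ 2 = om *: v ^+ 2.

Lemma square_invariant : u ^+ 2 \in invariants act.
Proof.
apply: invariants_gen.
- by rewrite expr2 sp_odd // smu spu -expr2 uv2 -scalerAl.
- by rewrite expr2 sm_odd // smu spu -expr2 uv2 -scalerAr.
- by rewrite expr2 act_a_mul au mulrNN.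
Qed.

Variable m : nat.
Hypotheses (m_gt0 : (0 < m)%N) (om_m : om ^+ m = -1).
Local Notation w := ((u * v) ^+ m - (v * u) ^+ m).

Lemma difference_invariant : w \in invariants act.
Proof.
have inv_m : om ^- m = -1 by rewrite om_m invrN1.
apply: invariants_gen.
- by rewrite actDr actNr sp_uvX sp_vuX inv_m om_m !scaleN1r opprK addrC.
- by rewrite actDr actNr sm_uvX sm_vuX inv_m om_m !scaleN1r opprK addrC.
- by rewrite actDr actNr a_uvX a_vuX.
Qed.

(** The sum of the 2n elements of the dihedral group: 2n times the projection onto
    the invariants. *)
Definition reynolds (b : A) : A :=
  let c := \sum_(k < n) act (r ^+ k) b in c + act sp c.

Lemma reynoldsD b c : reynolds (b + c) = reynolds b + reynolds c.
Proof.
rewrite /reynolds; have -> : \sum_(k < n) act (r ^+ k) (b + c) =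
    \sum_(k < n) act (r ^+ k) b + \sum_(k < n) act (r ^+ k) c.
  by rewrite -big_split; apply: eq_bigr => k _; apply: actDr.
by rewrite actDr addrACA.
Qed.

Lemma reynoldsZ d b : reynolds (d *: b) = d *: reynolds b.
Proof.
rewrite /reynolds; have -> : \sum_(k < n) act (r ^+ k) (d *: b) =
    d *: \sum_(k < n) act (r ^+ k) b.
  by rewrite scaler_sumr; apply: eq_bigr => k _; apply: actZr.
by rewrite actZr scalerDr.
Qed.

Lemma reynolds_mul b c : b \in invariants act -> reynolds (b * c) = b * reynolds c.
Proof.
move=> b_inv; rewrite /reynolds; have -> : \sum_(k < n) act (r ^+ k) (b * c) =
    b * \sum_(k < n) act (r ^+ k) c.
  by rewrite mulr_sumr; apply: eq_bigr => k _; apply: act_mul_invariant.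
by rewrite act_mul_invariant // mulrDr.
Qed.

Lemma reynolds_invariant b : b \in invariants act -> reynolds b = (2 * n)%:R *: b.
Proof.
move=> /invariantsP b_inv.
have fix_r k : act (r ^+ k) b = b.
  by rewrite b_inv rmorphXn rmorphM /= eps_sp eps_sm mulr1 expr1n scale1r.
rewrite /reynolds; have -> : \sum_(k < n) act (r ^+ k) b = n%:R *: b.
  under eq_bigr do rewrite fix_r.
  by rewrite sumr_const card_ord scaler_nat.
by rewrite actZr b_inv eps_sp scale1r -scalerDl -natrD addnn mul2n.
Qed.

Lemma reynolds_eigen b mu : act r b = mu *: b ->
  reynolds b = (\sum_(k < n) mu ^+ k) *: (b + act sp b).
Proof.
move=> rb; rewrite /reynolds.
have -> : \sum_(k < n) act (r ^+ k) b = (\sum_(k < n) mu ^+ k) *: b.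
  rewrite scaler_suml; apply: eq_bigr => k _; elim: (val k) => [|l IH].
    by rewrite !expr0 act1 scale1r.
  by rewrite exprSr actM rb actZr IH scalerA -exprS.
by rewrite actZr scalerDr.
Qed.

Lemma geometric_sum0 (mu : K) : mu ^+ n = 1 -> mu != 1 -> \sum_(k < n) mu ^+ k = 0.
Proof.
move=> mun mu1; have := subrX1 mu n; rewrite mun subrr => /eqP.
by rewrite eq_sym mulf_eq0 subr_eq0 (negPf mu1) => /eqP.
Qed.

Hypothesis A_gen : forall P : A -> Prop, P 1 ->
  (forall b c, P b -> P c -> P (b + c)) -> (forall d b, P b -> P (d *: b)) ->
  (forall b, P b -> P (u * b)) -> (forall b, P b -> P (v * b)) -> forall b, P b.
Hypotheses (n_def : n = (2 * m)%N) (n_neq0 : n%:R != 0 :> K).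

(** The Reynolds operator kills the words of odd length and those of length 2k
    with m not dividing k; it maps the others to power sums. *)
Lemma invariants_generated (Q : A -> Prop) : Q 1 ->
  (forall b c, Q b -> Q c -> Q (b + c)) -> (forall d b, Q b -> Q (d *: b)) ->
  (forall b, Q b -> Q (u ^+ 2 * b)) -> (forall b, Q b -> Q (w * b)) ->
  forall b, b \in invariants act -> Q b.
Proof.
move=> Q1 QD QZ Qz Qw.
have om0 : om != 0.
  apply/eqP => om0; have := prim_expr_order om_prim.
  by rewrite om0 expr0n gtn_eqF // => /eqP; rewrite eq_sym oner_eq0.
have Q0 : Q 0 by rewrite -(scale0r 1); apply: QZ.
have Qsum j : Q ((u * v) ^+ (m * j) + (-1) ^+ j *: (v * u) ^+ (m * j)).
  exact: (power_sums om0 uv2 A_gen).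
have kill b mu : act r b = mu *: b -> mu ^+ n = 1 -> mu != 1 -> Q (reynolds b).
  by move=> rb mun mu1; rewrite (reynolds_eigen rb) geometric_sum0 // scale0r.
have root_n k : (om ^+ k) ^+ n = 1.
  by rewrite exprAC (prim_expr_order om_prim) expr1n.
have odd_neq1 k : om ^+ (2 * k).+1 != 1.
  by rewrite -(prim_order_dvd om_prim) n_def; apply/negP => /dvdnP[l]; lia.
have even_eq1 k : om ^+ (2 * k) = 1 -> exists j, k = (m * j)%N.
  move/eqP; rewrite -(prim_order_dvd om_prim) n_def dvdn_pmul2l // => /dvdnP[j ->].
  by exists j; rewrite mulnC.
have om_mj j : om ^+ (m * j) = (-1) ^+ j by rewrite exprM om_m.
have Qrey b : Q (reynolds b).
  move: b; apply: (words_span om0 uv2 A_gen) => [b c|d b|b|k|k|k|k].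
  - by rewrite reynoldsD; apply: QD.
  - by rewrite reynoldsZ; apply: QZ.
  - by rewrite reynolds_mul ?square_invariant //; apply: Qz.
  - have [/even_eq1[j def_k]|mu1] := eqVneq (om ^+ (2 * k)) 1; last first.
      by apply: kill (r_uvX k) _ _; rewrite ?invr_eq1 // exprVn root_n invr1.
    rewrite (reynolds_eigen (r_uvX k)); apply: (QZ).
    by rewrite sp_uvX def_k om_mj.
  - have [/even_eq1[j def_k]|mu1] := eqVneq (om ^+ (2 * k)) 1; last first.
      by apply: kill (r_vuX k) _ _; rewrite ?root_n.
    rewrite (reynolds_eigen (r_vuX k)); apply: (QZ).
    rewrite sp_vuX def_k om_mj -exprVn invrN1.
    have -> : (v * u) ^+ (m * j) + (-1) ^+ j *: (u * v) ^+ (m * j) = (-1) ^+ j *: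
        ((u * v) ^+ (m * j) + (-1) ^+ j *: (v * u) ^+ (m * j)) :> A.
      by rewrite scalerDr scalerA -expr2 sqrr_sign scale1r addrC.
    exact: QZ.
  - by apply: kill (r_uvXu k) _ _; rewrite ?root_n.
  by apply: kill (r_vuXv k) _ _; rewrite ?invr_eq1 // exprVn root_n invr1.
move=> b /reynolds_invariant rb.
rewrite -[b]scale1r -(mulVf (x := (2 * n)%:R : K)); last by rewrite natrM mulf_neq0.
by rewrite -scalerA -rb; apply: QZ.
Qed.

End Action.

(** * The ring of invariants as a quantum plane *)

(** In two direct sum decompositions, a map that respects the components also reflects
    them: if f x lies in one component, then the images of the other components of x
    vanish by uniqueness. *)
Lemma graded_embedding (I : eqType) (M N : zmodType) (f : {additive M -> N})
    (grM : I -> set M) (grN : I -> set N) : injective f ->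
  direct_sum grM -> direct_sum grN ->
  (forall i x, grM i x -> grN i (f x)) -> forall i x, grN i (f x) -> grM i x.
Proof.
move=> f_inj [subM sumM _] [subN _ freeN] fgr i x fx.
have [s0 [g0 [g0gr def_x]]] := sumM x.
have [//|p /mapP[j _ ->]|s [g [s_uniq ggr sum_g]]] :=
  @collect_components _ _ grM [seq (j, g0 j) | j <- s0]; first exact: g0gr.
have {g0gr}def_x : x = \sum_(j <- s) g j by rewrite -sum_g big_map.
pose h j := f (if j \in s then g j else 0) - (if j == i then f x else 0).
have h_gr j : grN j (h j).
  apply: (subN j).2.
    by apply: fgr; case: ifP => _; [apply: ggr|apply: (subM j).1].
  by case: eqP => [->|_]; [exact: fx|apply: (subN j).1].
pose t := undup (i :: s).
have t_uniq : uniq t by apply: undup_uniq.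
have sum_h : \sum_(j <- t) h j = 0.
  rewrite sumrB -raddf_sum /=.
  have -> : \sum_(j <- t) (if j \in s then g j else 0) = x.
    rewrite def_x -big_mkcond /= -big_filter; apply: perm_big.
    apply: uniq_perm => [||j]; rewrite ?filter_uniq //.
    by rewrite mem_filter mem_undup inE; case: (j \in s); rewrite ?orbT ?andbF.
  rewrite -big_mkcond /= -big_filter filter_pred1_uniq ?big_seq1 ?subrr //.
  by rewrite mem_undup mem_head.
have h0 j : j \in t -> h j = 0 by apply: freeN.
have g_out j : j \in s -> j != i -> g j = 0.
  move=> js ji; apply: f_inj; rewrite raddf0 -(h0 j).
    by rewrite /h js (negPf ji) subr0.
  by rewrite mem_undup inE js orbT.
rewrite def_x big_seq; elim/big_rec: _ => [|j y js yi]; first exact: (subM i).1.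
have [->|/(g_out j js) ->] := eqVneq j i; last by rewrite add0r.
have [M0 MB] := subM i.
by rewrite -[y]opprK; apply: (MB) => //; rewrite -[- y]sub0r; apply: MB.
Qed.

Section PolynomialMap.
Variables (K : fieldType) (A : algType K) (z w : A).
Hypothesis wz : w * z = z * w.

Local Notation msupp := mpoly.msupp.
Local Notation mcoeff := mpoly.mcoeff.

Definition pair_of (l : multinom 2) : nat * nat := (l 0, l 1).

Lemma pair_of_inj : injective pair_of.
Proof.
move=> l l' [e0 e1]; apply/mnmP => i.
by case: i => [[|[|]]//= h]; [move: e0|move: e1];
  congr (_ = _); congr (fun_of_multinom _ _); apply: val_inj.
Qed.

(** Evaluation at the commuting elements z and w. The last clause reduces the
    injectivity to the independence of the products z^i w^j. *)
Lemma ex_mpoly_map : exists phi : {lrmorphism {mpoly K[2]} -> A},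
  [/\ phi (mpolyX _ (mnm1 0)) = z, phi (mpolyX _ (mnm1 1)) = w &
      forall p, exists c, phi p = qcomb z w c /\ (c = 0 -> p = 0)].
Proof.
pose h (i : 'I_2) := if i == 0 then z else w.
pose phi : {mpoly K[2]} -> A := mpoly.mmap (in_alg A) h.
have h1 l : mpoly.mmap1 h l = z ^+ l 0 * w ^+ l 1.
  rewrite /mpoly.mmap1 big_ord_recl big_ord1 /h /=; congr (_ * _ ^+ l _).
  exact: val_inj.
have phiX l : phi (mpolyX K l) = z ^+ l 0 * w ^+ l 1.
  by rewrite -h1; apply: (mpoly.mmapX h (in_alg A)).
have phiZ c p : phi (c *: p) = c *: phi p.
  by rewrite -[RHS]mulr_algl; apply: (mpoly.mmapZ h (in_alg A)).
have phiB : zmod_morphism phi by apply: (raddfB (mpoly.mmap (in_alg A) h)).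
have phiD p p' : phi (p + p') = phi p + phi p'.
  exact: (raddfD (mpoly.mmap (in_alg A) h)).
have phi0 : phi 0 = 0 by apply: (raddf0 (mpoly.mmap (in_alg A) h)).
have phi_mon l l' :
    phi (mpolyX K l * mpolyX K l') = phi (mpolyX K l) * phi (mpolyX K l').
  rewrite -mpolyXD !phiX !mnmDE !exprD -!mulrA; congr (_ * _).
  rewrite !mulrA; congr (_ * _).
  by apply/esym/commrX/commr_sym/commrX; rewrite /GRing.comm wz.
have phiM : monoid_morphism phi.
  split=> [|p p'].
    by rewrite -(mpolyX0 2 K) phiX !mnm0E !expr0 mulr1.
  elim/mpolyind: p => [|c l p _ _ IH]; first by rewrite mul0r phi0 mul0r.
  rewrite mulrDl !phiD mulrDl IH; congr (_ + _).
  rewrite -scalerAl !phiZ -scalerAl; congr (_ *: _).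
  elim/mpolyind: p' {p IH} => [|d l' p' _ _ IH]; first by rewrite mulr0 phi0 mulr0.
  by rewrite mulrDr !phiD mulrDr IH -scalerAr !phiZ -scalerAr phi_mon.
pose phiL : {lrmorphism {mpoly K[2]} -> A} := HB.pack phi
  (GRing.isZmodMorphism.Build _ _ phi phiB)
  (GRing.isMonoidMorphism.Build _ _ phi phiM)
  (GRing.isScalable.Build K _ _ _ phi phiZ).
exists phiL; split=> [||p].
- by rewrite [LHS]phiX !mnm1E mulr1.
- by rewrite [LHS]phiX !mnm1E mul1r.
exists (\sum_(l <- msupp p) mkmalgU (pair_of l) (mcoeff l p)); split.
  rewrite raddf_sum -[LHS]/(phi p) /phi /mpoly.mmap; apply: eq_bigr => l _.
  by rewrite h1 [RHS]qcombU; apply: mulr_algl.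
move=> c0; apply/mpolyP => l; rewrite mpoly.mcoeff0.
apply/eqP/contraT => pl; have lp : l \in msupp p by rewrite mpoly.mcoeff_msupp.
have := congr1 (monalg.mcoeff (pair_of l)) c0.
rewrite raddf_sum (bigD1_seq l) ?mpoly.msupp_uniq //= mcoeffUU big1 ?addr0.
  by rewrite monalg.mcoeff0 => pl0; rewrite pl0 eqxx in pl.
by move=> l' l'l; rewrite mcoeffU (inj_eq pair_of_inj) (negPf l'l).
Qed.

End PolynomialMap.

Section InvariantRing.
Variables (K : fieldType) (H A : algType K) (hs : hopf_structure H).
Variables (act : module_algebra hs A) (z w : A).
Hypotheses (z_inv : z \in invariants act) (w_inv : w \in invariants act).
Hypothesis wz : w * z = z * w.
Hypothesis generated : forall Q : A -> Prop, Q 1 ->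
  (forall b c, Q b -> Q c -> Q (b + c)) -> (forall d b, Q b -> Q (d *: b)) ->
  (forall b, Q b -> Q (z * b)) -> (forall b, Q b -> Q (w * b)) ->
  forall b, b \in invariants act -> Q b.
Hypothesis free : forall c, qcomb z w c = 0 -> c = 0.
Local Notation B := (invariant_ring act).

Definition inv_z : B := exist _ z z_inv.
Definition inv_w : B := exist _ w w_inv.

Lemma val_qmon k : val (qmon inv_z inv_w k) = qmon z w k.
Proof. by rewrite rmorphM !rmorphXn. Qed.

Lemma invariant_quantum_plane : quantum_plane inv_z inv_w 1.
Proof.
apply: quantum_plane_intro.
- by rewrite scale1r; apply: val_inj; rewrite !rmorphM.
- exact: oner_neq0.
- move=> P P1 PD PZ Pz Pw b.
  suff [b' /val_inj <-] : exists2 b' : B, val b' = val b & P b' by [].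
  move: (valP b); apply: (generated (Q := fun c => exists2 b' : B, val b' = c & P b')).
  - by exists 1; rewrite ?rmorph1.
  - move=> _ _ [b1 <- Pb1] [b2 <- Pb2].
    by exists (b1 + b2); [rewrite raddfD|apply: PD].
  - by move=> d _ [b1 <- Pb1]; exists (d *: b1); [rewrite linearZ|apply: PZ].
  - by move=> _ [b1 <- Pb1]; exists (inv_z * b1); [rewrite rmorphM|apply: Pz].
  - by move=> _ [b1 <- Pb1]; exists (inv_w * b1); [rewrite rmorphM|apply: Pw].
move=> c c0; apply: free.
have /(congr1 val) := c0; rewrite raddf0 => <-.
rewrite raddf_sum; apply: eq_bigr => k _.
by rewrite -val_qmon; exact/esym/(linearZ_LR (val : {linear B -> A})).
Qed.

Lemma polynomial_invariants : exists phi : {lrmorphism {mpoly K[2]} -> A},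
  [/\ injective phi, phi (mpolyX _ (mnm1 0)) = z, phi (mpolyX _ (mnm1 1)) = w &
      forall b, b \in invariants act <-> exists p, b = phi p].
Proof.
have [phi [phi0 phi1 phiE]] := ex_mpoly_map wz; exists phi.
have phi_inj : injective phi.
  apply: raddf_inj => p p0; have [c [def_p c0]] := phiE p.
  by apply/c0/free; rewrite -def_p.
split; [exact: phi_inj|exact: phi0|exact: phi1|move=> b; split=> [|[p ->]]].
  apply: (generated (Q := fun b => exists p, b = phi p)).
  - by exists 1; rewrite rmorph1.
  - by move=> _ _ [p ->] [r ->]; exists (p + r); rewrite raddfD.
  - by move=> d _ [p ->]; exists (d *: p); rewrite linearZ.
  - by move=> _ [p ->]; exists (mpolyX _ (mnm1 0) * p); rewrite rmorphM /= phi0.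
  by move=> _ [p ->]; exists (mpolyX _ (mnm1 1) * p); rewrite rmorphM /= phi1.
have [c [-> _]] := phiE p; rewrite /qcomb.
apply: rpred_sum => k _; apply: rpredZ; apply: rpredM; apply: rpredX.
  exact: z_inv.
exact: w_inv.
Qed.

(** Both gradings are direct sums, so that an inclusion suffices, and this one is
    checked on the generators. *)
Lemma invariant_gradingE (gr : nat -> set A) (d1 d2 : nat) :
  (0 < d1)%N -> (0 < d2)%N -> connected_graded gr -> gr d1 z -> gr d2 w ->
  @invariant_gr _ _ _ _ act gr = qplane_gr invariant_quantum_plane d1 d2.
Proof.
move=> d1_gt0 d2_gt0 [gr_sum grM gr0] zd wd.
pose QP := invariant_quantum_plane.
have [qgr_sum _ _] := qplane_connected QP d1_gt0 d2_gt0.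
have gr1 : gr 0%N 1 by rewrite gr0; exists 1; rewrite ?scale1r.
have grZ n c b : gr n b -> gr n (c *: b).
  rewrite -mulr_algl -{2}[n]add0n; apply: grM.
  by rewrite gr0; exists c.
have grX n b k : gr n b -> gr (k * n)%N (b ^+ k).
  by move=> bn; elim: k => [//|k IH]; rewrite exprS mulSn; apply: grM.
have [sub _ _] := gr_sum.
have sub_gr n b : qplane_gr QP d1 d2 n b -> gr n (val b).
  move=> bn; elim/qplane_gr_ind: b / bn => [|b c hb hc|c k <-].
  - by rewrite raddf0; apply: (sub n).1.
  - rewrite [val _]raddfD -[X in gr n (_ + X)]opprK; apply: (sub n).2 => //.
    by rewrite -[- _]sub0r; apply: (sub n).2 => //; apply: (sub n).1.
  rewrite [val _](linearZ_LR (val : {linear B -> A})); apply: grZ.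
  by rewrite [X in gr _ X]val_qmon; apply: grM; apply: grX.
apply/funext => n; apply/seteqP; split=> b; last by apply: sub_gr.
by move=> bn; apply: (graded_embedding (f := val : {additive B -> A}) val_inj qgr_sum gr_sum sub_gr).
Qed.

End InvariantRing.

(** * Roots of unity *)

Lemma sign_coprime (A : nzRingType) (i m : nat) :
  coprime i (2 * m) -> (-1) ^+ i = -1 :> A.
Proof.
by rewrite coprimeMr coprimen2 => /andP[i_odd _]; rewrite -signr_odd i_odd.
Qed.

Section RootsOfUnity.
Variables (R : realType) (m : nat).
Hypothesis m_gt0 : (0 < m)%N.
Local Notation lam := (lambda R m).
Local Notation t := (pi / m%:R : R).

Lemma lambdaX k : lam ^+ k = (cos (t *+ k) +i* sin (t *+ k))%C.
Proof.
elim: k => [|k IH]; first by rewrite expr0 mulr0n cos0 sin0.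
rewrite exprS IH mulrS cosD sinD /lambda; apply/eqP; rewrite eq_complex /=.
by rewrite eqxx /= [sin _ * cos _]mulrC addrC eqxx.
Qed.

Lemma lambda_m : lam ^+ m = -1.
Proof.
have m_neq0 : m%:R != 0 :> R by rewrite pnatr_eq0 -lt0n.
rewrite lambdaX -[t *+ m]mulr_natr divfK // cospi sinpi; apply/eqP.
by rewrite eq_complex /= oppr0 !eqxx.
Qed.

(** The cosine is injective on [0, pi], so that lambda^k is not 1 for 0 < k <= m; the
    exponents between m and 2m reduce to these by taking inverses. *)
Lemma lambda_prim : (2 * m).-primitive_root lam.
Proof.
have lam2m : lam ^+ (2 * m) = 1 by rewrite mulnC exprM lambda_m expr2 mulrNN mulr1.
have m_gt0R : 0 < m%:R :> R by rewrite ltr0n.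
have small k : (0 < k <= m)%N -> lam ^+ k != 1.
  move=> /andP[k_gt0 km]; apply/eqP; rewrite lambdaX => /(congr1 (@complex.Re R)) /=.
  rewrite -[RHS](cos0 R) => cos_eq.
  have t_gt0 : 0 < t *+ k by rewrite pmulrn_lgt0 // divr_gt0 ?pi_gt0.
  have t_le : t *+ k <= pi.
    rewrite -[t *+ k]mulr_natr mulrAC ler_pdivrMr // ler_pM2l ?pi_gt0 //.
    by rewrite ler_nat.
  have t0 : t *+ k = 0.
    by apply: cos_inj cos_eq; rewrite !in_itv /= ?lexx ?pi_ge0 ?(ltW t_gt0).
  by rewrite t0 ltxx in t_gt0.
apply/andP; split; first by rewrite muln_gt0.
apply/forallP => k; rewrite unity_rootE.
have [->|k_neq] := eqVneq k.+1 (2 * m)%N; first by rewrite lam2m !eqxx.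
have k_lt : (k.+1 < 2 * m)%N by rewrite ltn_neqAle k_neq /=.
apply/eqP/negbTE; have [km|km] := leqP k.+1 m; first exact: small.
apply/eqP => lk; have /negP[] := small (2 * m - k.+1)%N ltac:(lia).
have : lam ^+ (2 * m - k.+1) * lam ^+ k.+1 = 1 by rewrite -exprD subnK // ltnW.
by rewrite lk mulr1 => ->.
Qed.

Variable i : nat.
Hypothesis im : coprime i (2 * m).

Lemma lambdaX_prim : (2 * m).-primitive_root (lam ^+ i).
Proof. by have := exp_prim_root lambda_prim i; rewrite (eqP im) divn1. Qed.

Lemma lambdaX_m : (lam ^+ i) ^+ m = -1.
Proof. by rewrite exprAC lambda_m (sign_coprime _ im). Qed.

End RootsOfUnity.

(** * The reflection Hopf algebra *)

Section PreservesGrading.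
Variables (K : fieldType) (H : algType K) (q : K) (hs : hopf_structure H).
Variable act : module_algebra hs (Aminus q).
Local Notation u := (Aminus_u q).
Local Notation v := (Aminus_v q).
Hypothesis act_uv : forall h,
  (exists c d, act h u = c *: u + d *: v) /\
  (exists c d, act h v = c *: u + d *: v).

Lemma Aminus_preserves_grading : preserves_grading act (@Aminus_gr K q).
Proof.
move=> n h b bn; move: n b bn h.
pose P n b := forall h, Aminus_gr n (act h b).
suff: forall n b, Aminus_gr n b -> P n b by [].
have step n b h x : P n b -> (forall g, exists c d, act g x = c *: u + d *: v) ->
    Aminus_gr n.+1 (act h (x * b)).
  move=> Pb act_x; rewrite act_mul; elim: (comul hs h) => [|p s IH].
    by rewrite big_nil; apply: Aminus_gr0.
  rewrite big_cons; apply: Aminus_grD IH.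
  have [c [d ->]] := act_x p.1; rewrite mulrDl -!scalerAl.
  by apply: Aminus_grD; apply: Aminus_grZ;
    [apply: Aminus_gr_mulu|apply: Aminus_gr_mulv].
apply: Aminus_gr_ind => [n|n b c hb hc|n d b hb||n b hb|n b hb] h.
- by rewrite act0; apply: Aminus_gr0.
- by rewrite actDr; apply: Aminus_grD.
- by rewrite actZr; apply: Aminus_grZ.
- by rewrite act_one; apply: Aminus_grZ; exists 1; [exact: homogeneous1|rewrite rmorph1].
- by apply: step => // g; have [] := act_uv g.
- by apply: step => // g; have [] := act_uv g.
Qed.

End PreservesGrading.

Section Reflection.
Variables (K : fieldType) (m : nat) (om s : K).
Hypotheses (m_gt0 : (0 < m)%N) (two_neq0 : 2 != 0 :> K).
Hypothesis n_neq0 : (2 * m)%:R != 0 :> K.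
Hypotheses (om_prim : (2 * m).-primitive_root om) (om_m : om ^+ m = -1).
Hypothesis s2 : s ^+ 2 = om.
Local Notation H := (B4m K m).
Local Notation a := (B4m_a K m).
Local Notation sp := (B4m_sp K m).
Local Notation sm := (B4m_sm K m).
Local Notation A := (Aminus om).
Local Notation u := (Aminus_u om).
Local Notation v := (Aminus_v om).
Local Notation z := (u ^+ 2).
Local Notation w := ((u * v) ^+ m - (v * u) ^+ m).
Variables (hs : hopf_structure H) (act : module_algebra hs A).
Hypothesis hB : masuoka_structure hs.
Hypotheses (spu : act sp u = v) (spv : act sp v = u).
Hypotheses (smu : act sm u = om *: v) (smv : act sm v = om^-1 *: u).
Hypotheses (au : act a u = - u) (av : act a v = - v).

Let n_gt0 : (0 < 2 * m)%N. Proof. by rewrite muln_gt0. Qed.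

Let om_neq0 : om != 0.
Proof.
apply/eqP => om0; have := om_m; rewrite om0 expr0n gtn_eqF // => /eqP.
by rewrite eq_sym oppr_eq0 oner_eq0.
Qed.

Let s_neq0 : s != 0.
Proof.
by apply/eqP => s0; move: om_neq0; rewrite -s2 s0 expr0n eqxx.
Qed.

Let comul_a : tensor_eq (comul hs a) [:: (a, a)]. Proof. by have [[]] := hB. Qed.
Let eps_a : counit hs a = 1. Proof. by have [[]] := hB. Qed.
Let comul_sp := let: And5 _ h _ _ _ := hB in h.
Let comul_sm := let: And5 _ _ h _ _ := hB in h.
Let eps_sp : counit hs sp = 1. Proof. by have [_ _ _ []] := hB. Qed.
Let eps_sm : counit hs sm = 1. Proof. by have [_ _ _ []] := hB. Qed.

Let z_inv : z \in invariants act.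
Proof.
exact: (square_invariant two_neq0 (@B4m_asp K m) (@B4m_asm K m) comul_a comul_sp
  comul_sm eps_a eps_sp eps_sm spu smu au (@B4m_ind K m) (Aminus_rel om)).
Qed.

Let w_inv : w \in invariants act.
Proof.
exact: (difference_invariant two_neq0 (@B4m_asp K m) (@B4m_asm K m) comul_a comul_sp
  comul_sm eps_a eps_sp eps_sm spu spv smu smv au av (@B4m_ind K m) om_m).
Qed.

Let generated (Q : A -> Prop) : Q 1 ->
  (forall b c, Q b -> Q c -> Q (b + c)) -> (forall d b, Q b -> Q (d *: b)) ->
  (forall b, Q b -> Q (z * b)) -> (forall b, Q b -> Q (w * b)) ->
  forall b, b \in invariants act -> Q b.
Proof.
exact: (invariants_generated two_neq0 (@B4m_asp K m) (@B4m_asm K m) comul_a comul_sp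
  comul_sm eps_a eps_sp eps_sm spu spv smu smv au av n_gt0 om_prim (@B4m_ind K m)
  (Aminus_rel om) m_gt0 om_m (@Aminus_ind K om) erefl n_neq0).
Qed.

Let wz : w * z = z * w.
Proof.
exact/esym/(square_central (Aminus_rel om) (@Aminus_ind K om)). Qed.

Let free (c : {malg K[(nat * nat)%type]}) : qcomb z w c = 0 -> c = 0.
Proof. exact: z_w_free. Qed.

Theorem invariants_polynomial : exists phi : {lrmorphism {mpoly K[2]} -> A},
  [/\ injective phi, phi (mpolyX _ (mnm1 0)) = z, phi (mpolyX _ (mnm1 1)) = w &
      forall b, b \in invariants act <-> exists p, b = phi p].
Proof. exact: (polynomial_invariants z_inv w_inv wz generated free). Qed.

Lemma B4m_act_inner_faithful : inner_faithful act.
Proof.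
move=> I _ I0 h Ih.
apply: (act_faithful two_neq0 (@B4m_asp K m) (@B4m_asm K m) comul_a comul_sp
  comul_sm eps_a eps_sp eps_sm spu spv smu smv au av n_gt0 om_prim).
- exact: (dihedral_span n_gt0 (@B4m_spsp K m) (@B4m_r2m K m) (@B4m_sprspr K m)
    (@B4m_dihedral_ind K m)).
- by move=> P; apply: (dihedral_poly_eq0 (@B4m_r2m K m) om_prim).
- exact: even_words_free.
- exact: odd_words_free.
by move=> b; apply: I0.
Qed.

(** The algebra A and its ring of invariants are quantum planes, generated in degrees
    1, 1 and 2, 2m respectively. *)
Theorem B4m_reflection (R : realType) : reflection_hopf_algebra R act (@Aminus_gr K om).
Proof.
have grE := Aminus_grE s2 s_neq0 two_neq0.
split.
- exact: (dihedral_semisimple n_gt0 (@B4m_spsp K m) (@B4m_r2m K m) (@B4m_sprspr K m)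
    (@B4m_dihedral_ind K m)).
- exact: B4m_act_inner_faithful.
- apply: Aminus_preserves_grading => h.
  exact: (act_generators spu spv smu smv au av (@B4m_ind K m)).
- by exists 2%N; rewrite grE; apply: quantum_plane_AS_regular.
exists 2%N; rewrite (invariant_gradingE z_inv w_inv wz generated free (d1 := 2%N)
  (d2 := (2 * m)%N)) //.
- by apply: quantum_plane_AS_regular.
- by rewrite grE; apply: qplane_connected.
- by rewrite expr2 -[X in u * X]mulr1; apply/Aminus_gr_mulu/Aminus_gr_mulu/Aminus_gr1.
rewrite -scaleN1r; apply: Aminus_grD; last apply: Aminus_grZ.
  elim: m => [|k IH]; first exact: Aminus_gr1.
  by rewrite mulnS exprS -mulrA; apply/Aminus_gr_mulu/Aminus_gr_mulv.
elim: m => [|k IH]; first exact: Aminus_gr1.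
by rewrite mulnS exprS -mulrA; apply/Aminus_gr_mulv/Aminus_gr_mulu.
Qed.

End Reflection.

Theorem theorem4p7 (R : realType) (m i : nat)
    (hm : (2 <= m)%N) (hi : (1 <= i <= m - 1)%N) (him : coprime i (2 * m)%N)
    (lam := lambda R m)
    (A := Aminus (lam ^+ i)) (u := Aminus_u (lam ^+ i) : A)
    (v := Aminus_v (lam ^+ i) : A)
    (hs : hopf_structure (B4m R[i] m)) (hB : masuoka_structure hs)
    (act : module_algebra hs A) (hact : acts_by_pi lam i u v act) :
  (exists phi : {lrmorphism {mpoly R[i][2]} -> A},
     [/\ injective phi,
         phi (mpolyX _ (mnm1 0)) = u ^+ 2,
         phi (mpolyX _ (mnm1 1)) = (u * v) ^+ m - (v * u) ^+ m &
         forall x, x \in invariants act <-> exists p, x = phi p]) /\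
  reflection_hopf_algebra R act (@Aminus_gr _ (lam ^+ i)).
Proof.
have m_gt0 : (0 < m)%N by apply: leq_trans hm.
have two_neq0 : 2 != 0 :> R[i] by rewrite pnatr_eq0.
have n_neq0 : (2 * m)%:R != 0 :> R[i] by rewrite pnatr_eq0 -lt0n muln_gt0.
have [[spu spv] [smu smv] [au av]] := hact.
rewrite (sign_coprime _ him) !scaleN1r in au av.
have om_prim := lambdaX_prim R m_gt0 him; have om_m := lambdaX_m R m_gt0 him.
split.
  exact: (invariants_polynomial m_gt0 two_neq0 n_neq0 om_prim om_m hB spu spv smu smv
    au av).
exact: (B4m_reflection m_gt0 two_neq0 n_neq0 om_prim om_m (sqrtCK _) hB spu spv smu smv
    au av).
Qed.
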